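(* Assume: (1) the probability measures $\mu,\nu$ on $\mathbb{R}^d$ have supports included in $B_R$; (2) $\mu,\nu$ have densities with respect to the Lebesgue measure on $B_R$; (3) there exists $\tilde z_0\in C$ such that $\tilde z_0$ coincides with $z_0$ on $\mathrm{supp}(\mu)$ and $\tilde z_0^*$ coincides with $z_0^*$ on $\mathrm{supp}(\nu)$; (4) $C$ is a set of functions $\mathbb{R}^d\to\mathbb{R}$ which are uniformly bounded (in absolute value) by $M(r)$ on $B_r$ for every $r\ge 0$, uniformly lower bounded by $l$, and $\lambda$-strongly convex ($\lambda>0$). Let $\hat z_C\in\arg\min_{z\in C}\hat J(z)$ be the empirical potential computed from $n$ samples of each measure. If the unbalanced optimal transport potential $z_0$ between $\mu$ and $\nu$ belongs to $C$, then there exist constants $M'=M'(M,R,\lambda,l,\varphi)$, $R'=R'(M,R,\lambda,l)$ and $L=L(M,R,\lambda,l,\varphi)$, depending only on the indicated quantities, such that for all $0\le\delta\leq \frac{M'}{L}$, $$\mathbb{E}\big[d_{H^\circ}^\lambda(\hat{z}_C, z_0)^2\big] \;\leq\; 64\left(\delta + \frac{1}{\sqrt{n}} \int_{\delta/4}^{M'/L} \sqrt{H(C, L^\infty_{B_{R'}}, Lu)}\, du\right).$$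
   Context: $B_r$ is the Euclidean ball of $\mathbb{R}^d$ centered at $0$ with radius $r$. $q(x)=\frac12\|x\|^2$. $\varphi:\mathbb{R}_+\to\mathbb{R}_+\cup\{+\infty\}$ is convex, lower semicontinuous, $\varphi(1)=0$, with Legendre transform $\varphi^*(s)=\sup_{r\ge0}(rs-\varphi(r))$, and $\varphi^*$ is differentiable. For a function $z$, $z^*(y)=\sup_x(\langle x,y\rangle-z(x))$ (supremum over the domain of $z$). Semi-dual functional: $J_{\mu,\nu}(z)=\int\varphi^*(z-q)\,d\mu+\int\varphi^*(z^*-q)\,d\nu$. The (unbalanced optimal transport) potential $z_0$ is a minimizer of $J=J_{\mu,\nu}$ over bounded continuous convex functions on a compact set $X$ carrying $\mu$. $\hat\mu,\hat\nu$ are the empirical measures of $n$ independent samples of $\mu$ and of $\nu$ respectively, and $\hat J=J_{\hat\mu,\hat\nu}$. The expectation is over the samples. Pseudo-distance: with $\tilde\nu=(\varphi^* )'(z_0^*-q)\,\nu$ and $\mathbb{E}_\beta[f]=\int f\,d\beta$, $$d_{H^\circ}^\lambda(f,g)^2=\frac{1}{2\lambda}\,\mathbb{E}_{\tilde\nu}[\|\nabla(f^*-g^* )\|^2]+C'\big(\mathbb{E}_\nu[(f^*-g^* )^2]+\mathbb{E}_\mu[(f-g)^2]\big),$$ where $C'\ge0$ is a uniform lower bound, over $z\in C$, of the convexity constants of $\varphi^*$, i.e. $\varphi^*(b)-\varphi^*(a)\ge(\varphi^* )'(a)(b-a)+C'(b-a)^2$ for $(a,b)=(z_0(x)-q(x),z(x)-q(x))$,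 $x\in\mathrm{supp}(\mu)$, and for $(a,b)=(z_0^*(y)-q(y),z^*(y)-q(y))$, $y\in\mathrm{supp}(\nu)$, for all $z\in C$ (the value $C'=0$ is allowed). Metric entropy: $H(C,\|\cdot\|,u)$ is the logarithm of the covering number of $C$ at scale $u$ for the (semi-)norm $\|\cdot\|$ (minimal number of balls of radius $u$ needed to cover $C$); $L^\infty_{B_{R'}}$ is the sup norm over $B_{R'}$. *)

(* Defs.v *)
(* R^d is 'rV[R]_d, over an arbitrary R : realType. *)
From HB Require Import structures.
From mathcomp Require Import all_boot all_order all_algebra.
From mathcomp Require Import all_classical all_reals all_analysis measurable_realfun.

Set Implicit Arguments.
Unset Strict Implicit.
Unset Printing Implicit Defensive.
Import Order.TTheory GRing.Theory Num.Theory.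
Import numFieldNormedType.Exports.

Local Open Scope classical_set_scope.
Local Open Scope ring_scope.

(* Borel sigma-algebra of R^d *)
HB.instance Definition _ (R : realType) (d : nat) :=
  @isMeasurable.Build (sigma_display (@open 'rV[R]_d)) 'rV[R]_d
    <<s @open 'rV[R]_d >> (@sigma_algebra0 _ setT (@open 'rV[R]_d))
    (@sigma_algebraC _ (@open 'rV[R]_d))
    (@sigma_algebra_bigcup _ setT (@open 'rV[R]_d)).

Section borel_rV.
Context {R : realType}.

Lemma open_measurable_rV d (U : set 'rV[R]_d) : open U -> measurable U.
Proof. by move=> oU; exact: sub_sigma_algebra. Qed.

Lemma measurable_coord d (i : 'I_d) :
  measurable_fun [set: 'rV[R]_d] (fun v : 'rV[R]_d => v ord0 i).
Proof.
apply: (measurability _ (RGenOInfty.measurableE R)) => _ [_ [x ->] <-].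
rewrite setTI; apply: open_measurable_rV.
by apply: open_comp; [move=> v _; exact: coord_continuous|exact: interval_open].
Qed.

Lemma measurable_fun_rV disp (T : measurableType disp) d (f : T -> 'rV[R]_d) :
  (forall i, measurable_fun [set: T] (fun t => f t ord0 i)) ->
  measurable_fun [set: T] f.
Proof.
move=> mf; apply: (measurability (@open 'rV[R]_d)) => // _ [U oU <-].
rewrite setTI.
pose box (c : 'rV[rat]_d * rat) : set 'rV[R]_d :=
  [set w | forall i, `|ratr (c.1 ord0 i) - w ord0 i| < ratr c.2].
rewrite (_ : f @^-1` U = \bigcup_c
    (if `[< box c `<=` U >] then f @^-1` box c else set0)); last first.
  apply/seteqP; split=> [t Ut|t [c _]]; last first.
    by case: ifPn => // /asboolP; apply.
  have /nbhs_ballP[e /= e0 eU] : nbhs (f t) U by apply: open_nbhs_nbhs.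
  have /rat_in_itvoo[r] : 0 < e / 2 by rewrite divr_gt0.
  rewrite in_itv/= => /andP[r0 re].
  have q_ex i : exists q : rat, `|ratr q - f t ord0 i| < ratr r.
    have /rat_in_itvoo[q] : f t ord0 i - ratr r < f t ord0 i + ratr r.
      by rewrite ltrBlDr -addrA ltrDl addr_gt0.
    by rewrite in_itv/= -ltr_distlC distrC; exists q.
  pose c := (\row_i sval (cid (q_ex i)), r).
  exists c => //; rewrite ifT; last first.
    apply/asboolP => w cw; apply: eU; split=> // i j; rewrite ord1 /ball/=.
    rewrite (le_lt_trans (ler_distD (ratr (c.1 ord0 j)) _ _))//.
    rewrite (splitr e) ltrD//; last exact: lt_trans (cw j) re.
    rewrite distrC mxE; case: cid => /= q qr; exact: lt_trans qr re.
  by move=> i /=; rewrite mxE; case: cid.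
apply: countable_bigcupT_measurable => // c; case: ifPn => // _.
rewrite (_ : _ @^-1` _ = \bigcap_(i in [set: 'I_d])
    ((fun t => f t ord0 i) @^-1` ball (ratr (c.1 ord0 i) : R) (ratr c.2))); last first.
  by apply/seteqP; split=> [t ct i _|t ct i]; [exact: ct|exact: (ct i)].
apply: fin_bigcap_measurable => // i _; rewrite -[X in measurable X]setTI.
by apply: mf => //; apply: open_measurable; exact: ball_open.
Qed.

End borel_rV.

Section lebesgue_rV.
Context {R : realType}.

Definition rV_cons d (p : measurableTypeR R * 'rV[R]_d) : 'rV[R]_d.+1 :=
  \row_i (if unlift ord0 i is Some j then p.2 ord0 j else p.1).

Definition rV_uncons d (v : 'rV[R]_d.+1) : measurableTypeR R * 'rV[R]_d :=
  (v ord0 ord0, \row_i v ord0 (lift ord0 i)).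

Lemma rV_consK d : cancel (@rV_cons d) (@rV_uncons d).
Proof.
move=> [x v]; congr (_, _); first by rewrite mxE unlift_none.
by apply/rowP => i; rewrite !mxE liftK.
Qed.

Lemma measurable_rV_cons d : measurable_fun setT (@rV_cons d).
Proof.
apply: measurable_fun_rV => i; case: (unliftP ord0 i) => [j ->|->].
  rewrite (_ : (fun _ => _) = (fun v : 'rV[R]_d => v ord0 j) \o snd).
    by apply: measurableT_comp; [exact: measurable_coord|exact: measurable_snd].
  by apply/funext => p /=; rewrite mxE liftK.
rewrite (_ : (fun _ => _) = fst); first exact: measurable_fst.
by apply/funext => p /=; rewrite mxE unlift_none.
Qed.

Lemma measurable_rV_uncons d : measurable_fun setT (@rV_uncons d).
Proof.
apply/measurable_fun_pairP; split; first exact: measurable_coord.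
apply: measurable_fun_rV => i; rewrite (_ : (fun _ => _) =
  (fun v : 'rV[R]_d.+1 => v ord0 (lift ord0 i))); first exact: measurable_coord.
by apply/funext => v /=; rewrite mxE.
Qed.

Section step.
Context {d : nat} (m : {sigma_finite_measure set 'rV[R]_d -> \bar R}).
Let pm : {measure set (measurableTypeR R * 'rV[R]_d)%type -> \bar R} :=
  (lebesgue_measure \x m)%E.

Definition lebesgue_rV_step : set 'rV[R]_d.+1 -> \bar R :=
  pushforward (lebesgue_measure \x m)%E (@rV_cons d).

Let step0 : lebesgue_rV_step set0 = 0%E.
Proof. by rewrite /lebesgue_rV_step /pushforward preimage_set0 (measure0 pm). Qed.

Let step_ge0 A : (0 <= lebesgue_rV_step A)%E.
Proof. exact: (measure_ge0 pm). Qed.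

Let step_sigma_additive : semi_sigma_additive lebesgue_rV_step.
Proof.
move=> F mF tF mUF; rewrite /lebesgue_rV_step /pushforward preimage_bigcup.
apply: (@measure_semi_sigma_additive _ _ _ pm).
- by move=> n; rewrite -[X in measurable X]setTI; exact: measurable_rV_cons.
- apply/trivIsetP => /= i j _ _ ij; rewrite -preimage_setI.
  by move/trivIsetP : tF => /(_ _ _ _ _ ij) ->//; rewrite preimage_set0.
- rewrite -preimage_bigcup -[X in measurable X]setTI.
  exact: measurable_rV_cons.
Qed.

HB.instance Definition _ := isMeasure.Build _ _ _ lebesgue_rV_step
  step0 step_ge0 step_sigma_additive.

Let step_sigma_finite : sigma_finite setT lebesgue_rV_step.
Proof.
have /sigma_finiteP[F [TF ndF Foo]] := sigma_finiteT (@lebesgue_measure R).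
have /sigma_finiteP[G [TG ndG Goo]] := sigma_finiteT m.
exists (fun k => @rV_uncons d @^-1` (F k `*` G k)).
  apply/esym; rewrite -preimage_bigcup -subTset => v _.
  have [k _ Fk] : (\bigcup_k F k) (rV_uncons v).1 by rewrite -TF.
  have [j _ Gj] : (\bigcup_k G k) (rV_uncons v).2 by rewrite -TG.
  exists (maxn k j) => //; split.
  - by move: Fk; apply/subsetPset/ndF/leq_maxl.
  - by move: Gj; apply/subsetPset/ndG/leq_maxr.
move=> k; have [mF Fk] := Foo k; have [mG Gk] := Goo k; split.
  rewrite -[X in measurable X]setTI; apply: measurable_rV_uncons => //.
  exact: measurableX.
rewrite /lebesgue_rV_step /pushforward -comp_preimage.
rewrite (_ : _ \o _ = id); last by apply/funext; exact: rV_consK.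
rewrite preimage_id product_measure1E// lte_mul_pinfty//.
by rewrite ge0_fin_numE.
Qed.

HB.instance Definition _ := Measure_isSigmaFinite.Build _ _ _ lebesgue_rV_step
  step_sigma_finite.

End step.

(* Lebesgue measure on R^d, as the iterated product measure; on R^0 = {0} it is
   the unit mass. *)
Fixpoint lebesgue_rV (d : nat) : {sigma_finite_measure set 'rV[R]_d -> \bar R} :=
  match d with
  | 0 => @dirac _ 'rV[R]_0 0 R
  | d'.+1 => lebesgue_rV_step (lebesgue_rV d')
  end.

End lebesgue_rV.

Section euclidean.
Context {R : realType} {d : nat}.
Local Notation E := 'rV[R]_d.

(* The library norm `|x| on 'rV[R]_d is the sup norm, hence these. *)
Definition dot (x y : E) : R := \sum_i x ord0 i * y ord0 i.
Definition enorm (x : E) : R := Num.sqrt (dot x x).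
Definition eball (r : R) : set E := [set x | enorm x <= r].
Definition q (x : E) : R := 2^-1 * enorm x ^+ 2.

Definition gradient (f : E -> R) (x : E) : E :=
  \row_i 'D_(delta_mx ord0 i) f x.

Definition strongly_convex (lambda : R) (f : E -> R) : Prop :=
  forall (x y : E) (t : R), 0 <= t <= 1 ->
    f (t *: x + (1 - t) *: y) <=
      t * f x + (1 - t) * f y - lambda / 2 * t * (1 - t) * enorm (x - y) ^+ 2.

(* X need not be convex: the inequality is only required at the points of a
   segment that belong to X. *)
Definition convex_on (X : set E) (f : E -> R) : Prop :=
  forall (x y : E) (t : R), X x -> X y -> 0 <= t <= 1 ->
    X (t *: x + (1 - t) *: y) ->
    f (t *: x + (1 - t) *: y) <= t * f x + (1 - t) * f y.

(* z^* for z with domain D; the values of z outside D are irrelevant. The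
   supremum is finite in the two cases of use: z continuous on a compact D, and
   z strongly convex on D = R^d. *)
Definition conjugate (D : set E) (z : E -> R) (y : E) : R :=
  sup [set dot x y - z x | x in D].

Definition msupport (mu : set E -> \bar R) : set E :=
  [set x | forall U, open_nbhs x U -> (0 < mu U)%E].

Definition has_density_on (B : set E) (mu : set E -> \bar R) : Prop :=
  exists f : E -> R, [/\ measurable_fun setT f, forall x, 0 <= f x &
    forall A, measurable A ->
      mu A = (\int[lebesgue_rV d]_(x in A `&` B) (f x)%:E)%E].

End euclidean.

Section entropy_function.
Context {R : realType}.
Implicit Type phi : R -> \bar R.

Definition legendre phi (s : R) : \bar R :=
  ereal_sup [set ((r * s)%:E - phi r)%E | r in [set r | 0 <= r]].

Definition phistar phi (s : R) : R := fine (legendre phi s).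

(* A function on R_+ is encoded by its extension by +oo to the whole line,
   which preserves convexity and lower semicontinuity. *)
Definition entropy_function phi : Prop :=
  [/\ forall r, r < 0 -> phi r = +oo%E,
      forall r, (0 <= phi r)%E,
      forall r s t : R, 0 <= t <= 1 ->
        (phi (t * r + (1 - t) * s)%R <= t%:E * phi r + (1 - t)%:E * phi s)%E,
      lower_semicontinuous phi &
      phi 1 = 0%E].

Definition differentiable_conjugate phi : Prop :=
  (forall s, legendre phi s \is a fin_num) /\
  (forall s, derivable (phistar phi) s 1).

End entropy_function.

Section unbalanced_transport.
Context {R : realType} {d : nat}.
Local Notation E := 'rV[R]_d.
Variable phi : R -> \bar R.
Implicit Types (mu nu : set E -> \bar R) (D X : set E) (f g z : E -> R).

(* D is the domain of z *)
Definition semidual mu nu D z : \bar R :=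
  (\int[mu]_(x in D) (phistar phi (z x - q x))%:E +
   \int[nu]_y (phistar phi (conjugate D z y - q y))%:E)%E.

Definition convex_bounded_continuous X z : Prop :=
  [/\ {within X, continuous z}, convex_on X z &
      exists B, forall x, X x -> `|z x| <= B].

Definition uot_potential mu nu X z0 : Prop :=
  convex_bounded_continuous X z0 /\
  forall z, convex_bounded_continuous X z ->
    (semidual mu nu X z0 <= semidual mu nu X z)%E.

Definition convexity_bound (c a b : R) : Prop :=
  phistar phi b - phistar phi a >=
    derive1 (phistar phi) a * (b - a) + c * (b - a) ^+ 2.

(* c is a lower bound, uniform over z in C, of the convexity constants of
   phi^* between z0 - q and z - q on supp(mu), and between z0^* - q and
   z^* - q on supp(nu). *)
Definition uniform_convexity_bound mu nu X z0 (C : set (E -> R)) (c : R) : Prop :=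
  forall z, C z ->
    (forall x, msupport mu x -> convexity_bound c (z0 x - q x) (z x - q x)) /\
    (forall y, msupport nu y ->
       convexity_bound c (conjugate X z0 y - q y) (conjugate setT z y - q y)).

(* Density of nu~ with respect to nu. *)
Definition tilde_density X z0 (y : E) : R :=
  derive1 (phistar phi) (conjugate X z0 y - q y).

(* d(f, g)^2 for f with domain Df and g with domain Dg; the expectation under
   nu~ is the integral against tilde_density * nu. *)
Definition dHcirc2 mu nu X z0 (lambda c : R) Df f Dg g : \bar R :=
  let h y := conjugate Df f y - conjugate Dg g y in
  ((2 * lambda)^-1%:E *
     \int[nu]_y (enorm (gradient h y) ^+ 2 * tilde_density X z0 y)%:E +
   c%:E * (\int[nu]_y (h y ^+ 2)%:E +
           \int[mu]_(x in Df `&` Dg) ((f x - g x) ^+ 2)%:E))%E.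

End unbalanced_transport.

Section metric_entropy.
Context {R : realType} {T : Type}.

Definition sup_norm (B : set T) (f : T -> R) : \bar R :=
  ereal_sup [set `|f x|%:E | x in B].

(* Closed balls, whose centers need not belong to C; +oo if no finite cover
   exists. *)
Definition covering_number (C : set (T -> R)) (N : (T -> R) -> \bar R) (u : R) :
    \bar R :=
  ereal_inf [set k%:R%:E | k in [set k : nat |
    exists c : 'I_k -> T -> R,
      forall z, C z -> exists i, (N (fun x => (z x - c i x)%R) <= u%:E)%E]].

Definition metric_entropy C N u : \bar R := lne (covering_number C N u).

End metric_entropy.

Section sampling.
Context {R : realType} {dO : measure_display} {Omega : measurableType dO}.
Variable P : probability Omega R.
Context {dT : measure_display} {T : measurableType dT}.

(* The terms of a sequence of index at least n are ignored. *)
Definition mutually_independent (n : nat) (x : nat -> {RV P >-> T}) : Prop :=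
  forall A : nat -> set T, (forall i, measurable (A i)) ->
    P [set w | forall i, (i < n)%N -> A i (x i w)] =
    (\prod_(i < n) P (x i @^-1` A i))%E.

Definition independent_samples (mu : set T -> \bar R) (n : nat)
    (x : nat -> {RV P >-> T}) : Prop :=
  mutually_independent n x /\
  forall i, (i < n)%N -> forall A, measurable A -> distribution P (x i) A = mu A.

Definition empirical (n : nat) (x : nat -> T) : {measure set T -> \bar R} :=
  mscale (n%:R^-1)%:nng (msum (fun i => @dirac _ T (x i) R) n).

(* Expectation of a nonnegative function, as an outer expectation so as to be
   meaningful without measurability (an empirical minimizer need not be a
   measurable function of the sample). *)
Definition expectation_outer (f : Omega -> \bar R) : \bar R :=
  ereal_inf [set (\int[P]_w g w)%E | g in
    [set g : Omega -> \bar R |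
      measurable_fun setT g /\ forall w, (f w <= g w)%E]].

Lemma expectation_outerE (f : Omega -> \bar R) :
  measurable_fun setT f -> (forall w, 0 <= f w)%E ->
  expectation_outer f = (\int[P]_w f w)%E.
Proof.
move=> mf f0; apply/eqP; rewrite eq_le; apply/andP; split.
  by apply: ereal_inf_lbound; exists f.
apply: le_ereal_inf_tmp => _ [g [mg fg] <-]; apply: ge0_le_integral => //.
Qed.

End sampling.

(* Main.v *)
Require Import Defs.
From HB Require Import structures.
From mathcomp Require Import all_boot all_order all_algebra.
From mathcomp Require Import all_classical all_reals all_analysis.
From mathcomp Require Import measurable_realfun ring lra.

Set Implicit Arguments.
Unset Strict Implicit.
Unset Printing Implicit Defensive.
Import Order.TTheory GRing.Theory Num.Theory.
Import numFieldNormedType.Exports.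

Local Open Scope classical_set_scope.
Local Open Scope ring_scope.

(** The proof combines a deterministic stability estimate with a chaining bound
    for the empirical semi-dual functional.

    Stability. By the convexity bounds on [phi^*], the excess [J z - J z0] is at
    least its linearization at [z0] plus the quadratic terms of the distance.
    Comparing [z0] with the segment from [z0] to [z] and differentiating under
    the integral ([first_order_optimality]) replaces the part of the linearization
    that lives on [mu] by an integral over [nu~] of [z - z0] at [p y], where [p y]
    is the maximizer of [<x, y> - z0 x]. What remains under [nu~] is the gap
    [z (p y) + z^* y - <p y, y>] in Young's inequality, and strong convexity
    bounds it below by [lambda / 2] times [|grad z^* y - p y|^2] ([young_gap]).
    Hence the squared distance is at most [1 + lambda^-2] times the excess
    ([stability]).

    The delicate point is that [z0] is only a convex function on the compact [X]
    and is related to the strongly convex [zt] of the class on the supports alone,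
    while the distance involves derivatives of [z0^*] on the support of [nu], a
    closed set whose boundary may have positive measure. On this set [z0^*] equals
    the smooth function [zt^*]. On each line, all but countably many points of a
    set are accumulated by the set from both sides; at those points the one-sided
    slopes of the convex function [z0^*] must be those of [zt^*]. By Fubini the
    exceptional points are Lebesgue negligible, and [nu] has a density
    ([slopes_agree_ae], [optimal_map_ae]).

    Chaining. For an empirical minimizer the excess is at most the oscillation
    over the class of the centered empirical process, for [mu] and for [nu]
    separately ([excess_le_deviation]). Its integrands are Lipschitz in [z] for the
    sup norm on a fixed ball, because the maximizers in [z^*] stay in a ball
    ([conjugate_dist]). Independence gives sub-Gaussian moments of sample means,
    hence a bound on finitely many of them at once by one measurable
    function ([empirical_maximal_bound]); measurability matters because the
    expectation of the statement is an outer one. Dudley's argument over dyadic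
    scales ([chaining]) then gives a multiple of
    [eps K + n^(-1/2) * sum_k eps k * sqrt H(eps k)], and the sum is a lower
    Riemann sum of the entropy integral.

    Substituting [L u] for the scale multiplies both terms of this bound by [L],
    so that taking [L] small absorbs all constants, including [1 + lambda^-2]. *)

(** * Euclidean geometry of row vectors *)

Section euclidean_geometry.
Context {R : realType} {d : nat}.
Local Notation E := 'rV[R]_d.
Implicit Types (x y v : E) (r a : R).

Lemma dotC x y : dot x y = dot y x.
Proof. by rewrite /dot; apply: eq_bigr => i _; rewrite mulrC. Qed.

Lemma dotDl x x' y : dot (x + x') y = dot x y + dot x' y.
Proof. by rewrite /dot -big_split; apply: eq_bigr => i _; rewrite mxE mulrDl. Qed.

Lemma dotDr x y y' : dot x (y + y') = dot x y + dot x y'.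
Proof. by rewrite dotC dotDl !(dotC x). Qed.

Lemma dotZl a x y : dot (a *: x) y = a * dot x y.
Proof. by rewrite /dot mulr_sumr; apply: eq_bigr => i _; rewrite mxE mulrA. Qed.

Lemma dotZr a x y : dot x (a *: y) = a * dot x y.
Proof. by rewrite dotC dotZl dotC. Qed.

Lemma dotNl x y : dot (- x) y = - dot x y.
Proof. by rewrite -scaleN1r dotZl mulN1r. Qed.

Lemma dotNr x y : dot x (- y) = - dot x y.
Proof. by rewrite dotC dotNl dotC. Qed.

Lemma dotBl x x' y : dot (x - x') y = dot x y - dot x' y.
Proof. by rewrite dotDl dotNl. Qed.

Lemma dotBr x y y' : dot x (y - y') = dot x y - dot x y'.
Proof. by rewrite dotDr dotNr. Qed.

Lemma dot0l y : dot (0 : E) y = 0.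
Proof. by rewrite -(scale0r 0) dotZl mul0r. Qed.

Lemma dot_ge0 x : 0 <= dot x x.
Proof. by apply: sumr_ge0 => i _; rewrite -expr2 sqr_ge0. Qed.

Lemma dot_delta x i : dot x (delta_mx ord0 i) = x ord0 i.
Proof.
rewrite /dot (bigD1 i)//= big1 ?addr0 => [|j ji]; first by rewrite mxE !eqxx mulr1.
by rewrite mxE eqxx/= (negbTE ji) mulr0.
Qed.

Lemma enorm_ge0 x : 0 <= enorm x. Proof. exact: sqrtr_ge0. Qed.

Lemma sqr_enorm x : enorm x ^+ 2 = dot x x.
Proof. by rewrite sqr_sqrtr// dot_ge0. Qed.

Lemma enorm0 : enorm (0 : E) = 0.
Proof. by rewrite /enorm dot0l sqrtr0. Qed.

Lemma enormZ a x : enorm (a *: x) = `|a| * enorm x.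
Proof.
by rewrite /enorm dotZl dotZr mulrA -expr2 sqrtrM ?sqr_ge0// sqrtr_sqr.
Qed.

Lemma enormN x : enorm (- x) = enorm x.
Proof. by rewrite -scaleN1r enormZ normrN1 mul1r. Qed.

Lemma enormBC x y : enorm (x - y) = enorm (y - x).
Proof. by rewrite -enormN opprB. Qed.

Lemma le_coord_enorm x i : `|x ord0 i| <= enorm x.
Proof.
rewrite -sqrtr_sqr ler_wsqrtr// /dot (bigD1 i)//= -expr2 lerDl.
by apply: sumr_ge0 => j _; rewrite -expr2 sqr_ge0.
Qed.

Lemma enorm_eq0 x : enorm x = 0 -> x = 0.
Proof.
move=> x0; apply/rowP => i; rewrite mxE; apply/eqP.
by rewrite -normr_le0 -x0 le_coord_enorm.
Qed.

(** Cauchy-Schwarz, from the nonnegativity of [|b x - a y|^2] with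
    [a = |x|], [b = |y|]. *)
Lemma dot_le x y : dot x y <= enorm x * enorm y.
Proof.
have [x0|x0] := eqVneq (enorm x) 0.
  by rewrite x0 (enorm_eq0 x0) dot0l mul0r.
have [y0|y0] := eqVneq (enorm y) 0.
  by rewrite y0 (enorm_eq0 y0) dotC dot0l mulr0.
have ab : 0 < enorm x * enorm y by rewrite mulr_gt0// lt0r enorm_ge0 ?x0 ?y0.
have := dot_ge0 (enorm y *: x - enorm x *: y).
rewrite dotBl !dotBr !dotZl !dotZr (dotC y x) -!sqr_enorm => h.
have ab2 : 0 < 2 * (enorm x * enorm y) by rewrite mulr_gt0.
rewrite -subr_ge0 -(pmulr_rge0 _ ab2); apply: le_trans h _.
by rewrite le_eqVlt; apply/orP; left; apply/eqP; ring.
Qed.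

Lemma normr_dot_le x y : `|dot x y| <= enorm x * enorm y.
Proof.
by rewrite ler_norml dot_le andbT lerNl -dotNl (le_trans (dot_le _ _))// enormN.
Qed.

Lemma enormD x y : enorm (x + y) <= enorm x + enorm y.
Proof.
rewrite -(ler_pXn2r (n := 2))// ?nnegrE ?addr_ge0 ?enorm_ge0//.
rewrite sqr_enorm dotDl !dotDr (dotC y x) sqrrD -!sqr_enorm.
have := dot_le x y; lra.
Qed.

Lemma enormB_le x y : enorm x - enorm y <= enorm (x - y).
Proof. by rewrite lerBlDr (le_trans _ (enormD _ _))// subrK. Qed.

Lemma q_ge0 x : 0 <= q x.
Proof. by rewrite /q mulr_ge0// sqr_ge0. Qed.

Lemma eball0 r : 0 <= r -> eball r (0 : E).
Proof. by rewrite /eball/= enorm0. Qed.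

Lemma normr_sub_enorm_le x y : `|enorm x - enorm y| <= enorm (x - y).
Proof.
rewrite ler_norml enormB_le andbT lerNl opprB enormBC; exact: enormB_le.
Qed.

(** The norm [`|x|] of a row vector is the sup norm, so that this is half of the equivalence
    of the two norms; the other half is [le_coord_enorm]. *)
Lemma enorm_le_norm x : enorm x <= Num.sqrt d%:R * `|x|.
Proof.
have h i : `|x ord0 i| <= `|x| by rewrite [leRHS]/Num.norm/= mx_normrE;
  apply/bigmax_geP; right; exists (ord0, i).
rewrite -(ger0_norm (normr_ge0 x)) -sqrtr_sqr -sqrtrM// ler_wsqrtr//.
have -> : d%:R * `|x| ^+ 2 = \sum_(i < d) `|x| ^+ 2.
  by rewrite sumr_const card_ord mulr_natl.
rewrite /dot ler_sum// => i _.
by rewrite -expr2 -real_normK ?num_real// lerXn2r// nnegrE.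
Qed.

Lemma norm_le_enorm x : `|x| <= enorm x.
Proof.
rewrite [leLHS]/Num.norm/= mx_normrE; apply/bigmax_leP; split=> [|[i j] _].
  exact: enorm_ge0.
by rewrite ord1 le_coord_enorm.
Qed.

Lemma cvg_enorm0 (y0 : E) : enorm (y - y0) @[y --> y0] --> (0 : R).
Proof.
apply/(cvgr0Pnorm_le (F := nbhs y0)) => e e0.
near=> y; rewrite ger0_norm ?enorm_ge0//.
rewrite (le_trans (enorm_le_norm _))//.
have c0 : 0 < Num.sqrt d%:R + 1 :> R by rewrite ltr_wpDl// sqrtr_ge0.
rewrite (@le_trans _ _ ((Num.sqrt d%:R + 1) * `|y - y0|))//.
  by rewrite ler_wpM2r// lerDl.
rewrite mulrC -ler_pdivlMr// distrC; near: y.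
have yy0 : y @[y --> y0] --> y0 by exact: cvg_id.
by move/cvgrPdist_le : yy0; apply; rewrite divr_gt0.
Unshelve. all: by end_near. Qed.

(** The topology is that of the sup norm, whereas the estimates are Euclidean;
    this criterion passes from the latter to the former. *)
Lemma locally_lipschitz_continuous (f : E -> R) :
  (forall y0, exists K, forall y, enorm (y - y0) <= 1 ->
     `|f y - f y0| <= K * enorm (y - y0)) -> continuous f.
Proof.
move=> fK y0; have [K hK] := fK y0.
apply/(cvgrPdist_le (F := nbhs y0)) => e e0; near=> y.
rewrite distrC (le_trans (hK y _))//.
  by near: y; have /(cvgr0Pnorm_le (F := nbhs y0))/(_ 1 ltr01) := cvg_enorm0 y0;
    apply: filterS =>
    y; rewrite ger0_norm// enorm_ge0.
rewrite (@le_trans _ _ ((`|K| + 1) * enorm (y - y0)))//.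
  by rewrite ler_wpM2r ?enorm_ge0// (le_trans (ler_norm _))// lerDl.
rewrite mulrC -ler_pdivlMr ?ltr_wpDl//; near: y.
have /(cvgr0Pnorm_le (F := nbhs y0)) := cvg_enorm0 y0.
move=> /(_ (e / (`|K| + 1))); rewrite divr_gt0 ?ltr_wpDl// => /(_ isT).
by apply: filterS => y; rewrite ger0_norm// enorm_ge0.
Unshelve. all: by end_near. Qed.

Lemma continuous_enorm : continuous (@enorm R d).
Proof.
apply: locally_lipschitz_continuous => y0; exists 1 => y _; rewrite mul1r.
exact: normr_sub_enorm_le.
Qed.

Lemma continuous_dotl y : continuous (fun x : E => dot x y).
Proof.
apply: locally_lipschitz_continuous => y0; exists (enorm y) => x _.
by rewrite -dotBl mulrC normr_dot_le.
Qed.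

Lemma continuous_q : continuous (@q R d).
Proof.
move=> x; apply: (@continuous_comp _ _ _ (fun x => enorm x ^+ 2) ( *%R 2^-1)).
  apply: (@continuous_comp _ _ _ (@enorm R d) (fun s => s ^+ 2)).
    exact: continuous_enorm.
  exact: exprn_continuous.
exact: mulrl_continuous.
Qed.

Lemma compact_eball r : compact (eball r : set E).
Proof.
apply: bounded_closed_compact.
  exists r; split; first exact: num_real.
  by move=> s rs x /= xr; rewrite (le_trans (norm_le_enorm x))// (le_trans xr)// ltW.
have -> : eball r = @enorm R d @^-1` [set s | s <= r] by [].
apply: closed_comp; first by move=> x _; exact: continuous_enorm.
exact: closed_le.
Qed.

Lemma compact_sub_eball (X : set E) : compact X -> exists r, X `<=` eball r.
Proof.
move=> /compact_bounded[M [_ XM]]; exists (Num.sqrt d%:R * (M + 1)) => x Xx.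
rewrite /eball/= (le_trans (enorm_le_norm x))// ler_wpM2l ?sqrtr_ge0//.
by apply: XM => //; rewrite ltrDl.
Qed.

Lemma continuous_measurable (f : E -> R) : continuous f -> measurable_fun setT f.
Proof.
move=> cf; apply: (measurability _ (RGenOInfty.measurableE R)) => _ [_ [a ->] <-].
rewrite setTI; apply: open_measurable_rV.
by apply: open_comp; [move=> ? _; exact: cf|exact: interval_open].
Qed.

Lemma closed_measurable_rV (A : set E) : closed A -> measurable A.
Proof.
move=> cA; rewrite -(setCK A); apply: measurableC; apply: open_measurable_rV.
exact: closed_openC.
Qed.

Lemma continuous_within_measurable (A : set E) (f : E -> R) :
  closed A -> {within A, continuous f} -> measurable_fun A f.
Proof.
move=> cA cf; have mA := closed_measurable_rV cA.
apply: (measurability _ (RGenOInfty.measurableE R)) => _ [_ [a ->] <-].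
have /open_subspaceP[U oU UA] : open (f @^-1` `]a, +oo[ : set (subspace A)).
  by move/continuousP : cf; apply; exact: interval_open.
by rewrite setIC -UA; apply: measurableI => //; exact: open_measurable_rV.
Qed.

End euclidean_geometry.

(** * Conjugates of strongly convex functions *)

(** For a strongly convex [z] this is the gradient at [y] of the conjugate of
    [z]. It is introduced as the maximizer in the conjugate, which exists and is
    unique before anything is known about differentiability. *)
Definition grad_conj {R : realType} {d : nat} (z : 'rV[R]_d -> R)
    (y : 'rV[R]_d) : 'rV[R]_d :=
  xget 0 [set p | forall x, dot x y - z x <= dot p y - z p].

Definition potential_class {R : realType} {d : nat} (M : R -> R) (lambda l : R)
    (z : 'rV[R]_d -> R) : Prop :=
  [/\ forall r, 0 <= r -> forall v, eball r v -> `|z v| <= M r,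
      forall v, l <= z v & strongly_convex lambda z].

(** Outside the ball of this radius, [<x, y> - z x] is below its value at
    [x = 0] whenever [y] has norm at most [r]: the quadratic growth rate
    [lambda / 4] of [z] wins over the linear term. *)
Definition conj_radius {R : realType} (M : R -> R) (lambda l r : R) : R :=
  1 + 4 / lambda * (`|r| + 2 * `|M 0| + 2 * `|l| + 1).

(** Bound on the conjugate over the ball of radius [r], from the lower bound [l]
    and the bound [conj_radius] on the maximizers. *)
Definition conj_bound {R : realType} (M : R -> R) (lambda l r : R) : R :=
  `|M 0| + `|l| + conj_radius M lambda l r * `|r|.

Section strongly_convex_conjugate.
Context {R : realType} {d : nat} (M : R -> R) (lambda l : R).
Hypothesis lambda0 : 0 < lambda.
Local Notation E := 'rV[R]_d.
Local Notation rad := (conj_radius M lambda l).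
Local Notation class := (potential_class M lambda l).
Implicit Types (x y p : E) (z : E -> R).

Lemma conj_radius_gt1 r : 1 <= rad r.
Proof. by rewrite /conj_radius lerDl mulr_ge0 ?divr_ge0 ?addr_ge0 ?mulr_ge0// ltW. Qed.

Lemma potential_class_norm0 z : class z -> `|z 0| <= M 0.
Proof. by move=> [+ _ _]; apply => //; exact: eball0. Qed.

Lemma potential_class_convex z x y (t : R) : class z -> 0 <= t <= 1 ->
  z (t *: x + (1 - t) *: y) <= t * z x + (1 - t) * z y.
Proof.
move=> [_ _ scz] t01; apply: le_trans (scz x y t t01) _.
move: t01 => /andP[t0 t1].
by rewrite lerBlDr lerDl !mulr_ge0 ?invr_ge0 ?subr_ge0 ?(ltW lambda0) ?enorm_ge0.
Qed.

(** A convex function that is bounded by [M] on the unit ball around [y0] has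
    slopes at most [2 M] from [y0]: extend the segment to unit length. *)
Lemma potential_class_locally_lipschitz z y0 y : class z ->
  enorm (y - y0) <= 1 ->
  `|z y - z y0| <= 2 * M (enorm y0 + 1) * enorm (y - y0).
Proof.
move=> cz e1; set e := enorm (y - y0) in e1 *.
have [e0|e0] := eqVneq e 0.
  by rewrite e0 mulr0 (subr0_eq (enorm_eq0 e0)) subrr normr0.
have {}e0 : 0 < e by rewrite lt0r e0 enorm_ge0.
set u := e^-1 *: (y - y0).
have u1 : enorm u = 1 by rewrite enormZ gtr0_norm ?invr_gt0// mulVf// gt_eqF.
have yu : y - y0 = e *: u by rewrite scalerA divff ?scale1r// gt_eqF.
clearbody u; have [bz _ _] := cz.
have r0 : 0 <= enorm y0 + 1 by rewrite addr_ge0// enorm_ge0.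
have /ler_normlP[b0 b0'] : `|z y0| <= M (enorm y0 + 1).
  by apply: bz => //; rewrite /eball/= lerDl.
have /ler_normlP[bu bu'] : `|z (y0 + u)| <= M (enorm y0 + 1).
  by apply: bz => //; rewrite /eball/= (le_trans (enormD _ _))// u1.
have /ler_normlP[bv bv'] : `|z (y0 - u)| <= M (enorm y0 + 1).
  by apply: bz => //; rewrite /eball/= (le_trans (enormD _ _))// enormN u1.
rewrite ler_norml; apply/andP; split.
  have e1' : 0 < 1 + e by lra.
  have t01 : 0 <= (1 + e)^-1 <= 1 by rewrite invr_ge0 invf_le1//; lra.
  have := potential_class_convex y (y0 - u) cz t01.
  have -> : (1 + e)^-1 *: y + (1 - (1 + e)^-1) *: (y0 - u) = y0.
    have -> : y = y0 + e *: u by rewrite -yu addrC subrK.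
    by apply/rowP => i; rewrite !mxE; field; exact: lt0r_neq0.
  rewrite -(ler_pM2l e1') mulrDr !mulrA divff ?gt_eqF// mul1r.
  have -> : (1 + e) * (1 - (1 + e)^-1) = e by field; exact: lt0r_neq0.
  have : e * z (y0 - u) <= e * M (enorm y0 + 1) by rewrite ler_pM2l.
  have : e * - z y0 <= e * M (enorm y0 + 1) by rewrite ler_pM2l.
  by rewrite mulrN; lra.
have t01 : 0 <= e <= 1 by rewrite (ltW e0).
have := potential_class_convex (y0 + u) y0 cz t01.
have -> : e *: (y0 + u) + (1 - e) *: y0 = y.
  have -> : y = y0 + e *: u by rewrite -yu addrC subrK.
  by apply/rowP => i; rewrite !mxE; ring.
have : e * z (y0 + u) <= e * M (enorm y0 + 1) by rewrite ler_pM2l.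
have : e * - z y0 <= e * M (enorm y0 + 1) by rewrite ler_pM2l.
by rewrite mulrN; lra.
Qed.

Lemma potential_class_continuous z : class z -> continuous z.
Proof.
move=> cz; apply: locally_lipschitz_continuous => y0.
by exists (2 * M (enorm y0 + 1)) => y; exact: potential_class_locally_lipschitz.
Qed.

(** Strong convexity between [x] and [0], at the midpoint, where [z >= l]. *)
Lemma potential_class_coercive z x : class z ->
  2 * l - M 0 + lambda / 4 * enorm x ^+ 2 <= z x.
Proof.
move=> cz; have [_ lz scz] := cz.
have t01 : 0 <= (2^-1 : R) <= 1 by rewrite invr_ge0 invf_le1; lra.
have := scz x 0 2^-1 t01; rewrite scaler0 addr0 subr0.
have := lz (2^-1 *: x); have /ler_normlP[_] := potential_class_norm0 cz.
by lra.
Qed.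

Lemma conj_objective_far z x y r : class z -> enorm y <= r -> rad r < enorm x ->
  dot x y - z x < dot 0 y - z 0.
Proof.
move=> cz yr xr; rewrite dot0l sub0r.
have c := potential_class_coercive x cz;
  have /ler_normlP[_ m0] := potential_class_norm0 cz.
have xy : dot x y <= enorm x * r.
  by apply: le_trans (dot_le x y) _; rewrite ler_wpM2l// enorm_ge0.
have x1 : 1 < enorm x by apply: le_lt_trans (conj_radius_gt1 r) xr.
have M0 := ler_norm (M 0); have l0 := lerNnormlW (lexx `|l|).
have r0 := ler_norm r.
have h : `|r| + 2 * `|M 0| + 2 * `|l| + 1 < lambda / 4 * enorm x.
  have : 4 / lambda * (`|r| + 2 * `|M 0| + 2 * `|l| + 1) < enorm x.
    by apply: le_lt_trans xr; rewrite /conj_radius lerDr.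
  rewrite -ltr_pdivlMl ?divr_gt0// => h; apply: lt_le_trans h _.
  by rewrite le_eqVlt; apply/orP; left; apply/eqP; field; exact: lt0r_neq0.
have : (`|r| + 2 * `|M 0| + 2 * `|l| + 1) * enorm x <= lambda / 4 * enorm x ^+ 2.
  by rewrite expr2 mulrA ler_wpM2r ?ltW//; lra.
have : r * enorm x <= `|r| * enorm x by rewrite ler_wpM2r// enorm_ge0.
have : 2 * `|M 0| + 2 * `|l| + 1 <= (2 * `|M 0| + 2 * `|l| + 1) * enorm x.
  by rewrite ler_peMr ?ltW// ?addr_ge0 ?mulr_ge0.
have : - l <= `|l| by rewrite -normrN ler_norm.
by lra.
Qed.

Lemma grad_conj_exists z y : class z ->
  exists p, forall x, dot x y - z x <= dot p y - z p.
Proof.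
move=> cz; pose r := rad (enorm y).
have r1 : 0 <= r by rewrite (le_trans ler01)// conj_radius_gt1.
have [||p _ pmax] := @EVT_max_rV R d (fun x => dot x y - z x) (eball r) _
    (@compact_eball R d r).
- by exists 0; exact: eball0.
- apply: continuous_subspaceT => x.
  apply: (@continuousB _ _ _ (fun x => dot x y) z).
    exact: continuous_dotl.
  exact: potential_class_continuous.
exists p => x; have [xr|rx] := leP (enorm x) r.
  by apply: pmax; rewrite inE.
apply: (le_trans (ltW (conj_objective_far cz (lexx _) rx))).
by apply: pmax; rewrite inE; exact: eball0.
Qed.

Lemma grad_conjP z y x : class z ->
  dot x y - z x <= dot (grad_conj z y) y - z (grad_conj z y).
Proof.
move=> cz; rewrite /grad_conj.
by case: xgetP => [p _|]; [apply|by have [p pP] := grad_conj_exists y cz; move=> /(_ p)].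
Qed.

Lemma grad_conj_bounded z y r : class z -> enorm y <= r ->
  enorm (grad_conj z y) <= rad r.
Proof.
move=> cz yr; rewrite leNgt; apply/negP => /(conj_objective_far cz yr).
by rewrite ltNge grad_conjP.
Qed.

Lemma conjugateE z y : class z ->
  conjugate setT z y = dot (grad_conj z y) y - z (grad_conj z y).
Proof.
move=> cz; apply/eqP; rewrite eq_le; apply/andP; split.
  apply: ge_sup; first by exists (dot 0 y - z 0), 0.
  by move=> _ [x _ <-]; exact: grad_conjP.
apply: ub_le_sup; last by exists (grad_conj z y).
by exists (dot (grad_conj z y) y - z (grad_conj z y)) => _ [x _ <-]; exact: grad_conjP.
Qed.

Lemma young z x y : class z -> dot x y - z x <= conjugate setT z y.
Proof. by move=> cz; rewrite conjugateE// grad_conjP. Qed.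

(** Strong convexity near the maximizer: the objective at the point
    [t x + (1 - t) p] does not exceed its maximum; divide by [t] and let
    [t] tend to [0]. *)
Lemma young_gap z x y : class z ->
  lambda / 2 * enorm (x - grad_conj z y) ^+ 2 <=
  z x + conjugate setT z y - dot x y.
Proof.
move=> cz; rewrite conjugateE//; set p := grad_conj z y.
set a := lambda / 2 * _; have [_ _ scz] := cz.
have a0 : 0 <= a by rewrite mulr_ge0 ?sqr_ge0// divr_ge0// ltW.
have h t : 0 < t -> t < 1 -> (1 - t) * a <= z x + (dot p y - z p) - dot x y.
  move=> t0 t1.
  have t01 : 0 <= t <= 1 by rewrite !ltW.
  have := scz x p t t01.
  have := grad_conjP y (t *: x + (1 - t) *: p) cz.
  rewrite -/p dotDl !dotZl => h1 h2.
  rewrite -(ler_pM2l t0).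
  have -> : t * ((1 - t) * a) = lambda / 2 * t * (1 - t) * enorm (x - p) ^+ 2.
    by rewrite /a; ring.
  by lra.
apply/ler_addgt0Pr => e e0.
pose t := Num.min (2^-1) (e / (a + 1)).
have t0 : 0 < t by rewrite lt_min invr_gt0 ltr0n divr_gt0// ltr_wpDl.
have t1 : t < 1 by rewrite gt_min invf_lt1// ltr1n.
have ta : t * a <= e.
  have : t * (a + 1) <= e by rewrite -ler_pdivlMr ?ltr_wpDl// ge_min lexx orbT.
  by lra.
have := h t t0 t1; lra.
Qed.

Lemma conjugate_lower z y y' : class z ->
  conjugate setT z y + dot (grad_conj z y) (y' - y) <= conjugate setT z y'.
Proof.
move=> cz; apply: le_trans (young (grad_conj z y) y' cz).
by rewrite (conjugateE y cz) dotBr; lra.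
Qed.

(** The [1 / lambda]-smoothness of the conjugate: compare with the maximizer at
    [y'] by [young_gap], and absorb the cross term by completing a square. *)
Lemma conjugate_upper z y y' : class z ->
  conjugate setT z y' <= conjugate setT z y + dot (grad_conj z y) (y' - y) +
    enorm (y' - y) ^+ 2 / (2 * lambda).
Proof.
move=> cz; rewrite (conjugateE y' cz); set p' := grad_conj z y'.
set p := grad_conj z y.
have := young_gap p' y cz; rewrite -/p => h.
have xy : dot p' y' = dot p' y + dot p (y' - y) + dot (p' - p) (y' - y).
  by rewrite dotBl !dotBr; ring.
rewrite xy.
suff : dot (p' - p) (y' - y) <=
    lambda / 2 * enorm (p' - p) ^+ 2 + enorm (y' - y) ^+ 2 / (2 * lambda) by lra.
apply: le_trans (dot_le _ _) _; set a := enorm (p' - p); set b := enorm (y' - y).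
have : 0 <= (lambda * a - b) ^+ 2 / (2 * lambda).
  by rewrite divr_ge0 ?sqr_ge0// mulr_ge0// ltW.
have -> : (lambda * a - b) ^+ 2 / (2 * lambda) =
    lambda / 2 * a ^+ 2 + b ^+ 2 / (2 * lambda) - a * b.
  by field; exact: lt0r_neq0.
by rewrite subr_ge0.
Qed.

(** Add the Young gaps at [y] and [y'], each evaluated at the maximizer of the
    other. *)
Lemma grad_conj_lipschitz z y y' : class z ->
  enorm (grad_conj z y - grad_conj z y') <= enorm (y - y') / lambda.
Proof.
move=> cz; set p := grad_conj z y; set p' := grad_conj z y'.
have h1 := young_gap p' y cz; have h2 := young_gap p y' cz.
rewrite (conjugateE y cz) -/p in h1; rewrite (conjugateE y' cz) -/p' in h2.
rewrite enormBC in h1.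
have : lambda * enorm (p - p') ^+ 2 <= dot (p - p') (y - y').
  by rewrite dotBl !dotBr; lra.
move=> /le_trans/(_ (dot_le _ _)); have [->|e0] := eqVneq (enorm (p - p')) 0.
  by rewrite divr_ge0 ?enorm_ge0// ltW.
have {}e0 : 0 < enorm (p - p') by rewrite lt0r e0 enorm_ge0.
by rewrite expr2 mulrCA ler_pM2l// ler_pdivlMr// mulrC.
Qed.

Lemma conjugate_continuous z : class z -> continuous (conjugate setT z).
Proof.
move=> cz; apply: locally_lipschitz_continuous => y0.
pose r := rad (enorm y0 + 1); exists r => y y1.
have r0 : 0 <= enorm y0 + 1 by rewrite addr_ge0// enorm_ge0.
have hy0 : `|dot (grad_conj z y0) (y - y0)| <= r * enorm (y - y0).
  apply: le_trans (normr_dot_le _ _) _; rewrite ler_wpM2r ?enorm_ge0//.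
  by apply: grad_conj_bounded => //; rewrite lerDl.
have hy : `|dot (grad_conj z y) (y - y0)| <= r * enorm (y - y0).
  apply: le_trans (normr_dot_le _ _) _; rewrite ler_wpM2r ?enorm_ge0//.
  apply: grad_conj_bounded => //; rewrite -(subrK y0 y) (le_trans (enormD _ _))//.
  by rewrite addrC lerD2l.
have l1 := conjugate_lower y0 y cz; have l2 := conjugate_lower y y0 cz.
rewrite -opprB dotNr in l2.
by move: hy hy0; rewrite !ler_norml => /andP[? ?] /andP[? ?]; apply/andP; split; lra.
Qed.

Lemma grad_conj_continuous z i : class z -> continuous (fun y => grad_conj z y ord0 i).
Proof.
move=> cz; apply: locally_lipschitz_continuous => y0; exists lambda^-1 => y _.
rewrite mulrC; apply: le_trans (grad_conj_lipschitz y y0 cz).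
by apply: le_trans (le_coord_enorm _ i); rewrite !mxE.
Qed.

Lemma grad_conj_measurable z : class z -> measurable_fun setT (grad_conj z).
Proof.
move=> cz; apply: measurable_fun_rV => i; apply: continuous_measurable.
exact: grad_conj_continuous.
Qed.

(** All maximizers lie in the ball of radius [rad r], so that only the distance
    on this ball matters: here is the origin of the radius in the metric
    entropy. *)
Lemma conjugate_dist z z' r e y : class z -> class z' ->
  (forall x, eball (rad r) x -> `|z x - z' x| <= e) -> eball r y ->
  `|conjugate setT z y - conjugate setT z' y| <= e.
Proof.
move=> cz cz' zz' yr.
have h w w' : class w -> class w' ->
    (forall x, eball (rad r) x -> `|w x - w' x| <= e) ->
    conjugate setT w y - conjugate setT w' y <= e.
  move=> cw cw' ww'; rewrite (conjugateE y cw).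
  have := young (grad_conj w y) y cw'.
  have := ww' _ (grad_conj_bounded cw yr); rewrite ler_norml => /andP[? ?].
  by lra.
rewrite ler_norml h// andbT lerNl opprB; apply: h => // x /zz'.
by rewrite distrC.
Qed.

Lemma conjugate_bounded z r y : class z -> eball r y ->
  `|conjugate setT z y| <= conj_bound M lambda l r.
Proof.
move=> cz yr; have r0 : 0 <= r by apply: le_trans yr; exact: enorm_ge0.
have [_ lz _] := cz; rewrite /conj_bound (ger0_norm r0).
have z0 := le_trans (potential_class_norm0 cz) (ler_norm _).
have rr : 0 <= rad r * r by rewrite mulr_ge0// (le_trans ler01)// conj_radius_gt1.
have l0 := normr_ge0 l; have l1 : - l <= `|l| by rewrite -normrN ler_norm.
have m0 := normr_ge0 (M 0).
rewrite ler_norml; apply/andP; split.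
  have := young 0 y cz; rewrite dot0l; have := ler_norm (z 0); lra.
rewrite (conjugateE y cz).
have : dot (grad_conj z y) y <= rad r * r.
  apply: le_trans (dot_le _ _) _; apply: ler_pM; rewrite ?enorm_ge0//.
  exact: grad_conj_bounded.
by have := lz (grad_conj z y); lra.
Qed.

End strongly_convex_conjugate.

(** * Derivatives and the conjugate entropy *)

Section sequential_derivative.
Context {R : realType}.
Implicit Types (f : R -> R) (a : R).

Lemma derivable_expansion f a e : derivable f a 1 -> 0 < e ->
  exists2 del : R, 0 < del & forall h, `|h| < del ->
    `|f (a + h) - f a - derive1 f a * h| <= e * `|h|.
Proof.
move=> df e0; rewrite derive1E.
have [del /= del0 hdel] : \forall h \near (0 : R)^',
    `|'D_1 f a - h^-1 *: ((f \o shift a) (h *: 1) - f a)| <= e.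
  by move/(cvgrPdist_le (F := (0 : R)^')) : df; exact.
exists del => // h hd; have [->|h0] := eqVneq h 0.
  by rewrite addr0 subrr mulr0 subr0 normr0 mulr0.
have := hdel h; rewrite /ball/= sub0r normrN => /(_ hd h0).
rewrite distrC -[h *: 1]/(h * 1) mulr1 (addrC h) => he.
have -> : f (a + h) - f a - 'D_1 f a * h =
    (h^-1 * (f (a + h) - f a) - 'D_1 f a) * h by field.
by rewrite normrM ler_wpM2r.
Qed.

(** Chain rule along a sequence of increments, which need not come from a
    differentiable curve: convergence of their slopes [v k] suffices. *)
Lemma cvg_difference_quotient f a (t v : nat -> R) (v0 : R) : derivable f a 1 ->
  (forall k, 0 < t k) -> t k @[k --> \oo] --> 0 -> v k @[k --> \oo] --> v0 ->
  (f (a + t k * v k) - f a) / t k @[k --> \oo] --> derive1 f a * v0.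
Proof.
move=> df t0 t_cvg v_cvg.
have Dv : derive1 f a * v k @[k --> \oo] --> derive1 f a * v0.
  by apply: cvgM v_cvg; exact: cvg_cst.
suff h0 : (f (a + t k * v k) - f a) / t k - derive1 f a * v k @[k --> \oo] --> (0 : R).
  have -> : (fun k => (f (a + t k * v k) - f a) / t k) =
      (fun k => (f (a + t k * v k) - f a) / t k - derive1 f a * v k) \+
      (fun k => derive1 f a * v k) by apply/funext => k; rewrite /= subrK.
  by rewrite -[X in _ --> X]add0r; exact: cvgD h0 Dv.
apply/cvgr0Pnorm_le => e e0.
have b0 : 0 < `|v0| + 1 by rewrite ltr_wpDl.
have [del del0 hdel] := derivable_expansion df (divr_gt0 e0 b0).
have tv : t k * v k @[k --> \oo] --> (0 : R).
  by rewrite -(mul0r v0); exact: cvgM.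
near=> k.
have vk : `|v k| <= `|v0| + 1.
  near: k; move/cvgrPdist_le : v_cvg => /(_ 1 ltr01); apply: filterS => k.
  by rewrite distrC => h; rewrite -(subrK v0 (v k)) (le_trans (ler_normD _ _))// addrC
    lerD2l.
have tvk : `|t k * v k| < del.
  by near: k; move/cvgr0Pnorm_lt : tv; exact.
have -> : (f (a + t k * v k) - f a) / t k - derive1 f a * v k =
  (f (a + t k * v k) - f a - derive1 f a * (t k * v k)) / t k.
  by field; rewrite gt_eqF.
rewrite normrM normfV (gtr0_norm (t0 k)) ler_pdivrMr//.
apply: le_trans (hdel _ tvk) _; rewrite normrM (gtr0_norm (t0 k)).
rewrite mulrCA mulrC ler_wpM2r ?(ltW (t0 k))//.
by rewrite mulrAC ler_pdivrMr// ler_wpM2l// ltW.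
Unshelve. all: by end_near. Qed.

End sequential_derivative.

Section conjugate_entropy.
Context {R : realType} (phi : R -> \bar R).
Hypotheses (ephi : entropy_function phi) (dphi : differentiable_conjugate phi).
Local Notation psi := (phistar phi).
Implicit Types (a b s t r : R).

Lemma phistarE s : (psi s)%:E = legendre phi s.
Proof. by rewrite fineK//; case: dphi. Qed.

Lemma phistar_ge r s : 0 <= r -> ((r * s)%:E - phi r <= (psi s)%:E)%E.
Proof. by move=> r0; rewrite phistarE; apply: ereal_sup_ubound; exists r. Qed.

Lemma phistar_le s b :
  (forall r, 0 <= r -> ((r * s)%:E - phi r <= b%:E)%E) -> psi s <= b.
Proof.
move=> h; rewrite -lee_fin phistarE; apply: ge_ereal_sup => _ [r r0 <-].
exact: h.
Qed.

Lemma phistar_convex a b t : 0 <= t <= 1 ->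
  psi (t * a + (1 - t) * b) <= t * psi a + (1 - t) * psi b.
Proof.
move=> /andP[t0 t1]; apply: phistar_le => r r0.
have := phistar_ge a r0; have := phistar_ge b r0.
have [_ /(_ r) + _ _ _] := ephi; case: (phi r) => [c| |]//= _; last first.
  by move=> _ _; exact: leNye.
rewrite -!EFinB !lee_fin => hb ha.
have t1' : 0 <= 1 - t by rewrite subr_ge0.
have := ler_wpM2l t0 ha; have := ler_wpM2l t1' hb; lra.
Qed.

Lemma phistar_nondecreasing a b : a <= b -> psi a <= psi b.
Proof.
move=> ab; apply: phistar_le => r r0; apply: le_trans (phistar_ge b r0).
by rewrite leeD2r// lee_fin ler_wpM2l.
Qed.

(** Convexity bounds the secant slopes, whose limit is the derivative. *)
Lemma phistar_tangent a b : derive1 psi a * (b - a) <= psi b - psi a.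
Proof.
have [_ dpsi] := dphi.
have := @cvg_difference_quotient R psi a (@harmonic R) (fun=> b - a) (b - a) (dpsi a).
move=> /(_ (@harmonic_gt0 _) cvg_harmonic (cvg_cst _)) /cvgr_to_le; apply.
near=> k; rewrite ler_pdivrMr ?harmonic_gt0//.
have k01 : 0 <= @harmonic R k <= 1.
  by rewrite harmonic_ge0/= /harmonic invf_le1 ?ler1n.
have := phistar_convex b a k01.
have -> : harmonic k * b + (1 - harmonic k) * a = a + harmonic k * (b - a) by ring.
by lra.
Unshelve. all: by end_near. Qed.

Lemma phistar_derive_ge0 a : 0 <= derive1 psi a.
Proof.
have := phistar_tangent a (a - 1).
have : a - 1 <= a by lra.
by move=> /phistar_nondecreasing; lra.
Qed.

Lemma phistar_derive_nondecreasing : nondecreasing_fun (derive1 psi).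
Proof.
move=> a b; rewrite le_eqVlt => /predU1P[->//|ab].
rewrite -(@ler_pM2r _ (b - a)) ?subr_gt0//.
have := phistar_tangent a b; have := phistar_tangent b a; lra.
Qed.

Lemma phistar_lipschitz B a b : a <= B -> b <= B ->
  `|psi a - psi b| <= derive1 psi B * `|a - b|.
Proof.
wlog ab : a b / a <= b.
  by move=> h aB bB; have [/h|/ltW/h] := leP a b; [exact|rewrite distrC (distrC a);
    exact].
move=> _ bB; rewrite distrC ger0_norm ?subr_ge0 ?phistar_nondecreasing//.
rewrite distrC ger0_norm ?subr_ge0//.
have := phistar_tangent b a.
have : derive1 psi b * (b - a) <= derive1 psi B * (b - a).
  by rewrite ler_wpM2r ?subr_ge0// phistar_derive_nondecreasing.
lra.
Qed.

Lemma phistar_measurable : measurable_fun setT psi.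
Proof.
by apply: nondecreasing_measurable => // a b; exact: phistar_nondecreasing.
Qed.

Lemma phistar_derive_measurable : measurable_fun setT (derive1 psi).
Proof.
by apply: nondecreasing_measurable => //; exact: phistar_derive_nondecreasing.
Qed.

Lemma phistar_bounded B a : `|a| <= B ->
  `|psi a| <= `|psi 0| + derive1 psi B * B.
Proof.
move=> aB; have B0 : 0 <= B by apply: le_trans aB.
rewrite -(subrK (psi 0) (psi a)) addrC.
apply: le_trans (ler_normD _ _) _; rewrite lerD2l.
apply: le_trans (phistar_lipschitz (ler_normlW aB) B0) _.
by rewrite subr0 ler_wpM2l// phistar_derive_ge0.
Qed.

End conjugate_entropy.

(** * Supports, null sets and integrals *)

Section integral_comparison.
Context {R : realType} {disp : measure_display} {T : measurableType disp}.
Variable mu : {measure set T -> \bar R}.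
Local Open Scope ereal_scope.
Import HBNNSimple.

(** The integral of a nonnegative function is a supremum over simple functions
    below it, hence it is monotone without any measurability. *)
Lemma ge0_le_integral_nonmeas (f g : T -> \bar R) :
  (forall x, 0 <= f x) -> (forall x, f x <= g x) ->
  \int[mu]_x f x <= \int[mu]_x g x.
Proof.
move=> f0 fg; have g0 x : 0 <= g x by exact: le_trans (f0 x) (fg x).
rewrite !ge0_integralTE//; apply: ereal_sup_le => _ [h hf <-].
by exists h => // x; exact: le_trans (hf x) (fg x).
Qed.

(** Give [g] the value [+oo] on the exceptional set, so that it dominates
    everywhere. This is how the gradient of a function that is differentiable
    only almost everywhere, hence perhaps not measurable, is integrated. *)
Lemma ge0_le_integral_ae (D S N : set T) (f g : T -> \bar R) :
  measurable S -> mu (~` S) = 0 -> measurable N -> mu N = 0 ->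
  measurable_fun S g -> (forall x, S x -> 0 <= g x) ->
  (forall x, 0 <= f x) -> (forall x, S x -> ~ N x -> f x <= g x) ->
  \int[mu]_(x in D) f x <= \int[mu]_(x in S) g x.
Proof.
move=> mS S0 mN N0 mg g0 f0 fg; rewrite [leRHS]integral_mkcond integral_mkcond.
pose Z := ~` S `|` N; have mZ : measurable Z by apply: measurableU => //;
  exact: measurableC.
have Z0 : mu Z = 0.
  apply/eqP; rewrite -measure_le0 (le_trans (measureU2 _ _ _))//.
    exact: measurableC.
  by rewrite [X in (X + _ <= _)%E]S0 [X in (_ + X <= _)%E]N0 adde0.
have mg' : measurable_fun setT (g \_ S) by apply/(measurable_restrictT _ mS).
have g'0 x : 0 <= (g \_ S) x by rewrite erestrict_ge0.
pose k x := (g \_ S) x + (cst +oo \_ Z) x.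
have mk : measurable_fun setT k.
  by apply: emeasurable_funD => //; apply/(measurable_restrictT _ mZ).
have k0 x : 0 <= k x.
  by apply: adde_ge0; [exact: g'0|apply: erestrict_ge0 => ? _; exact: leey].
have -> : \int[mu]_x (g \_ S) x = \int[mu]_x k x.
  apply: ge0_ae_eq_integral => //; exists Z; split => // x /= /not_implyP[_].
  by apply: contra_notP => nZ; rewrite /k [X in _ + X]patchE memNset// adde0.
apply: ge0_le_integral_nonmeas => x.
  by rewrite patchE; case: ifP.
have [Zx|] := pselect (Z x).
  rewrite /k [X in _ + X]patchE mem_set// addey ?leey//.
  by rewrite gt_eqF// (lt_le_trans _ (g'0 x)).
move=> nZ; rewrite /k [X in _ + X]patchE memNset// adde0.
have /not_orP[/contrapT Sx Nx] := nZ.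
by rewrite patchE; case: ifP => _; rewrite patchE mem_set//; [exact: fg|exact: g0].
Qed.

End integral_comparison.

Lemma negligible_bigcup_countType {R : realType} {disp : measure_display}
    {T : measurableType disp} (mu : {measure set T -> \bar R}) (I : countType)
    (F : I -> set T) :
  (forall i, mu.-negligible (F i)) -> mu.-negligible (\bigcup_i F i).
Proof.
move=> F0; pose G k := if unpickle k is Some i then F i else set0.
have G0 k : mu.-negligible (G k).
  by rewrite /G; case: unpickle => [i|]; [exact: F0|exact: negligible_set0].
apply: negligibleS (negligible_bigcup G0) => x [i _ Fx].
by exists (pickle i) => //; rewrite /G pickleK.
Qed.

Section rV_measure.
Context {R : realType}.

Lemma closed_msupport d (mu : {measure set 'rV[R]_d -> \bar R}) : closed (msupport mu).
Proof.
rewrite -openC (_ : ~` _ =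
    \bigcup_(U in [set U | open U /\ ~ (0 < mu U)%E]) U).
  by apply: bigcup_open => U [].
apply/seteqP; split=> [x /= /existsNP[U /not_implyP[[oU Ux] muU]]|x [U [oU muU] Ux]].
  by exists U.
by move=> /(_ U (conj oU Ux)).
Qed.

(** Balls with rational centers and radii form a countable basis; those of
    measure zero cover the complement of the support. *)
Lemma msupport_full d (mu : {measure set 'rV[R]_d -> \bar R}) :
  mu (~` msupport mu) = 0%E.
Proof.
pose box (c : 'rV[rat]_d * rat) : set 'rV[R]_d :=
  ball (\row_i ratr (c.1 ord0 i) : 'rV[R]_d) (ratr c.2).
pose F c := if mu (box c) == 0%E then box c else set0.
have F0 c : mu.-negligible (F c).
  rewrite /F; case: ifPn => [/eqP b0|_]; last exact: negligible_set0.
  by apply/negligibleP => //; apply: open_measurable_rV; exact: ball_open.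
apply: measure_negligible.
  by apply: open_measurable_rV; exact/closed_openC/closed_msupport.
apply: negligibleS (negligible_bigcup_countType F0) => x /= /existsNP[U /not_implyP[[oU
  Ux] muU]].
have /nbhs_ballP[e /= e0 eU] : nbhs x U by apply: open_nbhs_nbhs.
have /rat_in_itvoo[r] : 0 < e / 2 by rewrite divr_gt0.
rewrite in_itv/= => /andP[r0 re].
have q_ex i : exists q : rat, `|ratr q - x ord0 i| < ratr r.
  have /rat_in_itvoo[q] : x ord0 i - ratr r < x ord0 i + ratr r.
    by rewrite ltrBlDr -addrA ltrDl addr_gt0.
  by rewrite in_itv/= -ltr_distlC distrC; exists q.
pose c := (\row_i sval (cid (q_ex i)), r).
have cx : box c x.
  by split=> // i j; rewrite (ord1 i) /ball/= !mxE; case: cid.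
have cU : box c `<=` U.
  move=> w cw; apply: eU; rewrite (splitr e).
  have xc := le_ball (ltW re) (ball_sym cx).
  exact: ball_triangle xc (le_ball (ltW re) cw).
exists c => //; rewrite /F ifT//.
rewrite -measure_le0 leNgt; apply/negP => muc; apply: muU.
apply: lt_le_trans muc _; apply: le_measure; rewrite ?inE//.
- by apply: open_measurable_rV; exact: ball_open.
- exact: open_measurable_rV.
Qed.

(** Fubini, in the coordinate [i]: that coordinate is integrated first if it is
    the leading one, and otherwise the sections at a fixed leading coordinate
    satisfy the same hypothesis in one dimension less. *)
Lemma lebesgue_rV_null_lines d (i : 'I_d) (N : set 'rV[R]_d) : measurable N ->
  (forall y, countable [set t | N (y + t *: delta_mx ord0 i)]) ->
  lebesgue_rV d N = 0%E.
Proof.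
elim: d => [|d IH] in i N *; first by case: i.
move=> mN cN.
pose A := @rV_cons R d @^-1` N.
have mA : measurable A.
  by rewrite -[A]setTI; exact: measurable_rV_cons.
change ((lebesgue_measure \x lebesgue_rV d)%E A = 0%E).
case: (unliftP ord0 i) => [j ij|i0].
  rewrite /product_measure1; apply: integral0_eq => x _ /=.
  apply: (IH j) => [|v]; first exact: measurable_xsection.
  congr countable: (cN (rV_cons (x, v))); apply/funext => t/=.
  rewrite /A /xsection/= inE/=; congr (N _).
  apply/rowP => k; rewrite !mxE ij; case: (unliftP ord0 k) => [k' ->|->] /=.
    by rewrite ?liftK ?mxE /= (inj_eq lift_inj).
  by rewrite mulr0 addr0.
have -> : (lebesgue_measure \x lebesgue_rV d)%E A =
    (\int[lebesgue_rV d]_v lebesgue_measure (ysection A v))%E.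
  have := indic_fubini_tonelli lebesgue_measure (lebesgue_rV d) mA.
  by rewrite indic_fubini_tonelli_FE ?indic_fubini_tonelli_GE.
apply: integral0_eq => v _ /=; apply: countable_lebesgue_measure0.
congr countable: (cN (rV_cons (0, v))); apply/funext => t/=.
rewrite /A /ysection/= inE/=; congr (N _).
apply/rowP => k; rewrite !mxE i0; case: (unliftP ord0 k) => [k' ->|->] /=.
  by rewrite ?liftK ?mxE/= mulr0 addr0.
by rewrite ?unlift_none ?eqxx mulr1 add0r.
Qed.

Lemma has_density_null d (B N : set 'rV[R]_d) (mu : set 'rV[R]_d -> \bar R) :
  has_density_on B mu -> measurable B -> measurable N ->
  lebesgue_rV d N = 0%E -> mu N = 0%E.
Proof.
move=> [f [mf f0 muE]] mB mN N0; rewrite muE//; apply: null_set_integral.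
- exact: measurableI.
- by apply/measurable_EFinP; exact: measurable_funTS.
- by apply/eqP; rewrite -measure_le0 -N0 le_measure ?inE//; exact: measurableI.
Qed.

End rV_measure.

(** * Conjugates over a compact set *)

Section compact_conjugate.
Context {R : realType} {d : nat} (X : set 'rV[R]_d) (r B : R).
Local Notation E := 'rV[R]_d.
Hypotheses (X0 : X !=set0) (Xr : X `<=` eball r).
Implicit Types (x y v : E) (z : E -> R).

Lemma conjugate_le z y b : (forall x, X x -> dot x y - z x <= b) ->
  conjugate X z y <= b.
Proof.
move=> h; apply: ge_sup; last by move=> _ [x Xx <-]; exact: h.
by have [x Xx] := X0; exists (dot x y - z x), x.
Qed.

Lemma conjugate_ge z x y : (forall x, X x -> `|z x| <= B) -> X x ->
  dot x y - z x <= conjugate X z y.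
Proof.
move=> zB Xx; apply: ub_le_sup; last by exists x.
exists (r * enorm y + B) => _ [x' Xx' <-].
apply: lerD; last by rewrite lerNl; exact: lerNnormlW (zB _ Xx').
by apply: le_trans (dot_le _ _) _; rewrite ler_wpM2r ?enorm_ge0//; exact: Xr.
Qed.

Lemma compact_conjugate_lipschitz z y y0 : (forall x, X x -> `|z x| <= B) ->
  `|conjugate X z y - conjugate X z y0| <= r * enorm (y - y0).
Proof.
move=> zB.
have h y1 y2 : conjugate X z y1 <= conjugate X z y2 + r * enorm (y1 - y2).
  apply: conjugate_le => x Xx.
  have := conjugate_ge y2 zB Xx.
  have : dot x (y1 - y2) <= r * enorm (y1 - y2).
    apply: le_trans (dot_le _ _) _; rewrite ler_wpM2r ?enorm_ge0//; exact: Xr.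
  by rewrite dotBr; lra.
have := h y y0; have := h y0 y; rewrite (enormBC y0) ler_norml => ? ?.
by apply/andP; split; lra.
Qed.

Lemma compact_conjugate_continuous z c : (forall x, X x -> `|z x| <= B) ->
  continuous (fun y => conjugate X z (y + c)).
Proof.
move=> zB; apply: locally_lipschitz_continuous => y0; exists r => y _.
by have := compact_conjugate_lipschitz (y + c) (y0 + c) zB;
  rewrite opprD addrACA subrr addr0.
Qed.

Lemma compact_conjugate_measurable z : (forall x, X x -> `|z x| <= B) ->
  measurable_fun setT (conjugate X z).
Proof.
move=> zB; apply: continuous_measurable.
have := @compact_conjugate_continuous z 0 zB.
by rewrite (_ : (fun y => _) = conjugate X z)//; apply/funext => y; rewrite addr0.
Qed.

Lemma compact_conjugate_slope_nondecreasing z y v (s s1 : R) : (forall x, X x -> `|z x|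
  <= B) ->
  0 < s -> s <= s1 ->
  (conjugate X z (y + s *: v) - conjugate X z y) / s <=
  (conjugate X z (y + s1 *: v) - conjugate X z y) / s1.
Proof.
move=> zB s0 ss1; have s10 : 0 < s1 by exact: lt_le_trans ss1.
rewrite ler_pdivrMr//.
set a := conjugate X z y; set b := conjugate X z (y + s1 *: v).
suff : conjugate X z (y + s *: v) <= a + s / s1 * (b - a).
  have -> : (b - a) / s1 * s = s / s1 * (b - a) by ring.
  lra.
apply: conjugate_le => x Xx.
have ha := conjugate_ge y zB Xx; have hb := conjugate_ge (y + s1 *: v) zB Xx.
rewrite -/a in ha; rewrite -/b !dotDr !dotZr in hb *.
have t0 : 0 <= s / s1 by rewrite divr_ge0 ?ltW.
have t1 : 0 <= 1 - s / s1 by rewrite subr_ge0 ler_pdivrMr// mul1r.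
have -> : s * dot x v = s / s1 * (s1 * dot x v) by rewrite mulrA mulfVK// gt_eqF.
have := ler_wpM2l t0 hb; have := ler_wpM2l t1 ha; lra.
Qed.

Lemma compact_conjugate_attained z y : compact X -> {within X, continuous z} ->
  (forall x, X x -> `|z x| <= B) ->
  exists2 x, X x & conjugate X z y = dot x y - z x.
Proof.
move=> cX cz zB.
have [|x Xx xmax] := @EVT_max_rV R d (fun x => dot x y - z x) X X0 cX.
  move=> x; apply: cvgB; last exact: cz.
  by apply: continuous_subspaceT => ?; exact: continuous_dotl.
rewrite inE in Xx; exists x => //; apply/eqP; rewrite eq_le conjugate_ge// andbT.
by apply: conjugate_le => x' Xx'; apply: xmax; rewrite inE.
Qed.

End compact_conjugate.

Section danskin.
Context {R : realType} {d : nat} (X : set 'rV[R]_d) (r B U : R).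
Local Notation E := 'rV[R]_d.
Hypotheses (X0 : X !=set0) (Xr : X `<=` eball r).
Implicit Types (x y v : E) (z u : E -> R).

Lemma compact_conjugate_dist z z' e y : (forall x, X x -> `|z x| <= B) ->
  (forall x, X x -> `|z' x| <= B) -> (forall x, X x -> `|z x - z' x| <= e) ->
  `|conjugate X z y - conjugate X z' y| <= e.
Proof.
move=> zB z'B zz'.
have h w w' : (forall x, X x -> `|w' x| <= B) -> (forall x, X x -> `|w x - w' x| <= e) ->
    conjugate X w y - conjugate X w' y <= e.
  move=> w'B ww'; rewrite lerBlDr; apply: (conjugate_le X0) => x Xx.
  have := conjugate_ge Xr y w'B Xx; have := ww' x Xx.
  by rewrite ler_norml => /andP[? _]; lra.
rewrite ler_norml h// andbT lerNl opprB; apply: h => // x /zz'.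
by rewrite distrC.
Qed.

Lemma compact_conjugate_bounded z rho y : (forall x, X x -> `|z x| <= B) ->
  enorm y <= rho -> `|conjugate X z y| <= r * rho + B.
Proof.
move=> zB yrho; have [x Xx] := X0.
have h x' : X x' -> `|dot x' y| <= r * rho.
  move=> /Xr/= xr; apply: (le_trans (normr_dot_le _ _)).
  by rewrite ler_pM// enorm_ge0.
rewrite ler_norml; apply/andP; split.
  have := conjugate_ge Xr y zB Xx; have := h x Xx; have := zB x Xx.
  by rewrite !ler_norml => /andP[? ?] /andP[? ?]; lra.
apply: (conjugate_le X0) => x' Xx'; have := h x' Xx'; have := zB x' Xx'.
by rewrite !ler_norml => /andP[? ?] /andP[? ?]; lra.
Qed.

Hypothesis cX : compact X.
Variables (z u : E -> R) (y x0 : E).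
Hypotheses (cz : {within X, continuous z}) (cu : {within X, continuous u})
  (zB : forall x, X x -> `|z x| <= B) (uU : forall x, X x -> `|u x| <= U)
  (Xx0 : X x0) (wx0 : conjugate X z y = dot x0 y - z x0)
  (uniq_x0 : forall x, X x -> conjugate X z y = dot x y - z x -> x = x0).

(** The gap [w y - (<x, y> - z x)] vanishes only at [x0], where the second
    summand of the continuous function [Psi] below is positive; so the minimum
    of [Psi] is positive, and it bounds the gap wherever [u x <= u x0 - e]. *)
Lemma argmax_gap (e : R) : 0 < e -> exists2 del, 0 < del &
  forall x, X x -> u x <= u x0 - e -> dot x y - z x <= conjugate X z y - del.
Proof.
move=> e0; set w := conjugate X z y.
pose Psi x := (w - (dot x y - z x)) + Num.max 0 (u x - (u x0 - e)).
have cPsi : {within X, continuous Psi}.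
  have ccst (c : R) : {within X, continuous (fun=> c)} by move=> ?; exact: cvg_cst.
  move=> x; apply: cvgD; last first.
    apply: (@continuous_max _ (subspace X) (fun=> 0) (fun x => u x - (u x0 - e))).
      exact: ccst.
    by apply: cvgB; [exact: cu|exact: ccst].
  apply: cvgB; first exact: ccst.
  apply: cvgB; last exact: cz.
  by apply: continuous_subspaceT => ?; exact: continuous_dotl.
have [x1 Xx1 x1min] := EVT_min_rV X0 cX cPsi.
rewrite inE in Xx1.
have gap0 x : X x -> 0 <= w - (dot x y - z x).
  by move=> Xx; rewrite subr_ge0; exact: (conjugate_ge Xr y zB).
have max0 x : 0 <= Num.max 0 (u x - (u x0 - e)) by rewrite le_max lexx.
exists (Psi x1).
  rewrite lt_neqAle addr_ge0 ?gap0 ?max0// andbT eq_sym; apply/eqP => P0.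
  have [g1 m1] : w - (dot x1 y - z x1) = 0 /\ Num.max 0 (u x1 - (u x0 - e)) = 0.
    by have := gap0 x1 Xx1; have := max0 x1; move: P0; rewrite /Psi; split; lra.
  have x10 : x1 = x0 by apply: uniq_x0 => //; apply/eqP; rewrite -subr_eq0 -/w g1.
  have : u x1 - (u x0 - e) <= 0 by rewrite -m1 le_max lexx orbT.
  by rewrite x10; lra.
move=> x Xx ux; have := x1min x; rewrite inE => /(_ Xx).
rewrite {2}/Psi max_l; last by lra.
by lra.
Qed.

(** Derivative of the conjugate in the direction [u]: the maximizer for the
    perturbed function must approach [x0], by compactness and uniqueness. *)
Lemma cvg_conjugate_quotient :
  (conjugate X (fun x => z x + harmonic k * u x) y - conjugate X z y) / harmonic k
    @[k --> \oo] --> - u x0.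
Proof.
have U0 : 0 <= U by apply: le_trans (uU Xx0).
apply/cvgrPdist_le => e e0; have [del del0 hdel] := argmax_gap e0.
have U1 : 0 < 2 * U + 1 by lra.
near=> k; have : @harmonic R k <= del / (2 * U + 1).
  near: k; have /cvgrPdist_le/(_ _ (divr_gt0 del0 U1)) := @cvg_harmonic R.
  by apply: filterS => k; rewrite sub0r normrN ger0_norm ?harmonic_ge0.
set t := @harmonic R k => ht.
have t0 : 0 < t by exact: harmonic_gt0.
have tdel : 2 * U * t <= del.
  by move: ht; rewrite ler_pdivlMr//; lra.
have t1 : t <= 1 by rewrite /t /harmonic invf_le1 ?ler1n.
have tB x : X x -> `|z x + t * u x| <= B + U.
  move=> Xx; rewrite (le_trans (ler_normD _ _))// lerD ?zB// normrM (gtr0_norm t0).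
  by rewrite -(mul1r U) ler_pM// ?uU// ltW.
set w := conjugate X z y; set wt := conjugate X _ y.
have wt1 : wt <= w + t * (e - u x0).
  apply: (conjugate_le X0) => x Xx.
  have [ux|ux] := leP (u x) (u x0 - e).
    have h1 := hdel x Xx ux; rewrite -/w in h1.
    have := uU Xx; have := uU Xx0; rewrite !ler_norml => /andP[a1 a2] /andP[b1 b2].
    have : t * (u x0 - u x) <= t * (2 * U) by rewrite ler_pM2l//; lra.
    have : 0 <= t * e by rewrite mulr_ge0// ltW.
    by lra.
  have := conjugate_ge Xr y zB Xx; rewrite -/w.
  have : t * (u x0 - e) <= t * u x by rewrite ler_pM2l// ltW.
  by lra.
have wt2 : w - t * u x0 <= wt.
  have := conjugate_ge Xr y tB Xx0; rewrite -/wt /w wx0; lra.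
have q1 : (wt - w) / t <= e - u x0 by rewrite ler_pdivrMr//; lra.
have q2 : - u x0 <= (wt - w) / t by rewrite ler_pdivlMr//; lra.
by rewrite ler_norml; apply/andP; split; lra.
Unshelve. all: by end_near. Qed.

End danskin.

(** * Comparing two conjugates where they coincide *)

(** The points [t] of such a set are separated by pairwise distinct
    rationals. *)
Lemma countable_right_isolated {R : realType} (A : set R) :
  (forall t, A t -> exists2 e, 0 < e & forall s, 0 < s -> s < e -> ~ A (t + s)) ->
  countable A.
Proof.
move=> isoA.
have /choice[f fP] (t : R) : exists p : rat,
    A t -> t < ratr p /\ forall t', A t' -> t < t' -> ratr p < t'.
  have [At|] := pselect (A t); last by exists 0.
  have [e e0 he] := isoA t At.
  have /rat_in_itvoo[p] : t < t + e by rewrite ltrDl.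
  rewrite in_itv/= => /andP[tp pe]; exists p => _; split=> // t' At' tt'.
  rewrite ltNge; apply/negP => t'p; apply: (he (t' - t)).
  - by rewrite subr_gt0.
  - by rewrite ltrBlDl (le_lt_trans t'p).
  - by rewrite addrC subrK.
have finj : {in A &, injective f}.
  move=> t t' /[!inE] At At' ff; apply/eqP; rewrite eq_le.
  have [tp ht] := fP t At; have [tp' ht'] := fP t' At'.
  by apply/andP; split; rewrite leNgt; apply/negP => lt;
    [have := ht' t At lt; rewrite -ff|have := ht t' At' lt; rewrite ff];
    rewrite ltNge ltW.
apply/countable_injP; exists (pickle \o f).
by move=> t t' At At' /= /(pcan_inj pickleK) /finj; exact.
Qed.

Section coincidence.
Context {R : realType} {d : nat} (M : R -> R) (lambda l : R).
Hypothesis lambda0 : 0 < lambda.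
Local Notation E := 'rV[R]_d.
Local Notation class := (potential_class M lambda l).
Variables (X : set E) (r B : R) (z0 zt : E -> R) (S : set E).
Hypotheses (X0 : X !=set0) (Xr : X `<=` eball r)
  (z0B : forall x, X x -> `|z0 x| <= B) (czt : class zt)
  (clS : closed S).
Local Notation w := (conjugate X z0).
Local Notation g := (conjugate setT zt).
Local Notation p := (grad_conj zt).
Hypothesis wg : forall y, S y -> w y = g y.
Implicit Types (x y v : E).

Let quotient v k y := (w (y + harmonic k *: v) - w y) / harmonic k.

(** The difference quotients of the convex function [w] decrease to its right
    derivative as [k] grows; so this set asks that the latter exceed the
    derivative [dot (p y) v] of [g] by at least [1 / (m + 1)]. Quantifying over
    [k] makes it visibly measurable. *)
Definition slope_gap v m : set E := S `&`
  [set y | forall k, dot (p y) v + harmonic m <= quotient v k y].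

Lemma measurable_slope_gap v m : measurable (slope_gap v m).
Proof.
apply: measurableI; first exact: closed_measurable_rV.
rewrite (_ : [set _ | _] = \bigcap_k
    ((fun y => quotient v k y - dot (p y) v) @^-1` `[harmonic m, +oo[)); last first.
  apply/seteqP; split=> y /= h k; last first.
    by have := h k I; rewrite /= in_itv/= andbT lerBrDr addrC.
  by move=> _ /=; rewrite in_itv/= andbT lerBrDr addrC.
apply: bigcap_measurableType => k _; rewrite -[X in measurable X]setTI.
apply: measurable_funB => //; last first.
  exact: (measurableT_comp (continuous_measurable (@continuous_dotl _ _ v))
    (grad_conj_measurable lambda0 czt)).
apply: measurable_funM => //; apply: measurable_funB.
  apply: continuous_measurable; exact: (@compact_conjugate_continuous _ _ X r B X0 Xr
    z0 _ z0B).
exact: (compact_conjugate_measurable X0 Xr z0B).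
Qed.

(** On a line directed by [v], no point of [S] follows a point of
    [slope_gap v m] closely: [w = g] there, [g] is smooth and the slopes of [w]
    are nondecreasing. *)
Lemma slope_gap_isolated v m y : slope_gap v m y ->
  exists2 e, 0 < e & forall s, 0 < s -> s < e -> ~ S (y + s *: v).
Proof.
move=> [Sy hy]; pose c := enorm v ^+ 2 / (2 * lambda).
have c0 : 0 <= c by rewrite divr_ge0 ?sqr_ge0// mulr_ge0// ltW.
exists (harmonic m / (c + 1)); first by rewrite divr_gt0 ?harmonic_gt0// ltr_wpDl.
move=> s s0; rewrite ltr_pdivlMr ?ltr_wpDl// => sm Ss.
have [k ks] : exists k, @harmonic R k <= s.
  have /cvgrPdist_le/(_ _ s0)[k _ /(_ k (leqnn k))] := @cvg_harmonic R.
  by rewrite sub0r normrN ger0_norm ?harmonic_ge0//; exists k.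
have := compact_conjugate_slope_nondecreasing X0 Xr y v z0B (harmonic_gt0 k) ks.
move=> /(le_trans (hy k)); rewrite ler_pdivlMr// !wg//.
have := conjugate_upper lambda0 y (y + s *: v) czt.
rewrite (addrC y) addrK dotZr enormZ (gtr0_norm s0) exprMn -mulrA -/c.
rewrite expr2 -mulrA => h1 h2.
have : (dot (p y) v + harmonic m) * s <= s * dot (p y) v + s * (s * c) by lra.
rewrite mulrC mulrDr lerD2l ler_pM2l// => h3.
by have := lt_le_trans sm h3; lra.
Qed.

(** The sections by lines are right isolated sets. The sign [sg] covers the left
    derivatives, for which the line is run through backwards. *)
Lemma slope_gap_null (sg : R) i m : sg * sg = 1 ->
  lebesgue_rV d (slope_gap (sg *: delta_mx ord0 i) m) = 0%E.
Proof.
move=> sg2; set v := sg *: _.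
apply: (@lebesgue_rV_null_lines _ _ i) => [|y]; first exact: measurable_slope_gap.
pose A := [set t | slope_gap v m (y + t *: v)].
rewrite (_ : [set t | _] = (fun t => sg * t) @` A); last first.
  apply/seteqP; split=> [t /= ht|_ [t /= ht <-]].
    by exists (sg * t); rewrite ?mulrA ?sg2 ?mul1r// /A/= /v scalerA mulrAC sg2 mul1r.
  by move: ht; rewrite /A/= /v scalerA mulrC.
apply: sub_countable (card_image_le _ _) _.
apply: countable_right_isolated => t /slope_gap_isolated[e e0 he].
exists e => // s s0 se [] + _; rewrite scalerDl addrA; exact: he.
Qed.

Definition slopes_agree y := forall (b : bool) i m,
  ~ slope_gap ((-1) ^+ b *: delta_mx ord0 i) m y.

Lemma slopes_agree_ae : exists N, [/\ measurable N, lebesgue_rV d N = 0%E &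
  forall y, ~ N y -> slopes_agree y].
Proof.
pose F (c : bool * 'I_d * nat) :=
  slope_gap ((-1) ^+ c.1.1 *: delta_mx ord0 c.1.2) c.2.
have [|N [mN N0 FN]] := @negligible_bigcup_countType _ _ _ (lebesgue_rV d) _ F.
  move=> [[b i] m]; apply/negligibleP; first exact: measurable_slope_gap.
  by apply: slope_gap_null; rewrite -expr2 sqrr_sign.
exists N; split=> // y Ny b i m h; apply: Ny; apply: FN.
by exists (b, i, m).
Qed.

Lemma exists_small_quotient y v (e : R) : S y -> (forall m, ~ slope_gap v m y) -> 0 < e ->
  exists k, quotient v k y < dot (p y) v + e.
Proof.
move=> Sy hy e0.
have [m me] : exists m, @harmonic R m <= e.
  have /cvgrPdist_le/(_ _ e0)[k _ /(_ k (leqnn k))] := @cvg_harmonic R.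
  by rewrite sub0r normrN ger0_norm ?harmonic_ge0//; exists k.
apply: contra_notP (hy m) => /forallNP h; split=> // k.
by have /negP := h k; rewrite -leNgt => /(le_trans _); apply; rewrite lerD2l.
Qed.

Lemma quotient_ge x y v k : X x -> w y = dot x y - z0 x -> dot x v <= quotient v k y.
Proof.
move=> Xx wy; rewrite /quotient ler_pdivlMr ?harmonic_gt0//.
have := conjugate_ge Xr (y + harmonic k *: v) z0B Xx.
by rewrite wy dotDr dotZr; lra.
Qed.

(** At almost every point of [S], the maximizers over [X] for [z0] are
    subgradients of [w] and hence equal the gradient of [g]. *)
Lemma slopes_agree_argmax x y : S y -> slopes_agree y -> X x ->
  w y = dot x y - z0 x -> x = p y.
Proof.
move=> Sy ay Xx wy.
have h (b : bool) i : dot x ((-1) ^+ b *: delta_mx ord0 i) <=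
    dot (p y) ((-1) ^+ b *: delta_mx ord0 i).
  apply/ler_addgt0Pr => e e0.
  have [k /ltW] := exists_small_quotient Sy (ay b i) e0.
  by apply: le_trans; exact: quotient_ge.
apply/rowP => i; apply/eqP; rewrite eq_le.
have := h true i; have := h false i.
by rewrite expr0 expr1 scale1r scaleN1r !dotNr !dot_delta lerN2 => -> ->.
Qed.

(** The right derivatives of [w] in the directions [v] and [- v] are at least
    those of the subgradient [p y], and at most these by the choice of [y]. *)
Lemma slopes_agree_gradient z y : class z -> S y -> slopes_agree y -> X (p y) ->
  w y = dot (p y) y - z0 (p y) ->
  gradient (fun y => conjugate setT z y - w y) y = grad_conj z y - p y.
Proof.
move=> cz Sy ay Xp wy; apply/rowP => i; rewrite !mxE.
set h := fun y => _; pose c := (2 * lambda)^-1.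
have c0 : 0 < c by rewrite invr_gt0 mulr_gt0.
have hb (b : bool) e : 0 < e -> exists2 del, 0 < del & forall s, 0 < s -> s < del ->
    let v := (-1) ^+ b *: delta_mx ord0 i in
    `|(h (y + s *: v) - h y) / s - dot (grad_conj z y - p y) v| <= e.
  move=> e0; set v := _ *: _.
  have [k kP] := exists_small_quotient Sy (ay b i) e0.
  exists (Num.min (harmonic k) (e / c)); first by rewrite lt_min harmonic_gt0 divr_gt0.
  move=> s s0; rewrite lt_min ltr_pdivlMr// => /andP[/ltW sk /ltW sc] /=.
  have v1 : enorm v = 1.
    by rewrite enormZ normr_sign mul1r /enorm dot_delta mxE !eqxx sqrtr1.
  have w1 : (w (y + s *: v) - w y) / s <= dot (p y) v + e.
    apply: le_trans (ltW kP); exact: (compact_conjugate_slope_nondecreasing X0 Xr y v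
      z0B s0 sk).
  have w2 : dot (p y) v <= (w (y + s *: v) - w y) / s.
    rewrite ler_pdivlMr//.
    have := conjugate_ge Xr (y + s *: v) z0B Xp.
    by rewrite wy dotDr dotZr; lra.
  have z1 : (conjugate setT z (y + s *: v) - conjugate setT z y) / s <=
      dot (grad_conj z y) v + e.
    rewrite ler_pdivrMr//.
    have := conjugate_upper lambda0 y (y + s *: v) cz.
    rewrite (addrC y) addrK dotZr enormZ v1 mulr1 (gtr0_norm s0) -/c.
    have : s * (s * c) <= s * e by rewrite ler_pM2l.
    by rewrite expr2; lra.
  have z2 : dot (grad_conj z y) v <=
      (conjugate setT z (y + s *: v) - conjugate setT z y) / s.
    rewrite ler_pdivlMr//.
    have := conjugate_lower lambda0 y (y + s *: v) cz.
    by rewrite (addrC y) addrK dotZr; lra.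
  have -> : (h (y + s *: v) - h y) / s =
    (conjugate setT z (y + s *: v) - conjugate setT z y) / s -
    (w (y + s *: v) - w y) / s by rewrite /h; ring.
  by rewrite dotBl ler_norml; apply/andP; split; lra.
apply: cvg_lim => //; apply/(cvgrPdist_le (F := (0 : R)^')) => e e0.
have [d1 d10 h1] := hb false e e0; have [d2 d20 h2] := hb true e e0.
exists (Num.min d1 d2); first by rewrite /= lt_min d10.
move=> t; rewrite /ball/= sub0r normrN lt_min => /andP[td1 td2] t0.
rewrite /= distrC (addrC (t *: _)).
have [tlt|tgt|tE] := ltgtP t 0; last by rewrite tE eqxx in t0.
  have nt0 : 0 < - t by rewrite oppr_gt0.
  rewrite (ltr0_norm tlt) in td2; have := h2 _ nt0 td2.
  rewrite /= expr1 scaleN1r scalerN scaleNr opprK dotNr dot_delta !mxE.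
  have E A a : `|t^-1 * A - a| = `|A / - t - - a| by rewrite -normrN invrN; congr `|_|;
    ring.
  by move=> ht; apply: le_trans ht; rewrite le_eqVlt; apply/orP; left; apply/eqP;
    exact: E.
rewrite (gtr0_norm tgt) in td1; have := h1 _ tgt td1.
by rewrite /= expr0 scale1r dot_delta !mxE mulrC.
Qed.

End coincidence.

(** * Integrals of bounded functions *)

Section probability_integrals.
Context {R : realType} {disp : measure_display} {T : measurableType disp}.
Variable mu : probability T R.
Implicit Types (S D N : set T) (f g : T -> R).

Lemma bounded_integrable S f B : measurable S -> measurable_fun S f ->
  (forall x, S x -> `|f x| <= B) -> mu.-integrable S (EFin \o f).
Proof.
move=> mS mf fB; apply: measurable_bounded_integrable => //.
  by apply: (le_lt_trans (probability_le1 mu mS)); rewrite ltry.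
exists B; split; first exact: num_real.
by move=> b Bb x Sx; exact: le_trans (fB x Sx) (ltW Bb).
Qed.

Definition bounded_measurable S f : Prop :=
  measurable_fun S f /\ exists B, forall x, S x -> `|f x| <= B.

Lemma bounded_measurable_integrable S f : measurable S -> bounded_measurable S f ->
  mu.-integrable S (EFin \o f).
Proof. by move=> mS [mf [B fB]]; exact: bounded_integrable fB. Qed.

Lemma bounded_measurableD S f g : bounded_measurable S f ->
  bounded_measurable S g -> bounded_measurable S (fun x => f x + g x).
Proof.
move=> [mf [B fB]] [mg [B' gB]]; split; first exact: measurable_funD.
by exists (B + B') => x Sx; rewrite (le_trans (ler_normD _ _))// lerD ?fB ?gB.
Qed.

Lemma bounded_measurableM S f g : bounded_measurable S f ->
  bounded_measurable S g -> bounded_measurable S (fun x => f x * g x).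
Proof.
move=> [mf [B fB]] [mg [B' gB]]; split; first exact: measurable_funM.
by exists (B * B') => x Sx; rewrite normrM ler_pM ?fB ?gB.
Qed.

Lemma bounded_measurable_cst S (c : R) : bounded_measurable S (fun=> c).
Proof. by split=> //; exists `|c|. Qed.

Lemma bounded_measurableB S f g : bounded_measurable S f ->
  bounded_measurable S g -> bounded_measurable S (fun x => f x - g x).
Proof.
move=> bf [mg [B gB]]; apply: bounded_measurableD => //.
split; first exact: measurableT_comp.
by exists B => x Sx; rewrite normrN gB.
Qed.

Lemma bounded_measurable_sum S (I : Type) (s : seq I) (F : I -> T -> R) :
  (forall i, bounded_measurable S (F i)) ->
  bounded_measurable S (fun x => \sum_(i <- s) F i x).
Proof.
move=> bF; elim: s => [|i s IH].
  by under eq_fun do rewrite big_nil; exact: bounded_measurable_cst.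
by under eq_fun do rewrite big_cons; exact: bounded_measurableD.
Qed.

Lemma Rintegral_sum S (I : Type) (s : seq I) (F : I -> T -> R) : measurable S ->
  (forall i, bounded_measurable S (F i)) ->
  \int[mu]_(x in S) (\sum_(i <- s) F i x) = \sum_(i <- s) \int[mu]_(x in S) F i x.
Proof.
move=> mS bF; elim: s => [|i s IH].
  by rewrite big_nil; under eq_Rintegral do rewrite big_nil;
    rewrite Rintegral_cst// mul0r.
rewrite big_cons -IH; under eq_Rintegral do rewrite big_cons.
rewrite RintegralD//; apply: bounded_measurable_integrable => //.
exact: bounded_measurable_sum.
Qed.

Lemma EFin_Rintegral S f : measurable S -> mu.-integrable S (EFin \o f) ->
  (\int[mu]_(x in S) (f x)%:E)%E = (\int[mu]_(x in S) f x)%:E.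
Proof. by move=> mS fi; rewrite fineK//; exact: integrable_fin_num. Qed.

Lemma integral_full_subset D S (f : T -> \bar R) : measurable D -> measurable S ->
  S `<=` D -> mu (~` S) = 0%E -> measurable_fun D f ->
  (\int[mu]_(x in D) f x = \int[mu]_(x in S) f x)%E.
Proof.
move=> mD mS SD S0 mf; rewrite integral_mkcond [RHS]integral_mkcond.
apply: ae_eq_integral => //.
- exact/(measurable_restrictT _ mD).
- apply/(measurable_restrictT _ mS); exact: measurable_funS mf.
exists (~` S); split=> //; first exact: measurableC.
move=> x /= + Sx; apply; move=> _.
by rewrite !patchE !mem_set//; exact: SD.
Qed.

Lemma Rintegral_bounded_cvg S N (f_ : nat -> T -> R) f B : measurable S ->
  measurable N -> mu N = 0%E ->
  (forall k, measurable_fun S (f_ k)) -> measurable_fun S f ->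
  (forall k x, S x -> `|f_ k x| <= B) ->
  (forall x, S x -> ~ N x -> f_ k x @[k --> \oo] --> f x) ->
  \int[mu]_(x in S) f_ k x @[k --> \oo] --> \int[mu]_(x in S) f x.
Proof.
move=> mS mN N0 mf_ mf f_B f_f.
have [] // := @dominated_convergence _ _ _ mu S mS (fun k x => (f_ k x)%:E)
  (fun x => (f x)%:E) (fun=> B%:E).
- by move=> k; apply/measurable_EFinP.
- exact/measurable_EFinP.
- exists N; split=> // x /= /not_implyP[Sx]; apply: contra_notP => Nx.
  by apply: cvg_EFin; [exact: nearW|exact: f_f].
- exact: (@bounded_integrable S (cst B) `|B|).
- by apply: aeW => x k Sx; rewrite lee_fin f_B.
move=> fi _ h.
have : fine (\int[mu]_(x in S) (f_ k x)%:E) @[k --> \oo] -->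
    fine (\int[mu]_(x in S) (f x)%:E).
  apply: fine_cvg; rewrite fineK//; exact: integrable_fin_num.
by [].
Qed.

Lemma ge0_le_Rintegral_ae D S N f g : measurable S -> mu (~` S) = 0%E ->
  measurable N -> mu N = 0%E -> bounded_measurable S g ->
  (forall x, 0 <= f x) -> (forall x, 0 <= g x) ->
  (forall x, S x -> ~ N x -> f x <= g x) ->
  (\int[mu]_(x in D) (f x)%:E <= (\int[mu]_(x in S) g x)%:E)%E.
Proof.
move=> mS S0 mN N0 bg f0 g0 fg.
rewrite -(EFin_Rintegral mS (bounded_measurable_integrable mS bg)).
have [mg _] := bg.
apply: (@ge0_le_integral_ae _ _ _ mu D S N (fun x => (f x)%:E) (fun x => (g x)%:E))
  => //; first exact/measurable_EFinP.
all: by move=> *; rewrite lee_fin ?fg.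
Qed.

End probability_integrals.

(** * Optimality and stability of the potential *)

Section potentials.
Context {R : realType} {d : nat} (phi : R -> \bar R).
Hypotheses (ephi : entropy_function phi) (dphi : differentiable_conjugate phi).
Variables (M : R -> R) (lambda l rad : R).
Hypothesis lambda0 : 0 < lambda.
Variables (mu nu : probability 'rV[R]_d R).
Hypotheses (mu_rad : msupport mu `<=` eball rad) (nu_rad : msupport nu `<=` eball rad).
Local Notation E := 'rV[R]_d.
Local Notation class := (potential_class M lambda l).
Local Notation psi := (phistar phi).
Local Notation Smu := (msupport mu).
Local Notation Snu := (msupport nu).
Implicit Types (x y : E) (z : E -> R).

Lemma q_bounded x : eball rad x -> `|q x| <= rad ^+ 2 / 2.
Proof.
move=> xr; rewrite ger0_norm ?q_ge0// /q mulrC ler_wpM2r//.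
by rewrite lerXn2r ?nnegrE ?enorm_ge0// (le_trans _ xr)// enorm_ge0.
Qed.

Lemma measurable_supp (m : probability E R) : measurable (msupport m).
Proof. by apply: closed_measurable_rV; exact: closed_msupport. Qed.

(** Common bound on [z - q] and [z^* - q] over the supports; finding it before
    the dimension is known is what makes the final constants uniform. *)
Definition cost_bound : R :=
  `|M rad| + conj_bound M lambda l rad + rad ^+ 2 / 2.

Lemma potential_cost_bounded z x : class z -> Smu x -> `|z x - q x| <= cost_bound.
Proof.
move=> cz /mu_rad xr; have rad0 : 0 <= rad by apply: le_trans xr; exact: enorm_ge0.
have [bz _ _] := cz.
have h1 := le_trans (bz _ rad0 _ xr) (ler_norm _).
have h2 := q_bounded xr.
have h3 : 0 <= conj_bound M lambda l rad.
  by apply: le_trans (conjugate_bounded lambda0 cz xr).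
by rewrite /cost_bound (le_trans (ler_normB _ _))//; lra.
Qed.

Lemma conjugate_cost_bounded z y : class z -> Snu y ->
  `|conjugate setT z y - q y| <= cost_bound.
Proof.
move=> cz /nu_rad yr; have h1 := conjugate_bounded lambda0 cz yr.
have h2 := q_bounded yr; have h3 := normr_ge0 (M rad).
by rewrite /cost_bound (le_trans (ler_normB _ _))//; lra.
Qed.

Lemma measurable_potential_cost z : class z -> measurable_fun setT (fun x => z x - q x).
Proof.
move=> cz; apply: measurable_funB; apply: continuous_measurable.
  exact: (potential_class_continuous lambda0 cz).
exact: continuous_q.
Qed.

Lemma measurable_conjugate_cost z : class z ->
  measurable_fun setT (fun y => conjugate setT z y - q y).
Proof.
move=> cz; apply: measurable_funB; apply: continuous_measurable.
  exact: (conjugate_continuous lambda0 cz).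
exact: continuous_q.
Qed.

Definition mu_part z : R := \int[mu]_(x in Smu) psi (z x - q x).
Definition nu_part (w : E -> R) : R := \int[nu]_(y in Snu) psi (w y - q y).

Lemma semidualE D z B : measurable D -> Smu `<=` D ->
  measurable_fun D z -> measurable_fun setT (conjugate D z) ->
  (forall x, Smu x -> `|z x - q x| <= B) ->
  (forall y, Snu y -> `|conjugate D z y - q y| <= B) ->
  semidual phi mu nu D z = (mu_part z + nu_part (conjugate D z))%:E.
Proof.
move=> mD SD mz mw zB wB; have mS := measurable_supp.
have mq (A : set E) : measurable_fun A (@q R d).
  by apply: measurable_funTS; apply: continuous_measurable; exact: continuous_q.
have mpsi (f : E -> R) A : measurable_fun A f -> measurable_fun A (fun x => psi (f x)).
  by move=> mf; exact: (measurableT_comp (phistar_measurable dphi) mf).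
have m1 : measurable_fun D (fun x => psi (z x - q x)).
  by apply: mpsi; exact: measurable_funB.
have m2 : measurable_fun setT (fun x => psi (conjugate D z x - q x)).
  by apply: mpsi; exact: measurable_funB.
rewrite /semidual (integral_full_subset mD (mS mu) SD (msupport_full mu)); last first.
  exact/measurable_EFinP.
rewrite (integral_full_subset measurableT (mS nu) _ (msupport_full nu))//; last first.
  exact/measurable_EFinP.
rewrite !EFin_Rintegral//.
- apply: (@bounded_integrable _ _ _ nu _ _ (`|psi 0| + derive1 psi B * B));
    [exact: mS| |].
    exact: measurable_funTS.
  by move=> y Sy; exact: (phistar_bounded ephi dphi (wB y Sy)).
- apply: (@bounded_integrable _ _ _ mu _ _ (`|psi 0| + derive1 psi B * B));
    [exact: mS| |].
    exact: measurable_funS m1.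
  by move=> y Sy; exact: (phistar_bounded ephi dphi (zB y Sy)).
Qed.

End potentials.
Section optimality.
Context {R : realType} {d : nat} (phi : R -> \bar R).
Hypotheses (ephi : entropy_function phi) (dphi : differentiable_conjugate phi).
Variables (M : R -> R) (lambda l rad : R).
Hypothesis lambda0 : 0 < lambda.
Variables (mu nu : probability 'rV[R]_d R) (X : set 'rV[R]_d).
Hypotheses (mu_rad : msupport mu `<=` eball rad) (nu_rad : msupport nu `<=` eball rad)
  (nu_density : has_density_on (eball rad) nu)
  (cX : compact X) (muX : mu (~` X) = 0%E).
Local Notation E := 'rV[R]_d.
Local Notation class := (potential_class M lambda l).
Local Notation psi := (phistar phi).
Local Notation Smu := (msupport mu).
Local Notation Snu := (msupport nu).
Variables (z0 zt : E -> R).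
Hypotheses (uot : uot_potential phi mu nu X z0) (czt : class zt)
  (zt_mu : forall v, Smu v -> zt v = z0 v)
  (zt_nu : forall v, Snu v -> conjugate setT zt v = conjugate X z0 v).
Local Notation w := (conjugate X z0).
Local Notation p := (grad_conj zt).
Implicit Types (x y : E) (z : E -> R).

Lemma closed_domain : closed X.
Proof. by apply: compact_closed => //; exact: norm_hausdorff. Qed.

Lemma msupport_domain : Smu `<=` X.
Proof.
move=> x Sx; apply: contrapT => nXx.
suff : (0 < mu (~` X))%E by rewrite muX ltxx.
by apply: Sx; split=> //; apply: closed_openC; exact: closed_domain.
Qed.

Lemma domain_nonempty : X !=set0.
Proof.
apply/set0P/negP => /eqP X0; move: muX; rewrite X0 setC0 probability_setT.
by move/eqP; rewrite onee_eq0.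
Qed.

Lemma measurable_eball rho : measurable (eball rho : set E).
Proof.
apply: closed_measurable_rV; apply: compact_closed; first exact: norm_hausdorff.
exact: compact_eball.
Qed.

(** Convexity of [w] alone would only make its gradient the maximizer where [w]
    is differentiable; the coincidence with the smooth conjugate of [zt] on the
    support of [nu] identifies both with [p]. The density of [nu] serves to
    discard the points where the slopes disagree. *)
Lemma optimal_map_ae : exists N, [/\ measurable N, nu N = 0%E &
  forall y, Snu y -> ~ N y ->
  [/\ X (p y), w y = dot (p y) y - z0 (p y),
      forall x, X x -> w y = dot x y - z0 x -> x = p y &
      forall z, class z ->
        gradient (fun y => conjugate setT z y - w y) y = grad_conj z y - p y]].
Proof.
have [[cz0 _ [B0 z0B]] _] := uot.
have [r Xr] := compact_sub_eball cX.
have X0 := domain_nonempty.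
have clS : closed Snu by exact: closed_msupport.
have wg y : Snu y -> w y = conjugate setT zt y by move=> /zt_nu.
have [N [mN N0 hN]] := slopes_agree_ae lambda0 X0 Xr z0B czt clS wg.
exists N; split=> //.
  exact: has_density_null nu_density (measurable_eball _) mN N0.
move=> y Sy Ny; have ay := hN y Ny.
have [x Xx wx] := compact_conjugate_attained X0 Xr y cX cz0 z0B.
have uniq_p x' : X x' -> w y = dot x' y - z0 x' -> x' = p y.
  exact: (slopes_agree_argmax Xr z0B Sy ay).
have xp := uniq_p _ Xx wx; rewrite xp in Xx wx.
split=> // z cz; exact: (slopes_agree_gradient lambda0 X0 Xr z0B cz Sy ay Xx wx).
Qed.

(** First order optimality of [z0] in the direction of [z], by dominated
    convergence of the difference quotients of the semi-dual functional along
    the segments from [z0] to [z]. By the definition of [w], the last factor is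
    [z0 (p y) - z (p y)] almost everywhere: this is the half that is needed of the
    fact that [p] pushes the reweighted [nu] forward to the reweighted [mu]. *)
Lemma first_order_optimality z : class z ->
  0 <= \int[mu]_(x in Smu) (derive1 psi (z0 x - q x) * (z x - z0 x)) +
       \int[nu]_(y in Snu) (derive1 psi (w y - q y) *
         (dot (p y) y - w y - z (p y))).
Proof.
move=> cz.
have [[cz0 vz0 [B0 z0B]] z0min] := uot.
have [r Xr] := compact_sub_eball cX.
have X0 := domain_nonempty.
have r0 : 0 <= r by have [x /Xr] := X0; apply: le_trans; exact: enorm_ge0.
have [bz _ _] := cz.
pose U := B0 + M r; pose u x := z x - z0 x.
have uU x : X x -> `|u x| <= U.
  move=> Xx; rewrite (le_trans (ler_normB _ _))// /U addrC lerD ?z0B//.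
  by apply: bz => //; exact: Xr.
have [x1 Xx1] := X0.
have B00 : 0 <= B0 by apply: le_trans (z0B x1 Xx1).
have U0 : 0 <= U by apply: le_trans (uU x1 Xx1).
pose h := @harmonic R; have h0 k : 0 < h k by exact: harmonic_gt0.
have h1 k : h k <= 1 by rewrite /h /harmonic invf_le1 ?ler1n.
pose zk k x := z0 x + h k * u x.
have clX := closed_domain; have mX := closed_measurable_rV clX.
have czX : {within X, continuous z}.
  by apply: continuous_subspaceT; exact: (potential_class_continuous lambda0 cz).
have cu : {within X, continuous u} by move=> x; apply: cvgB; [exact: czX|exact: cz0].
have czk k : {within X, continuous (zk k)}.
  move=> x; apply: cvgD; first exact: cz0.
  by apply: cvgM; [exact: cvg_cst|exact: cu].
have zkB k x : X x -> `|zk k x| <= B0 + U.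
  move=> Xx; rewrite (le_trans (ler_normD _ _))// lerD ?z0B// normrM (gtr0_norm (h0 k)).
  by rewrite -(mul1r U) ler_pM// ?uU// ltW.
have z0B' x : X x -> `|z0 x| <= B0 + U by move=> /z0B h'; rewrite (le_trans h')// lerDl.
have Jk k : (semidual phi mu nu X z0 <= semidual phi mu nu X (zk k))%E.
  apply: z0min; split; [exact: czk| |by exists (B0 + U); exact: zkB].
  move=> x y t Xx Xy t01 Xxy; have := vz0 x y t Xx Xy t01 Xxy.
  have := potential_class_convex lambda0 x y cz t01; rewrite /zk /u.
  set a := z (_ + _); set b := z0 (_ + _) => ha hb.
  have := ler_wpM2l (ltW (h0 k)) ha.
  have h1k : 0 <= 1 - h k by rewrite subr_ge0.
  have := ler_wpM2l h1k hb; lra.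
(* A bound on the costs along all the segments, hence on the slopes of [phi^*]. *)
pose Bc := r * `|rad| + (B0 + U) + rad ^+ 2 / 2.
have rr0 : 0 <= r * `|rad| by rewrite mulr_ge0.
have costX (f : E -> R) x : (forall x, X x -> `|f x| <= B0 + U) -> Smu x -> `|f x - q
  x| <= Bc.
  move=> fB Sx; rewrite (le_trans (ler_normB _ _))// lerD ?q_bounded//;
    last exact: mu_rad.
  by rewrite (le_trans (fB x (msupport_domain Sx)))// lerDr.
have costw (f : E -> R) y : (forall x, X x -> `|f x| <= B0 + U) -> Snu y ->
    `|conjugate X f y - q y| <= Bc.
  move=> fB Sy; rewrite (le_trans (ler_normB _ _))// lerD ?q_bounded//;
    last exact: nu_rad.
  by apply: (compact_conjugate_bounded X0 Xr fB);
    rewrite (le_trans (nu_rad Sy))// ler_norm.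
have mw (f : E -> R) : (forall x, X x -> `|f x| <= B0 + U) -> measurable_fun setT
  (conjugate X f).
  exact: (compact_conjugate_measurable X0 Xr).
have mSmu : measurable Smu by exact: measurable_supp.
have mSnu : measurable Snu by exact: measurable_supp.
have mXf (f : E -> R) : {within X, continuous f} -> measurable_fun Smu f.
  by move=> cf; apply: measurable_funS (continuous_within_measurable clX cf) => //;
    exact: msupport_domain.
have Jz (f : E -> R) : {within X, continuous f} -> (forall x, X x -> `|f x| <= B0 + U) ->
    semidual phi mu nu X f = (mu_part phi mu f + nu_part phi nu (conjugate X f))%:E.
  move=> cf fB; apply: (@semidualE _ _ phi ephi dphi mu nu X f Bc) => //.
  - exact: msupport_domain.
  - exact: continuous_within_measurable.
  - exact: mw.
  - by move=> x; exact: costX.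
  - by move=> y; exact: costw.
have mq (A : set E) : measurable_fun A (@q R d).
  by apply: measurable_funTS; apply: continuous_measurable; exact: continuous_q.
have mpsi (f : E -> R) A : measurable_fun A f -> measurable_fun A (fun x => psi (f x)).
  by move=> mf; exact: (measurableT_comp (phistar_measurable dphi) mf).
have mpsi' (f : E -> R) A : measurable_fun A f ->
    measurable_fun A (fun x => derive1 psi (f x)).
  by move=> mf; exact: (measurableT_comp (phistar_derive_measurable ephi dphi) mf).
pose K := derive1 psi Bc.
have quot (m : probability E R) (S : set E) (f f' : E -> R) k : measurable S ->
    measurable_fun S f -> measurable_fun S f' ->
    (forall x, S x -> `|f x| <= Bc) -> (forall x, S x -> `|f' x| <= Bc) ->
    \int[m]_(x in S) ((psi (f' x) - psi (f x)) / h k) =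
    (\int[m]_(x in S) psi (f' x) - \int[m]_(x in S) psi (f x)) / h k.
  move=> mS mf mf' fB f'B.
  have i1 : m.-integrable S (EFin \o (fun x => psi (f x))).
    apply: (@bounded_integrable _ _ _ m _ _ (`|psi 0| + derive1 psi Bc * Bc)) => //.
      exact: mpsi.
    by move=> x Sx; exact: (phistar_bounded ephi dphi (fB x Sx)).
  have i2 : m.-integrable S (EFin \o (fun x => psi (f' x))).
    apply: (@bounded_integrable _ _ _ m _ _ (`|psi 0| + derive1 psi Bc * Bc)) => //.
      exact: mpsi.
    by move=> x Sx; exact: (phistar_bounded ephi dphi (f'B x Sx)).
  rewrite RintegralZr//; last by apply: (integrableB mS i2 i1).
  by rewrite RintegralB.
have quot_ge0 (a b a' b' s : R) : 0 < s -> b + b' <= a + a' ->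
    0 <= (a - b) / s + (a' - b') / s.
  by move=> s0 ab; rewrite -mulrDl divr_ge0 ?(ltW s0)//; lra.
pose A k := \int[mu]_(x in Smu) ((psi (zk k x - q x) - psi (z0 x - q x)) / h k).
pose B k := \int[nu]_(y in Snu)
  ((psi (conjugate X (zk k) y - q y) - psi (w y - q y)) / h k).
have AB k : 0 <= A k + B k.
  have := Jk k; rewrite (Jz z0 cz0 z0B') (Jz _ (czk k) (zkB k)) lee_fin /mu_part
    /nu_part => J.
  rewrite /A /B !quot//.
  - exact: quot_ge0 (h0 k) J.
  - by apply: measurable_funB => //; apply: measurable_funTS; exact: mw.
  - by apply: measurable_funB => //; apply: measurable_funTS; apply: mw; exact: zkB.
  - by move=> y Sy; exact: costw.
  - by move=> y Sy; apply: costw => //; exact: zkB.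
  - by apply: measurable_funB => //; exact: mXf.
  - by apply: measurable_funB => //; exact: mXf.
  - by move=> y Sy; exact: costX.
  - by move=> y Sy; apply: costX => //; exact: zkB.
have [_ dpsi] := dphi.
have Acvg : A k @[k --> \oo] --> \int[mu]_(x in Smu) (derive1 psi (z0 x - q x) * u x).
  apply: (@Rintegral_bounded_cvg _ _ _ mu Smu set0 _ _ (K * U)) => //.
  - move=> k; apply: measurable_funM => //; apply: measurable_funB; apply: mpsi;
    by apply: measurable_funB => //; exact: mXf.
  - apply: measurable_funM; last exact: mXf.
    by apply: mpsi'; apply: measurable_funB => //; exact: mXf.
  - move=> k x Sx; rewrite normrM normfV (gtr0_norm (h0 k)) ler_pdivrMr//.
    have b1 := costX _ _ (zkB k) Sx; have b2 := costX _ _ z0B' Sx.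
    apply: le_trans (phistar_lipschitz ephi dphi (ler_normlW b1) (ler_normlW b2)) _.
    rewrite -mulrA ler_wpM2l ?(phistar_derive_ge0 ephi dphi)//.
    have -> : zk k x - q x - (z0 x - q x) = h k * u x by rewrite /zk; ring.
    by rewrite normrM (gtr0_norm (h0 k)) mulrC ler_wpM2r ?(ltW (h0 k))// uU//;
      exact: msupport_domain.
  - move=> x Sx _; have eqk k : (psi (zk k x - q x) - psi (z0 x - q x)) / h k =
        (psi ((z0 x - q x) + h k * u x) - psi (z0 x - q x)) / h k.
      by congr ((psi _ - _) / _); rewrite /zk; ring.
    rewrite (funext eqk).
    exact: (cvg_difference_quotient (dpsi (z0 x - q x)) h0 cvg_harmonic (cvg_cst (u x))).
have Bcvg : B k @[k --> \oo] --> \int[nu]_(y in Snu)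
    (derive1 psi (w y - q y) * (dot (p y) y - w y - z (p y))).
  have [N [mN N0 hN]] := optimal_map_ae.
  apply: (@Rintegral_bounded_cvg _ _ _ nu Snu N _ _ (K * U)) => //.
  - move=> k; apply: measurable_funM => //; apply: measurable_funB; apply: mpsi;
    by apply: measurable_funB => //; apply: measurable_funTS; apply: mw => //; exact: zkB.
  - apply: measurable_funTS; apply: measurable_funM.
      by apply: mpsi'; apply: measurable_funB => //; exact: mw.
    have mp := grad_conj_measurable lambda0 czt.
    apply: measurable_funB; last first.
      exact: (measurableT_comp (continuous_measurable (potential_class_continuous
        lambda0 cz)) mp).
    apply: measurable_funB; last exact: mw.
    apply: measurable_sum => i; apply: measurable_funM; last exact: measurable_coord.
    exact: (measurableT_comp (measurable_coord i) mp).
  - move=> k y Sy; rewrite normrM normfV (gtr0_norm (h0 k)) ler_pdivrMr//.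
    have b1 := costw _ _ (zkB k) Sy; have b2 := costw _ _ z0B' Sy.
    apply: le_trans (phistar_lipschitz ephi dphi (ler_normlW b1) (ler_normlW b2)) _.
    rewrite -mulrA ler_wpM2l ?(phistar_derive_ge0 ephi dphi)//.
    rewrite opprB addrA subrK.
    apply: (compact_conjugate_dist X0 Xr y (zkB k) z0B') => x Xx.
    have -> : zk k x - z0 x = h k * u x by rewrite /zk; ring.
    by rewrite normrM (gtr0_norm (h0 k)) mulrC ler_wpM2r ?(ltW (h0 k))// uU.
  - move=> y Sy Ny; have [Xp wp uniq_p _] := hN y Sy Ny.
    have dcv := cvg_conjugate_quotient X0 Xr cX cz0 cu z0B uU Xp wp uniq_p.
    have -> : dot (p y) y - w y - z (p y) = - u (p y) by rewrite /u wp; ring.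
    pose v k := (conjugate X (zk k) y - w y) / h k.
    have eqk k : (psi (conjugate X (zk k) y - q y) - psi (w y - q y)) / h k =
        (psi ((w y - q y) + h k * v k) - psi (w y - q y)) / h k.
      by congr ((psi _ - _) / _); rewrite /v mulrC divfK ?gt_eqF//; ring.
    rewrite (funext eqk).
    exact: (cvg_difference_quotient (dpsi (w y - q y)) h0 cvg_harmonic dcv).
have ABcvg := cvgD Acvg Bcvg.
exact: (cvgr_to_ge (ABcvg _) (nearW _ AB)).
Qed.

(** The distance is controlled by the excess of the semi-dual functional. The
    first order condition turns the linear part of the excess into the integral
    against the reweighted [nu] of the Young gap of [z] at [(p y, y)], which by
    strong convexity dominates the squared distance between [p y] and the
    gradient of the conjugate of [z]. *)
Lemma stability z c : class z -> 0 <= c ->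
  (forall x, Smu x -> convexity_bound phi c (z0 x - q x) (z x - q x)) ->
  (forall y, Snu y -> convexity_bound phi c (w y - q y) (conjugate setT z y - q y)) ->
  (dHcirc2 phi mu nu X z0 lambda c setT z X z0 <=
   ((1 + lambda ^- 2) * (mu_part phi mu z + nu_part phi nu (conjugate setT z) -
     (mu_part phi mu zt + nu_part phi nu (conjugate setT zt))))%:E)%E.
Proof.
move=> cz c0 convmu convnu.
have mSmu : measurable Smu by exact: measurable_supp.
have mSnu : measurable Snu by exact: measurable_supp.
pose g := conjugate setT zt; pose zs := conjugate setT z.
have wg y : Snu y -> w y = g y by move=> /zt_nu.
have bm_costmu f : class f -> bounded_measurable Smu (fun x => f x - q x).
  move=> cf; split; first by apply: measurable_funTS;
    exact: (measurable_potential_cost lambda0 cf).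
  by exists (cost_bound M lambda l rad) => x; exact: potential_cost_bounded.
have bm_costnu f : class f -> bounded_measurable Snu (fun y => conjugate setT f y - q y).
  move=> cf; split; first by apply: measurable_funTS;
    exact: (measurable_conjugate_cost lambda0 cf).
  by exists (cost_bound M lambda l rad) => x; exact: conjugate_cost_bounded.
have bm_psi S (f : E -> R) : bounded_measurable S f -> bounded_measurable S (fun x =>
  psi (f x)).
  move=> [mf [B fB]]; split; first exact: (measurableT_comp (phistar_measurable dphi) mf).
  by eexists => x Sx; exact: (phistar_bounded ephi dphi (fB x Sx)).
have bm_psi' S (f : E -> R) : bounded_measurable S f ->
    bounded_measurable S (fun x => derive1 psi (f x)).
  move=> [mf [B fB]]; split; first exact: (measurableT_comp (phistar_derive_measurable
    ephi dphi) mf).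
  exists (derive1 psi B) => x Sx; rewrite ger0_norm ?(phistar_derive_ge0 ephi dphi)//.
  exact/(phistar_derive_nondecreasing ephi dphi)/ler_normlW/fB.
have bm_diffmu : bounded_measurable Smu (fun x => z x - zt x).
  have -> : (fun x => z x - zt x) = (fun x => (z x - q x) - (zt x - q x)).
    by apply/funext => x; ring.
  by apply: bounded_measurableB; exact: bm_costmu.
have bm_diffnu : bounded_measurable Snu (fun y => zs y - g y).
  have -> : (fun y => zs y - g y) = (fun y => (zs y - q y) - (g y - q y)).
    by apply/funext => y; ring.
  by apply: bounded_measurableB; exact: bm_costnu.
have mgrad f : class f -> measurable_fun setT (grad_conj f).
  by move=> cf; exact: (grad_conj_measurable lambda0 cf).
pose R1 := conj_radius M lambda l rad.
have R10 : 0 <= R1 by rewrite (le_trans ler01)// conj_radius_gt1.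
have gradB f y : class f -> Snu y -> enorm (grad_conj f y) <= R1.
  by move=> cf /nu_rad; exact: grad_conj_bounded.
have bm_at_p f : class f -> bounded_measurable Snu (fun y => f (p y)).
  move=> cf; split.
    apply: measurable_funTS.
    exact: (measurableT_comp (continuous_measurable (potential_class_continuous lambda0
      cf)) (grad_conj_measurable lambda0 czt)).
  by exists (M R1) => y Sy; have [bf _ _] := cf; apply: bf => //; exact: gradB.
pose gap y := enorm (grad_conj z y - p y) ^+ 2.
have bm_gap : bounded_measurable Snu gap.
  split.
    apply: measurable_funTS; rewrite /gap.
    have -> : (fun y => enorm (grad_conj z y - p y) ^+ 2) =
        (fun y => \sum_i (grad_conj z y ord0 i - p y ord0 i) * (grad_conj z y ord0 i -
          p y ord0 i)).
      by apply/funext => y; rewrite sqr_enorm /dot; apply: eq_bigr => i _; rewrite !mxE.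
    by apply: measurable_sum => i; apply: measurable_funM; apply: measurable_funB;
      apply: (measurableT_comp (measurable_coord i)); exact: mgrad.
  exists ((R1 + R1) ^+ 2) => y Sy; rewrite ger0_norm ?sqr_ge0//.
  have RR : 0 <= R1 + R1 by exact: addr_ge0.
  rewrite lerXn2r ?nnegrE ?enorm_ge0//.
  by rewrite (le_trans (enormD _ _))// enormN lerD// gradB.
pose dmu x := derive1 psi (zt x - q x); pose dnu y := derive1 psi (g y - q y).
have bm_dmu : bounded_measurable Smu dmu by apply: bm_psi'; exact: bm_costmu.
have bm_dnu : bounded_measurable Snu dnu by apply: bm_psi'; exact: bm_costnu.
have dnu0 y : 0 <= dnu y by exact: (phistar_derive_ge0 ephi dphi).
pose I1 := \int[mu]_(x in Smu) (dmu x * (z x - zt x)).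
pose I2 := \int[nu]_(y in Snu) (dnu y * (zs y - g y)).
pose I3 := \int[nu]_(y in Snu) (dnu y * (zt (p y) - z (p y))).
have I130 : 0 <= I1 + I3.
  have := first_order_optimality cz; congr (_ <= _ + _).
    by apply: eq_Rintegral => x /[!inE] Sx; rewrite /dmu zt_mu.
  apply: eq_Rintegral => y /[!inE] Sy; rewrite /dnu wg//.
  by congr (_ * (_ - _)); rewrite /g (conjugateE lambda0 _ czt); ring.
pose Q1 := \int[nu]_(y in Snu) ((zs y - g y) ^+ 2).
pose Q2 := \int[mu]_(x in Smu) ((z x - zt x) ^+ 2).
pose G := \int[nu]_(y in Snu) (gap y * dnu y).
have int_mu f : bounded_measurable Smu f -> mu.-integrable Smu (EFin \o f).
  exact: bounded_measurable_integrable.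
have int_nu f : bounded_measurable Snu f -> nu.-integrable Snu (EFin \o f).
  exact: bounded_measurable_integrable.
have Q10 : 0 <= Q1 by apply: Rintegral_ge0 => ? _; exact: sqr_ge0.
have Q20 : 0 <= Q2 by apply: Rintegral_ge0 => ? _; exact: sqr_ge0.
have G0 : 0 <= G by apply: Rintegral_ge0 => ? _; rewrite mulr_ge0 ?sqr_ge0.
have excess_mu : I1 + c * Q2 <= mu_part phi mu z - mu_part phi mu zt.
  rewrite /I1 /Q2 /mu_part -RintegralZl//; last first.
    by apply: int_mu; exact: bounded_measurableM.
  rewrite -RintegralD//; last first.
  - apply: int_mu; apply: bounded_measurableM; first exact: bounded_measurable_cst.
    exact: bounded_measurableM.
  - by apply: int_mu; exact: bounded_measurableM.
  rewrite -RintegralB//; last first.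
  - by apply: int_mu; apply: bm_psi; exact: bm_costmu.
  - by apply: int_mu; apply: bm_psi; exact: bm_costmu.
  apply: le_Rintegral => //.
  - apply: int_mu; apply: bounded_measurableD; first exact: bounded_measurableM.
    apply: bounded_measurableM; first exact: bounded_measurable_cst.
    exact: bounded_measurableM.
  - by apply: int_mu; apply: bounded_measurableB; apply: bm_psi; exact: bm_costmu.
  move=> x Sx; have := convmu x Sx; rewrite /convexity_bound -!zt_mu//.
  by have -> : z x - q x - (zt x - q x) = z x - zt x by ring.
have excess_nu : I2 + c * Q1 <= nu_part phi nu zs - nu_part phi nu g.
  rewrite /I2 /Q1 /nu_part -RintegralZl//; last first.
    by apply: int_nu; exact: bounded_measurableM.
  rewrite -RintegralD//; last first.
  - apply: int_nu; apply: bounded_measurableM; first exact: bounded_measurable_cst.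
    exact: bounded_measurableM.
  - by apply: int_nu; exact: bounded_measurableM.
  rewrite -RintegralB//; last first.
  - by apply: int_nu; apply: bm_psi; exact: bm_costnu.
  - by apply: int_nu; apply: bm_psi; exact: bm_costnu.
  apply: le_Rintegral => //.
  - apply: int_nu; apply: bounded_measurableD; first exact: bounded_measurableM.
    apply: bounded_measurableM; first exact: bounded_measurable_cst.
    exact: bounded_measurableM.
  - by apply: int_nu; apply: bounded_measurableB; apply: bm_psi; exact: bm_costnu.
  move=> y Sy; have := convnu y Sy; rewrite /convexity_bound -!zt_nu//.
  by have -> : conjugate setT z y - q y - (conjugate setT zt y - q y) = zs y - g y by
    rewrite /zs /g; ring.
have I23 : lambda / 2 * G <= I2 - I3.
  rewrite /I2 /I3 /G -RintegralZl//; last by apply: int_nu; exact: bounded_measurableM.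
  have bm3 : bounded_measurable Snu (fun y => dnu y * (zt (p y) - z (p y))).
    by apply: bounded_measurableM => //; apply: bounded_measurableB; exact: bm_at_p.
  have bm2 : bounded_measurable Snu (fun y => dnu y * (zs y - g y)).
    exact: bounded_measurableM.
  rewrite -RintegralB//; [|exact: int_nu|exact: int_nu].
  apply: le_Rintegral => //.
  - apply: int_nu; apply: bounded_measurableM; first exact: bounded_measurable_cst.
    exact: bounded_measurableM.
  - by apply: int_nu; exact: bounded_measurableB.
  move=> y Sy; have := young_gap lambda0 (p y) y cz;
    rewrite enormBC -/(gap y) -/(zs y) => h.
  have gE : g y = dot (p y) y - zt (p y) by rewrite /g (conjugateE lambda0 y czt).
  rewrite gE -mulrBr mulrA mulrC ler_wpM2l//.
  by apply: le_trans h _; rewrite le_eqVlt; apply/orP; left; apply/eqP; ring.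
have [N [mN N0 hN]] := optimal_map_ae.
have bound1 : (\int[nu]_y (enorm (gradient (fun y => conjugate setT z y - w y) y) ^+ 2 *
    tilde_density phi X z0 y)%:E <= G%:E)%E.
  apply: (ge0_le_Rintegral_ae _ mSnu (msupport_full nu) mN N0).
  - exact: bounded_measurableM.
  - move=> y; apply: mulr_ge0; first exact: sqr_ge0.
    exact: (phistar_derive_ge0 ephi dphi).
  - by move=> y; apply: mulr_ge0; [exact: sqr_ge0|exact: dnu0].
  - move=> y Sy Ny; have [_ _ _ /(_ z cz) ->] := hN y Sy Ny.
    by rewrite /tilde_density wg.
have bound2 : (\int[nu]_y ((conjugate setT z y - w y) ^+ 2)%:E <= Q1%:E)%E.
  apply: (ge0_le_Rintegral_ae _ mSnu (msupport_full nu) (@measurable0 _ _) (measure0 nu)).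
  - exact: bounded_measurableM.
  - by move=> ?; exact: sqr_ge0.
  - by move=> ?; exact: sqr_ge0.
  - by move=> ? Sy _; rewrite wg.
have bound3 : (\int[mu]_(x in setT `&` X) ((z x - z0 x) ^+ 2)%:E <= Q2%:E)%E.
  apply: (ge0_le_Rintegral_ae _ mSmu (msupport_full mu) (@measurable0 _ _) (measure0 mu)).
  - exact: bounded_measurableM.
  - by move=> ?; exact: sqr_ge0.
  - by move=> ?; exact: sqr_ge0.
  - by move=> ? Sy _; rewrite zt_mu.
have l2 : 0 <= lambda ^- 2 by rewrite invr_ge0 sqr_ge0.
apply: (@le_trans _ _ (((2 * lambda)^-1 * G + c * (Q1 + Q2))%:E)).
  rewrite EFinD !EFinM /dHcirc2 EFinD; apply: leeD; apply: lee_wpmul2l => //.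
  - by rewrite lee_fin invr_ge0 mulr_ge0// ltW.
  - exact: leeD.
rewrite lee_fin.
have -> : (2 * lambda)^-1 * G = lambda ^- 2 * (lambda / 2 * G).
  by field; rewrite gt_eqF.
clearbody I1 I2 I3 G Q1 Q2; move: excess_mu excess_nu.
move: (mu_part _ _ z) (mu_part _ _ zt) (nu_part _ _ zs) (nu_part _ _ g) => a a' b b' ha
  hb.
set D := _ - _; have D1 : lambda / 2 * G + c * (Q1 + Q2) <= D by rewrite /D; lra.
clearbody D.
have cQ : 0 <= c * (Q1 + Q2) by rewrite mulr_ge0// addr_ge0.
have lG : 0 <= lambda / 2 * G by rewrite mulr_ge0// divr_ge0// ltW.
have : lambda ^- 2 * (lambda / 2 * G) <= lambda ^- 2 * D.
  by rewrite ler_wpM2l//; lra.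
by rewrite mulrDl mul1r; lra.
Qed.

End optimality.

(** * Concentration of empirical means *)

Section expR_bounds.
Context {R : realType}.
Implicit Types x : R.

Lemma expR_le_quadratic x : x <= 2^-1 -> expR x <= 1 + x + 2 * x ^+ 2.
Proof.
move=> x2; have x1 : 0 < 1 - x by lra.
have : expR x <= (1 - x)^-1.
  rewrite -[expR x]invrK -expRN lef_pV2 ?posrE ?expR_gt0//.
  exact: expR_ge1Dx.
move=> /le_trans; apply; rewrite -[leLHS]mul1r ler_pdivrMr//.
have : 0 <= x ^+ 2 * (1 - 2 * x) by rewrite mulr_ge0 ?sqr_ge0//; lra.
have -> : (1 + x + 2 * x ^+ 2) * (1 - x) = 1 + x ^+ 2 * (1 - 2 * x) by ring.
lra.
Qed.

(** For a centered variable bounded by [b] this gives the sub-Gaussian bound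
    [E exp(x) <= exp(2 b^2)] in one step. *)
Lemma expR_le_id_expR_sqr x : expR x <= x + expR (2 * x ^+ 2).
Proof.
have e := expR_ge1Dx (2 * x ^+ 2).
have [x2|x2] := leP x (2^-1); first by have := expR_le_quadratic x2; lra.
have : expR x <= expR (2 * x ^+ 2).
  rewrite ler_expR expr2 mulrA -{1}(mul1r x) ler_wpM2r//; lra.
lra.
Qed.

End expR_bounds.

Section weighted_integral.
Context {R : realType} {dO : measure_display} {Omega : measurableType dO}
  {dT : measure_display} {T : measurableType dT}.
Variables (P : {measure set Omega -> \bar R}) (mu : {measure set T -> \bar R}).
Variables (D : set Omega) (W : Omega -> R) (Y : Omega -> T) (C : R).
Hypotheses (mD : measurable D) (mW : measurable_fun setT W) (W0 : forall w, 0 <= W w)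
  (mY : measurable_fun setT Y).
Hypothesis WY : forall B, measurable B ->
  (\int[P]_(w in D `&` Y @^-1` B) (W w)%:E = C%:E * mu B)%E.
Import HBNNSimple.

(** Extension of the hypothesis from indicator functions to nonnegative
    measurable functions, by simple approximation. *)
Lemma weighted_integral (f : T -> R) : measurable_fun setT f -> (forall t, 0 <= f t) ->
  (\int[P]_(w in D) (W w * f (Y w))%:E = C%:E * \int[mu]_t (f t)%:E)%E.
Proof.
move=> mf f0; have mEf : measurable_fun setT (EFin \o f) by exact/measurable_EFinP.
have Ef0 t : setT t -> (0 <= (EFin \o f) t)%E by move=> _; rewrite lee_fin.
pose g := nnsfun_approx measurableT mEf.
have gcvg (t : T) : (g k t)%:E @[k --> \oo] --> (f t)%:E.
  by have := cvg_nnsfun_approx measurableT mEf Ef0 (I : setT t).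
have gnd t m n : (m <= n)%N -> g m t <= g n t.
  by move=> mn; have /lefP := nd_nnsfun_approx measurableT mEf mn; exact.
have mgY k : measurable_fun setT (fun w => W w * g k (Y w)).
  by apply: measurable_funM => //; exact: measurableT_comp.
have gE k : (\int[P]_(w in D) (W w * g k (Y w))%:E = C%:E * \int[mu]_t (g k t)%:E)%E.
  have mpre r : measurable (Y @^-1` (g k @^-1` [set r])).
    by rewrite -[X in measurable X]setTI; apply: mY.
  rewrite integralT_nnsfun sintegralE.
  transitivity (\int[P]_(w in D) (\sum_(r \in range (g k))
      (r * (W w * \1_(Y @^-1` (g k @^-1` [set r])) w))%:E))%E.
    apply: eq_integral => w _; rewrite fimfunE fsumEFin//; congr (_%:E).
    rewrite mulr_fsumr//; apply: eq_fsbigr => r _.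
    by rewrite mulrCA.
  rewrite ge0_integral_fsum//; last 2 first.
  - move=> r; apply/measurable_EFinP/measurable_funTS.
    by apply: measurable_funM => //; apply: measurable_funM => //;
      exact: measurable_indic.
  - move=> r w _; rewrite mulrCA EFinM mule_ge0 ?lee_fin//.
    exact: (nnfun_muleindic_ge0 (g k) r (Y w)).
  rewrite ge0_mule_fsumr; last first.
    move=> r; have [->|r0] := eqVneq (g k @^-1` [set r]) set0.
      by rewrite measure0 mule0.
    by have /set0P[t /= <-] := r0; rewrite mule_ge0 ?lee_fin.
  apply: eq_fsbigr => r; rewrite inE => -[t _ <-].
  have r0 : 0 <= g k t by [].
  under eq_integral do rewrite EFinM.
  rewrite ge0_integralZl//; last 2 first.
  - apply/measurable_EFinP/measurable_funTS.
    by apply: measurable_funM => //; exact: measurable_indic.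
  - by move=> w _; rewrite lee_fin mulr_ge0.
  rewrite muleCA -WY//; congr (_ * _)%E.
  rewrite integral_mkcondr; apply: eq_integral => w _.
  by rewrite patchE indicE; case: ifP; rewrite ?mulr1 ?mulr0.
transitivity (limn (fun k => \int[P]_(w in D) (W w * g k (Y w))%:E)%E).
  rewrite -monotone_convergence//.
  - apply: eq_integral => w _; apply/esym/cvg_lim => //.
    rewrite EFinM; under eq_fun do rewrite EFinM.
    by apply: cvgeZl => //; exact: gcvg.
  - by move=> k; apply/measurable_EFinP/measurable_funTS.
  - by move=> k w _; rewrite lee_fin mulr_ge0.
  - by move=> w _ m n mn; rewrite lee_fin ler_wpM2l// gnd.
under eq_fun do rewrite gE.
rewrite limeMl//.
  rewrite -monotone_convergence//.
  - by congr (_ * _)%E; apply: eq_integral => t _; apply/cvg_lim.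
  - by move=> k; apply/measurable_EFinP.
  - by move=> k t _; rewrite lee_fin.
  - by move=> t _ m n mn; rewrite lee_fin gnd.
apply/ereal_nondecreasing_is_cvgn => a b ab; apply: ge0_le_integral => //.
- by move=> t _; rewrite lee_fin.
- exact/measurable_EFinP.
- exact/measurable_EFinP.
- by move=> t _; rewrite lee_fin gnd.
Qed.

End weighted_integral.

Section iid.
Context {R : realType} {dO : measure_display} {Omega : measurableType dO}
  {dT : measure_display} {T : measurableType dT}.
Variables (P : probability Omega R) (mu : probability T R) (n : nat)
  (x : nat -> {RV P >-> T}).
Hypothesis iid : independent_samples mu n x.
Let pr B : R := fine (mu B).

Let prE B : measurable B -> mu B = (pr B)%:E.
Proof. by move=> mB; rewrite /pr fineK// fin_num_measure. Qed.

Lemma joint_law (A : nat -> set T) : (forall i, measurable (A i)) ->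
  P [set w | forall i, (i < n)%N -> A i (x i w)] = (\prod_(0 <= i < n) pr (A i))%:E.
Proof.
move=> mA; have [ind law] := iid; rewrite ind//.
rewrite big_mkord -prodEFin; apply: eq_bigr => i _.
by rewrite -prE// -(law i (ltn_ord i) _ (mA i)).
Qed.

(** Independence for the first [m] variables tested on functions and the other
    ones on sets; functions replace sets one variable at a time. *)
Lemma integral_prod_iid_partial (f : T -> R) (c : R) (m : nat) (A : nat -> set T) :
  measurable_fun setT f -> (forall t, 0 <= f t) ->
  (\int[mu]_t (f t)%:E = c%:E)%E -> (m <= n)%N -> (forall i, measurable (A i)) ->
  (\int[P]_(w in [set w | forall i, (m <= i < n)%N -> A i (x i w)])
    (\prod_(i < m) f (x i w))%:E = (c ^+ m * \prod_(m <= i < n) pr (A i))%:E)%E.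
Proof.
move=> mf f0 fc.
have mset m' (A' : nat -> set T) : (forall i, measurable (A' i)) ->
    measurable [set w | forall i, (m' <= i < n)%N -> A' i (x i w)].
  move=> mA'; rewrite (_ : [set w | _] = \bigcap_(i in [set i | (m' <= i < n)%N])
      (x i @^-1` A' i)); last first.
    by apply/seteqP; split=> w h i hi; exact: h.
  apply: bigcap_measurableType => i _; rewrite -[X in measurable X]setTI.
  exact: measurable_funP.
elim: m A => [|m IH] A mn mA.
  rewrite expr0 mul1r -joint_law//; under eq_integral do rewrite big_ord0.
  by rewrite integral_cst ?mul1e//; exact: mset.
set D := [set w | _]; pose W w := \prod_(i < m) f (x i w).
pose C := c ^+ m * \prod_(m.+1 <= i < n) pr (A i).
have mxm i : measurable_fun setT (x i) by exact: measurable_funP.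
have mW : measurable_fun setT W.
  by apply: measurable_prod => i _; exact: measurableT_comp.
have W0 w : 0 <= W w by exact: prodr_ge0.
have WY B : measurable B ->
    (\int[P]_(w in D `&` x m @^-1` B) (W w)%:E = C%:E * mu B)%E.
  move=> mB; pose A' i := if i == m then B else A i.
  have mA' i : measurable (A' i) by rewrite /A'; case: ifP.
  have := IH A' (ltnW mn) mA'.
  have A'm : A' m = B by rewrite /A' eqxx.
  rewrite big_ltn// A'm => IHm.
  rewrite (_ : D `&` _ = [set w | forall i, (m <= i < n)%N -> A' i (x i w)]).
    rewrite IHm prE// -EFinM /C; congr (_%:E).
    rewrite -mulrA [pr B * _]mulrC; congr (_ * (_ * _)).
    by rewrite !big_nat; apply: eq_bigr => i /andP[mi _]; rewrite /A' gtn_eqF.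
  apply/seteqP; split=> [w [Dw xB] i /andP[mi ni]|w h]; rewrite /A'.
    case: eqP => [->//|/eqP im]; apply: Dw; rewrite ni andbT ltn_neqAle mi andbT.
    by rewrite eq_sym.
  split=> [i /andP[mi ni]|].
    by have := h i; rewrite /A' gtn_eqF// (ltnW mi) ni; exact.
  by have := h m; rewrite /A' eqxx leqnn mn; exact.
under eq_integral do rewrite big_ord_recr.
rewrite (weighted_integral (mset _ _ mA) mW W0 (mxm m) WY mf f0) fc -EFinM.
by rewrite /C exprSr mulrAC.
Qed.

Lemma bounded_measurable_sample (f : T -> R) i : bounded_measurable setT f ->
  bounded_measurable setT (fun w => f (x i w)).
Proof.
move=> [mf [B fB]]; split; first exact: measurableT_comp.
by exists B => w _; exact: fB.
Qed.

Lemma bounded_measurable_expR d' (T' : measurableType d') (f : T' -> R) :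
  bounded_measurable setT f -> bounded_measurable setT (fun t => expR (f t)).
Proof.
move=> [mf [B fB]]; split; first exact: measurableT_comp.
exists (expR B) => t _; rewrite ger0_norm ?expR_ge0// ler_expR.
exact: le_trans (ler_norm _) (fB t I).
Qed.

Definition sample_mean (f : T -> R) (w : Omega) : R :=
  n%:R^-1 * \sum_(i < n) f (x i w).

Lemma bounded_measurable_sample_mean (f : T -> R) : bounded_measurable setT f ->
  bounded_measurable setT (sample_mean f).
Proof.
move=> bf; apply: bounded_measurableM; first exact: bounded_measurable_cst.
by apply: bounded_measurable_sum => i; exact: bounded_measurable_sample.
Qed.

Lemma expR_sample_mean_le (f : T -> R) (b s : R) : (0 < n)%N ->
  measurable_fun setT f -> (forall t, `|f t| <= b) -> \int[mu]_t f t = 0 ->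
  \int[P]_w expR (s * sample_mean f w) <= expR (2 * s ^+ 2 * b ^+ 2 / n%:R).
Proof.
move=> n0 mf fb f0; have n1 : 0 < n%:R :> R by rewrite ltr0n.
have bf : bounded_measurable setT f by split=> //; exists b => t _.
pose e t := expR (s / n%:R * f t).
have be : bounded_measurable setT e.
  by apply: bounded_measurable_expR; apply: bounded_measurableM => //;
    exact: bounded_measurable_cst.
pose c := \int[mu]_t e t.
have ec : (\int[mu]_t (e t)%:E = c%:E)%E.
  by rewrite EFin_Rintegral//; exact: bounded_measurable_integrable.
have c0 : 0 <= c by apply: Rintegral_ge0 => t _; exact: expR_ge0.
have := @integral_prod_iid_partial e c n (fun=> setT) be.1 (fun t => expR_ge0 _) ec
  (leqnn n) (fun=> measurableT).
rewrite big_geq// mulr1 (_ : [set w | _] = setT); last by apply/seteqP; split.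
move=> eE.
have -> : \int[P]_w expR (s * sample_mean f w) = c ^+ n.
  apply: EFin_inj; rewrite -eE fineK; last first.
    apply: integrable_fin_num => //; apply: bounded_measurable_integrable => //.
    apply: bounded_measurable_expR; apply: bounded_measurableM;
      first exact: bounded_measurable_cst.
    exact: bounded_measurable_sample_mean.
  apply: eq_integral => w _; congr (_%:E).
  by rewrite -expR_sum /sample_mean mulrA mulr_sumr.
have -> : 2 * s ^+ 2 * b ^+ 2 / n%:R = (2 * (s / n%:R * b) ^+ 2) * n%:R :> R.
  by field; rewrite gt_eqF.
rewrite expRM_natr lerXn2r ?nnegrE ?expR_ge0//.
set a := s / n%:R; set k := expR _.
have : c <= \int[mu]_t (a * f t + k).
  apply: le_Rintegral => //; rewrite -?/(e _).
  - exact: bounded_measurable_integrable.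
  - apply: bounded_measurable_integrable => //; apply: bounded_measurableD.
      by apply: bounded_measurableM => //; exact: bounded_measurable_cst.
    exact: bounded_measurable_cst.
  move=> t _; apply: le_trans (expR_le_id_expR_sqr _) _; rewrite lerD2l ler_expR.
  rewrite ler_pM2l//.
  have fb2 : f t ^+ 2 <= b ^+ 2.
    by rewrite -(real_normK (num_real (f t))) lerXn2r ?nnegrE// (le_trans _ (fb t)).
  by have := ler_wpM2l (sqr_ge0 a) fb2; rewrite -!exprMn.
rewrite RintegralD//; last 2 first.
- apply: bounded_measurable_integrable => //; apply: bounded_measurableM => //.
  exact: bounded_measurable_cst.
- by apply: bounded_measurable_integrable => //; exact: bounded_measurable_cst.
rewrite RintegralZl//; last exact: bounded_measurable_integrable.
rewrite f0 mulr0 add0r Rintegral_cst//.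
by rewrite [X in _ * fine X](_ : _ = 1%E) ?mulr1//; exact: probability_setT.
Qed.

(** The bound [max u <= log (sum (exp u))] is replaced by its linearization
    [s u <= c - 1 + exp (s u - c)], whose right-hand side is integrated
    term by term; this gives a measurable upper bound of all the means without
    forming their maximum. The term [e] is needed when [N = 1], where the optimal
    [s] is [0]. *)
Lemma empirical_maximal_bound (N : nat) (f : 'I_N -> T -> R) (b e : R) :
  (0 < n)%N -> (0 < N)%N -> 0 < b -> 0 < e ->
  (forall j, measurable_fun setT (f j)) -> (forall j t, `|f j t| <= b) ->
  (forall j, \int[mu]_t f j t = 0) ->
  exists g : Omega -> R, [/\ bounded_measurable setT g,
    forall j w, sample_mean (f j) w <= g w &
    \int[P]_w g w <= 3 * b * Num.sqrt (ln N%:R / n%:R) + e].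
Proof.
move=> n0 N0 b0 e0 mf fb f0; pose h : R := ln N%:R.
have n1 : 0 < n%:R :> R by rewrite ltr0n.
have h0 : 0 <= h by rewrite ln_ge0// ler1n.
have [s s0 sP] : exists2 s, 0 < s &
    2 * s * b ^+ 2 / n%:R + h / s <= 3 * b * Num.sqrt (h / n%:R) + e.
  have [hE|hN] := eqVneq h 0.
    exists (e * n%:R / (2 * b ^+ 2));
      first by rewrite !mulr_gt0 ?invr_gt0 ?mulr_gt0 ?exprn_gt0.
    rewrite hE !mul0r sqrtr0 mulr0 addr0 add0r le_eqVlt; apply/orP; left; apply/eqP.
    by field; rewrite !gt_eqF.
  have {}h0 : 0 < h by rewrite lt0r hN.
  pose r := Num.sqrt (h / n%:R).
  have r0 : 0 < r by rewrite sqrtr_gt0 divr_gt0.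
  have r2 : h = n%:R * r ^+ 2.
    by rewrite sqr_sqrtr ?divr_ge0 ?ltW// mulrC divfK// gt_eqF.
  exists (n%:R * r / b); first by rewrite !mulr_gt0// invr_gt0.
  have -> : 2 * (n%:R * r / b) * b ^+ 2 / n%:R + h / (n%:R * r / b) = 3 * b * r.
    by rewrite r2; field; rewrite !gt_eqF.
  by rewrite -/r lerDl ltW.
pose c := 2 * s ^+ 2 * b ^+ 2 / n%:R + h.
have bf j : bounded_measurable setT (f j) by split=> //; exists b => t _; exact: fb.
have bs j : bounded_measurable setT (sample_mean (f j)).
  exact: bounded_measurable_sample_mean.
pose E j w := expR (s * sample_mean (f j) w).
have bE j : bounded_measurable setT (E j).
  by apply: bounded_measurable_expR; apply: bounded_measurableM => //;
    exact: bounded_measurable_cst.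
have bsum := @bounded_measurable_sum _ _ _ setT _ (index_enum 'I_N) E bE.
pose g w := (c - 1) / s + expR (- c) / s * \sum_j E j w.
have bg2 : bounded_measurable setT (fun w => expR (- c) / s * \sum_j E j w).
  by apply: bounded_measurableM => //; exact: bounded_measurable_cst.
exists g; split.
- by apply: bounded_measurableD => //; exact: bounded_measurable_cst.
- move=> j w; rewrite -(ler_pM2l s0).
  have -> : s * g w = c - 1 + expR (- c) * \sum_j E j w.
    by rewrite /g; field; rewrite gt_eqF.
  have : expR (s * sample_mean (f j) w - c) <= expR (- c) * \sum_j E j w.
    rewrite expRD mulrC ler_pM2l ?expR_gt0// (bigD1 j)//= lerDl.
    by apply: sumr_ge0 => i _; exact: expR_ge0.
  have := expR_ge1Dx (s * sample_mean (f j) w - c); lra.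
rewrite RintegralD//; last 2 first.
- by apply: bounded_measurable_integrable => //; exact: bounded_measurable_cst.
- exact: bounded_measurable_integrable.
rewrite RintegralZl//; last exact: bounded_measurable_integrable.
rewrite Rintegral_cst// [X in _ * fine X](_ : _ = 1%E) ?mulr1//;
  last exact: probability_setT.
rewrite Rintegral_sum//.
have sumE : \sum_j \int[P]_w E j w <= N%:R * expR (c - h).
  rewrite -[X in X%:R * _]card_ord -sumr_const mulr_suml ler_sum// => j _.
  rewrite mul1r /c addrK; exact: expR_sample_mean_le.
have eh : expR h = N%:R by rewrite lnK// posrE ltr0n.
have : expR (- c) / s * (\sum_j \int[P]_w E j w) <= s^-1.
  have sE : expR (- c) / s * (N%:R * expR (c - h)) = s^-1.
    rewrite -eh mulrAC -!expRD (_ : - c + (h + (c - h)) = 0) ?expR0 ?mul1r//.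
    by ring.
  by rewrite -[leRHS]sE ler_wpM2l// divr_ge0 ?expR_ge0// ltW.
move=> h1; apply: le_trans sP; apply: (@le_trans _ _ ((c - 1) / s + s^-1)).
  by rewrite lerD2l.
rewrite le_eqVlt; apply/orP; left; apply/eqP; rewrite /c.
by field; rewrite !gt_eqF.
Qed.

End iid.

(** * Chaining *)

Section chaining.
Context {R : realType} {dO : measure_display} {Omega : measurableType dO}
  {dT : measure_display} {T : measurableType dT}.
Variables (P : probability Omega R) (mu : probability T R) (n : nat)
  (x : nat -> {RV P >-> T}).
Hypotheses (n0 : (0 < n)%N) (iid : independent_samples mu n x).
Context {Z : Type}.
Variables (C : set Z) (F : Z -> T -> R).
Hypothesis bF : forall z, C z -> bounded_measurable setT (F z).

Definition deviation (z : Z) (w : Omega) : R :=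
  \int[mu]_t F z t - sample_mean n x (F z) w.

Lemma deviation_sub_le (z z' : Z) (r : R) w : C z -> C z' ->
  (forall t, `|F z t - F z' t| <= r) ->
  deviation z w - deviation z' w <= 2 * r.
Proof.
move=> Cz Cz' zz'.
have i1 : \int[mu]_t F z t - \int[mu]_t F z' t <= r.
  rewrite -RintegralB//; try by apply: bounded_measurable_integrable => //; exact: bF.
  have -> : r = \int[mu]_(t in setT) (fun=> r) t.
    by rewrite Rintegral_cst// [X in _ * fine X](_ : _ = 1%E) ?mulr1//;
      exact: probability_setT.
  apply: le_Rintegral => //.
  - by apply: bounded_measurable_integrable => //; apply: bounded_measurableB; exact: bF.
  - by apply: bounded_measurable_integrable => //; exact: bounded_measurable_cst.
  by move=> t _; exact: le_trans (ler_norm _) (zz' t).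
have i2 : sample_mean n x (F z') w - sample_mean n x (F z) w <= r.
  rewrite /sample_mean -mulrBr ler_pdivrMl ?ltr0n// -sumrB.
  have -> : n%:R * r = \sum_(i < n) r by rewrite sumr_const card_ord mulr_natl.
  apply: ler_sum => i _; rewrite (le_trans (ler_norm _))// distrC; exact: zz'.
by rewrite /deviation; lra.
Qed.

(** One link of the chain: the difference of the deviations of [z] and [z'] is
    the sample mean of a centered function bounded by [2 r]. *)
Lemma chaining_link (N : nat) (z z' : 'I_N -> Z) (r e : R) :
  (0 < N)%N -> 0 < r -> 0 < e -> (forall j, C (z j)) -> (forall j, C (z' j)) ->
  (forall j t, `|F (z j) t - F (z' j) t| <= r) ->
  exists g : Omega -> R, [/\ bounded_measurable setT g,
    forall j w, deviation (z j) w - deviation (z' j) w <= g w &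
    \int[P]_w g w <= 6 * r * Num.sqrt (ln N%:R / n%:R) + e].
Proof.
move=> N0 r0 e0 Cz Cz' zz'.
have iF z1 : C z1 -> mu.-integrable setT (EFin \o F z1).
  by move=> Cz1; apply: bounded_measurable_integrable => //; exact: bF.
pose c j := \int[mu]_t F (z j) t - \int[mu]_t F (z' j) t.
pose f j t := c j - (F (z j) t - F (z' j) t).
have bD j : bounded_measurable setT (fun t => F (z j) t - F (z' j) t).
  by apply: bounded_measurableB; exact: bF.
have cE j : c j = \int[mu]_t (F (z j) t - F (z' j) t).
  by rewrite RintegralB//; exact: iF.
have one : fine (mu setT) = 1 by rewrite [X in fine X](_ : _ = 1%E)//;
  exact: probability_setT.
have cr j : `|c j| <= r.
  rewrite cE (le_trans (le_normr_Rintegral _ (bounded_measurable_integrable _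
    measurableT (bD j))))//.
  have -> : r = \int[mu]_(t in setT) (fun=> r) t by rewrite Rintegral_cst// one mulr1.
  apply: le_Rintegral => //.
    apply: bounded_measurable_integrable => //; split;
      first by apply: measurableT_comp => //; have [] := bD j.
    by exists r => t _; rewrite normr_id.
  by apply: bounded_measurable_integrable => //; exact: bounded_measurable_cst.
have [||||g [bg gz gi]] := @empirical_maximal_bound _ _ _ _ _ P mu n x iid N f (2 * r)
  e n0 N0 _ e0.
- by rewrite mulr_gt0.
- by move=> j; have [] := bounded_measurableB (bounded_measurable_cst setT (c j)) (bD j).
- by move=> j t; rewrite (le_trans (ler_normB _ _))// mulrDl mul1r lerD.
- move=> j; rewrite /f RintegralB//; last 2 first.
  + by apply: bounded_measurable_integrable => //; exact: bounded_measurable_cst.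
  + exact: bounded_measurable_integrable.
  by rewrite Rintegral_cst// one mulr1 -cE subrr.
exists g; split=> // [j w|]; last by rewrite mulrA -natrM in gi.
apply: le_trans (gz j w); rewrite le_eqVlt; apply/orP; left; apply/eqP.
have sE : \sum_(i < n) f j (x i w) =
    n%:R * c j - (\sum_(i < n) F (z j) (x i w) - \sum_(i < n) F (z' j) (x i w)).
  by rewrite /f sumrB sumr_const card_ord sumrB mulr_natl.
rewrite /deviation /sample_mean sE /c; field.
by rewrite pnatr_eq0 -lt0n.
Qed.

Variables (N : nat -> nat) (net : forall k, 'I_(N k) -> Z) (rho : nat -> R) (zt : Z).
Hypotheses (N0 : forall k, (0 < N k)%N) (net0 : forall i, @net 0%N i = zt)
  (Cnet : forall k i, C (@net k i)) (rho0 : forall k, 0 < rho k)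
  (netP : forall k z, C z -> exists i, forall t, `|F z t - F (@net k i) t| <= rho k).

(** Each point of the net at level [k + 1] is linked to one at level [k], so
    that level [k + 1] contributes a maximum over [N (k + 1)] links only. *)
Lemma chaining_net (K : nat) (e : R) : 0 < e ->
  exists g : Omega -> R, [/\ bounded_measurable setT g,
    forall i w, deviation (@net K i) w - deviation zt w <= g w &
    \int[P]_w g w <=
      \sum_(k < K) (6 * rho k * Num.sqrt (ln (N k.+1)%:R / n%:R) + e)].
Proof.
move=> e0; elim: K => [|K [g [bg gK gi]]].
  exists (fun=> 0); split; first exact: bounded_measurable_cst.
    by move=> i w; rewrite net0 subrr.
  by rewrite big_ord0 Rintegral_cst// mul0r.
have /choice[parent parentP] (i : 'I_(N K.+1)) : exists j,
    forall t, `|F (@net K.+1 i) t - F (@net K j) t| <= rho K by exact: netP.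
have [h [bh hK hi]] := chaining_link (N0 K.+1) (rho0 K) e0 (Cnet (k := K.+1))
  (fun i => Cnet (parent i)) parentP.
exists (fun w => g w + h w); split; first exact: bounded_measurableD.
  by move=> i w; have := hK i w; have := gK (parent i) w; lra.
rewrite big_ord_recr/= RintegralD//; try exact: bounded_measurable_integrable.
exact: lerD.
Qed.

Lemma chaining (K : nat) (e : R) : 0 < e ->
  exists g : Omega -> R, [/\ bounded_measurable setT g,
    forall z w, C z -> deviation z w - deviation zt w <= g w &
    \int[P]_w g w <= 2 * rho K +
      \sum_(k < K) (6 * rho k * Num.sqrt (ln (N k.+1)%:R / n%:R) + e)].
Proof.
move=> e0; have [g [bg gK gi]] := chaining_net K e0.
exists (fun w => 2 * rho K + g w); split.
- by apply: bounded_measurableD => //; exact: bounded_measurable_cst.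
- move=> z w Cz; have [i iP] := netP K Cz.
  by have := deviation_sub_le w Cz (Cnet i) iP; have := gK i w; lra.
rewrite RintegralD//; last exact: bounded_measurable_integrable.
  rewrite Rintegral_cst// [X in _ * fine X](_ : _ = 1%E); last exact: probability_setT.
  by rewrite mulr1 lerD2l.
by apply: bounded_measurable_integrable => //; exact: bounded_measurable_cst.
Qed.

End chaining.

(** * Metric entropy *)

Section entropy.
Context {R : realType} {T : Type}.
Variables (C : set (T -> R)) (B : set T).
Hypothesis C0 : C !=set0.
Local Notation cov := (covering_number C (sup_norm B)).
Local Notation sqrtH u := (sqrte (metric_entropy C (sup_norm B) u)).

Let covers u (k : nat) := exists c : 'I_k -> T -> R,
  forall z, C z -> exists i, (sup_norm B (fun x => (z x - c i x)%R) <= u%:E)%E.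

Let covers_gt0 u k : covers u k -> (0 < k)%N.
Proof.
move=> [c cP]; have [z Cz] := C0; have [i _] := cP z Cz.
exact: leq_ltn_trans (leq0n _) (ltn_ord i).
Qed.

Lemma covering_number_nonincreasing u v : u <= v -> (cov v <= cov u)%E.
Proof.
move=> uv; apply: le_ereal_inf_tmp => _ [k [c cP] <-].
apply: ereal_inf_lbound; exists k => //; exists c => z Cz.
by have [i iP] := cP z Cz; exists i; rewrite (le_trans iP)// lee_fin.
Qed.

Lemma covering_number_ge1 u : (1 <= cov u)%E.
Proof.
apply: le_ereal_inf_tmp => _ [k /covers_gt0 k0 <-].
by rewrite lee_fin ler1n.
Qed.

Lemma sqrt_entropy_nonincreasing u v : u <= v -> (sqrtH v <= sqrtH u)%E.
Proof.
move=> uv; have cov0 w : (0 <= cov w)%E by exact: le_trans (covering_number_ge1 w).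
have inT w : cov w \in `[0%E, +oo%E] by rewrite in_itv/= cov0 leey.
rewrite lee_sqrt; first by rewrite lee_lne// covering_number_nonincreasing.
by rewrite -lne1 lee_lne// ?covering_number_ge1// in_itv/= lee01 leey.
Qed.

(** The centers of a covering need not belong to [C]; replacing each of them by
    a point of [C] in its ball costs a factor [2] in the radius. *)
Lemma covering_net u : cov u = +oo%E \/
  exists N : nat, [/\ (0 < N)%N, sqrtH u = (Num.sqrt (ln N%:R))%:E &
    exists c : 'I_N -> T -> R, (forall i, C (c i)) /\
      forall z, C z -> exists i, forall t, B t -> `|z t - c i t| <= 2 * u].
Proof.
have [[k0 hk0]|/forallNP h] := pselect (exists k, covers u k); last first.
  left; rewrite /covering_number (_ : [set _ | _ in _] = set0) ?ereal_inf0//.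
  by apply/seteqP; split=> [t [k hk _]|//]; exact: h hk.
right; have exk : exists k, `[< covers u k >] by exists k0; exact/asboolP.
pose N := ex_minn exk; have [NP Nmin] : covers u N /\ forall k, covers u k -> (N <= k)%N.
  by rewrite /N; case: ex_minnP => m /asboolP cm mmin; split=> // k ck; apply: mmin;
    exact/asboolP.
have N0 := covers_gt0 NP.
have covE : cov u = N%:R%:E.
  apply/eqP; rewrite eq_le ereal_inf_lbound/=; last by exists N.
  apply: le_ereal_inf_tmp => _ [k hk <-].
  by rewrite lee_fin ler_nat; exact: Nmin.
exists N; split=> //; first by rewrite /metric_entropy covE lne_EFin ?ltr0n.
have [c cP] := NP; have [zt Czt] := C0.
have near_le z z' t : (sup_norm B (fun x => (z x - z' x)%R) <= u%:E)%E -> B t ->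
    `|z t - z' t| <= u.
  move=> h Bt; rewrite -lee_fin; apply: le_trans h.
  by apply: ereal_sup_ubound; exists t.
have /choice[c' c'P] (i : 'I_N) : exists z', C z' /\
    ((exists2 z, C z & (sup_norm B (fun x => (z x - c i x)%R) <= u%:E)%E) ->
     (sup_norm B (fun x => (z' x - c i x)%R) <= u%:E)%E).
  have [[z Cz hz]|h] := pselect (exists2 z, C z &
      (sup_norm B (fun x => (z x - c i x)%R) <= u%:E)%E).
    by exists z.
  by exists zt; split.
exists c'; split=> [i|z Cz]; first by have [] := c'P i.
have [i iP] := cP z Cz; exists i => t Bt.
have [_ /(_ (ex_intro2 _ _ z Cz iP)) i'P] := c'P i.
have := near_le _ _ _ iP Bt; have := near_le _ _ _ i'P Bt.
rewrite !ler_norml => /andP[? ?] /andP[? ?]; apply/andP; split; lra.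
Qed.

End entropy.

Section nonincreasing_integral.
Context {R : realType}.
Variable f : R -> \bar R.
Hypotheses (f0 : forall u, (0 <= f u)%E)
  (f_ni : forall u v, u <= v -> (f v <= f u)%E).
Local Notation leb := (@lebesgue_measure R).

Lemma nonincreasing_emeasurable : measurable_fun setT f.
Proof.
apply: (measurability _ (ErealGenOInfty.measurableE R)) => _ [_ [a ->] <-].
rewrite setTI; apply: is_interval_measurable => u v /= fu fv w /andP[uw wv].
by move: fv; rewrite /= !in_itv/= !andbT => /lt_le_trans; apply; exact: f_ni.
Qed.

(** On the interval between [s k.+1] and [s k] the function is at least
    [f (s k)]. Real lower bounds [c k] replace these values because they may be
    infinite; letting [c k] grow then shows that the integral is infinite. *)
Lemma nonincreasing_integral_ge (s : nat -> R) (c : nat -> R) (a b : R) (K : nat) :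
  (forall k, (k < K)%N -> s k.+1 <= s k) -> s 0%N <= b -> a <= s K ->
  (forall k, (k < K)%N -> 0 <= c k) ->
  (forall k, (k < K)%N -> ((c k)%:E <= f (s k))%E) ->
  ((\sum_(k < K) (s k - s k.+1) * c k)%:E <= \int[leb]_(u in `[a, b]) f u)%E.
Proof.
move=> sd sb sa c0 cf.
have mf D : measurable_fun D f by exact: measurable_funTS nonincreasing_emeasurable.
apply: (@le_trans _ _ (\int[leb]_(u in `[s K, s 0%N[) f u)%E); last first.
  apply: ge0_subset_integral => //; first exact: mf.
  move=> u /=; rewrite !in_itv/= => /andP[su us].
  by rewrite (le_trans sa su) (le_trans (ltW us)).
elim: K sd {sa} c0 cf => [|K IH] sd c0 cf.
  by rewrite big_ord0 integral_ge0.
have sKK := sd K (ltnSn K).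
have s0K : s K <= s 0%N.
  elim: K sd {IH c0 cf sKK} => // K IH sd.
  by apply: le_trans (sd K _) (IH _) => // k kK; apply: sd; exact: ltnW.
rewrite big_ord_recr/= EFinD (@itv_bndbnd_setU _ _ _ (BLeft (s K)))// ?bnd_simp//.
rewrite ge0_integral_setU//; last 2 first.
- exact: mf.
- by apply: lt_disjoint => u v; rewrite !in_itv/= => /andP[_ uK] /andP[Kv _];
    exact: lt_le_trans Kv.
rewrite addeC leeD//; last first.
  by apply: IH => k kK; [apply: sd|apply: c0|apply: cf]; exact: ltnW.
apply: (@le_trans _ _ (\int[leb]_(u in `[s K.+1, s K[) (c K)%:E)%E).
  rewrite integral_cst//= lebesgue_measure_itv/= lte_fin.
  case: ltP => [_|]; first by rewrite -EFinD -EFinM mulrC.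
  move=> h; have -> : s K.+1 = s K by apply/eqP; rewrite eq_le sKK h.
  by rewrite subrr mul0r mule0.
apply: ge0_le_integral => //.
- by move=> u _; rewrite lee_fin c0.
- exact: mf.
move=> u /=; rewrite in_itv/= => /andP[_ /ltW uK].
exact: le_trans (cf K (ltnSn K)) (f_ni uK).
Qed.

End nonincreasing_integral.

(** * The empirical potential *)

Section empirical_measure.
Context {R : realType} {disp : measure_display} {T : measurableType disp}.

Lemma ge0_integral_empirical (n : nat) (a : nat -> T) (f : T -> R) :
  measurable_fun setT f -> (forall t, 0 <= f t) ->
  (\int[@empirical R _ T n a]_t (f t)%:E = (n%:R^-1 * \sum_(i < n) f (a i))%:E)%E.
Proof.
move=> mf f0; have mEf : measurable_fun setT (EFin \o f) by exact/measurable_EFinP.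
have Ef0 t : setT t -> (0 <= (EFin \o f) t)%E by move=> _; rewrite lee_fin.
rewrite /empirical ge0_integral_mscale// ge0_integral_measure_sum//.
rewrite EFinM /= -sumEFin; congr (_ * _)%E; apply: eq_bigr => i _.
by rewrite integral_dirac// diracT mul1e.
Qed.

Lemma integral_empirical (n : nat) (a : nat -> T) (f : T -> R) :
  measurable_fun setT f ->
  (\int[@empirical R _ T n a]_t (f t)%:E = (n%:R^-1 * \sum_(i < n) f (a i))%:E)%E.
Proof.
move=> mf; rewrite integralE.
pose fp t := Num.max (f t) 0; pose fn t := Num.max (- f t) 0.
have mfp : measurable_fun setT fp by exact: measurable_maxr.
have mfn : measurable_fun setT fn by apply: measurable_maxr => //;
  exact: measurableT_comp.
have -> : (fun t => (f t)%:E)^\+%E = (fun t => (fp t)%:E).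
  by apply/funext => t; rewrite funeposE -EFin_max.
have -> : (fun t => (f t)%:E)^\-%E = (fun t => (fn t)%:E).
  by apply/funext => t; rewrite funenegE -EFin_max.
rewrite !ge0_integral_empirical//; try by move=> t; rewrite le_max lexx orbT.
rewrite -EFinB -mulrBr -sumrB; congr (_ * _)%:E; apply: eq_bigr => i _.
rewrite /fp /fn; have [f0|f0] := leP 0 (f (a i)).
  by rewrite max_r ?oppr_le0// subr0.
by rewrite max_l ?oppr_ge0 ?ltW// sub0r opprK.
Qed.

End empirical_measure.

Section outer_expectation.
Context {R : realType} {dO : measure_display} {Omega : measurableType dO}.
Variable P : probability Omega R.

(** Adding [+oo] on the negligible set where the bound fails makes [g] an
    admissible majorant without changing its integral. *)
Lemma expectation_outer_le (h : Omega -> \bar R) (g : Omega -> R) :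
  bounded_measurable setT g -> P.-negligible [set w | ~ (h w <= (g w)%:E)%E] ->
  (expectation_outer P h <= (\int[P]_w g w)%:E)%E.
Proof.
move=> bg [N [mN N0 hN]].
have gint : P.-integrable setT (EFin \o g) by exact: bounded_measurable_integrable.
have mg : measurable_fun setT (EFin \o g) by exact/measurable_EFinP/bg.1.
pose k w := ((g w)%:E + (cst +oo \_ N) w)%E.
have mk : measurable_fun setT k.
  by apply: emeasurable_funD => //; apply/(measurable_restrictT _ mN).
apply: ereal_inf_lbound; exists k.
  split=> // w; have [Nw|Nw] := pselect (N w).
    by rewrite /k patchE mem_set//= addey ?leey.
  rewrite /k patchE memNset//= adde0.
  by apply: contrapT => hw; apply: Nw; exact: hN.
rewrite -(EFin_Rintegral measurableT gint); apply: ae_eq_integral => //.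
exists N; split=> // w /= /not_implyP[_]; apply: contra_notP => Nw.
by rewrite /k patchE memNset// adde0.
Qed.

End outer_expectation.

Section empirical_potential.
Context {R : realType} {d : nat} (phi : R -> \bar R).
Hypotheses (ephi : entropy_function phi) (dphi : differentiable_conjugate phi).
Variables (M : R -> R) (lambda l rad : R).
Hypothesis lambda0 : 0 < lambda.
Variables (mu nu : probability 'rV[R]_d R).
Hypotheses (mu_rad : msupport mu `<=` eball rad) (nu_rad : msupport nu `<=` eball rad).
Local Notation E := 'rV[R]_d.
Local Notation class := (potential_class M lambda l).
Local Notation psi := (phistar phi).
Local Notation Smu := (msupport mu).
Local Notation Snu := (msupport nu).
Implicit Types (x y : E) (z : E -> R).

(** Lipschitz constant of [phi^*] on the range of the costs; the summand [1]
    makes it positive. *)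
Definition entropy_slope : R := derive1 psi (cost_bound M lambda l rad) + 1.

(** The ball of this radius contains both the support of [mu], where potentials
    are evaluated, and the maximizers in the conjugates at points of the support
    of [nu]. *)
Definition entropy_radius : R := conj_radius M lambda l rad + `|rad|.

(** The integrands of the semi-dual functional, cut off outside the supports to
    make them bounded. *)
Definition mu_integrand z : E -> R := (fun x => psi (z x - q x)) \_ Smu.
Definition nu_integrand z : E -> R := (fun y => psi (conjugate setT z y - q y)) \_ Snu.

Lemma entropy_slope_gt0 : 0 < entropy_slope.
Proof. by rewrite ltr_wpDl// (phistar_derive_ge0 ephi dphi). Qed.

Lemma bounded_measurable_cutoff (S : set E) (f : E -> R) B : measurable S ->
  measurable_fun setT f -> (forall x, S x -> `|f x| <= B) ->
  bounded_measurable setT ((fun x => psi (f x)) \_ S).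
Proof.
move=> mS mf fB; split.
  apply/(measurable_restrictT _ mS)/measurable_funTS.
  exact: (measurableT_comp (phistar_measurable dphi) mf).
exists `| `|psi 0| + derive1 psi B * B | => x _; rewrite patchE.
case: ifPn => [/[!inE] Sx|_]; last by rewrite normr0.
by rewrite (le_trans (phistar_bounded ephi dphi (fB x Sx)))// ler_norm.
Qed.

Lemma bounded_measurable_mu_integrand z : class z ->
  bounded_measurable setT (mu_integrand z).
Proof.
move=> cz; apply: (@bounded_measurable_cutoff _ _ (cost_bound M lambda l rad)).
- exact: measurable_supp.
- exact: (measurable_potential_cost lambda0 cz).
- by move=> x; exact: potential_cost_bounded.
Qed.

Lemma bounded_measurable_nu_integrand z : class z ->
  bounded_measurable setT (nu_integrand z).
Proof.
move=> cz; apply: (@bounded_measurable_cutoff _ _ (cost_bound M lambda l rad)).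
- exact: measurable_supp.
- exact: (measurable_conjugate_cost lambda0 cz).
- by move=> x; exact: conjugate_cost_bounded.
Qed.

Lemma cutoff_lipschitz (S : set E) (f g : E -> R) e x : 0 <= e ->
  (forall x, S x -> `|f x| <= cost_bound M lambda l rad) ->
  (forall x, S x -> `|g x| <= cost_bound M lambda l rad) ->
  (forall x, S x -> `|f x - g x| <= e) ->
  `|((fun x => psi (f x)) \_ S) x - ((fun x => psi (g x)) \_ S) x| <= entropy_slope * e.
Proof.
move=> e0 fB gB fg; rewrite !patchE; case: ifPn => [/[!inE] Sx|_]; last first.
  by rewrite subr0 normr0 mulr_ge0// ltW// entropy_slope_gt0.
apply: le_trans (phistar_lipschitz ephi dphi (ler_normlW (fB x Sx)) (ler_normlW (gB x
  Sx))) _.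
apply: ler_pM => //; first exact: (phistar_derive_ge0 ephi dphi).
  by rewrite /entropy_slope lerDl.
exact: fg.
Qed.

Lemma mu_integrand_lipschitz z z' e x : class z -> class z' -> 0 <= e ->
  (forall x, eball entropy_radius x -> `|z x - z' x| <= e) ->
  `|mu_integrand z x - mu_integrand z' x| <= entropy_slope * e.
Proof.
move=> cz cz' e0 zz'; apply: cutoff_lipschitz => // {}x Sx.
- exact: (potential_cost_bounded lambda0 mu_rad cz Sx).
- exact: (potential_cost_bounded lambda0 mu_rad cz' Sx).
rewrite opprB addrA subrK; apply: zz'; have := mu_rad Sx.
rewrite /eball/= => /le_trans; apply; rewrite (le_trans (ler_norm _))// lerDr.
by rewrite (le_trans ler01)// conj_radius_gt1.
Qed.

Lemma nu_integrand_lipschitz z z' e y : class z -> class z' -> 0 <= e ->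
  (forall x, eball entropy_radius x -> `|z x - z' x| <= e) ->
  `|nu_integrand z y - nu_integrand z' y| <= entropy_slope * e.
Proof.
move=> cz cz' e0 zz'; apply: cutoff_lipschitz => // {}y Sy.
- exact: (conjugate_cost_bounded lambda0 nu_rad cz Sy).
- exact: (conjugate_cost_bounded lambda0 nu_rad cz' Sy).
rewrite opprB addrA subrK.
apply: (conjugate_dist lambda0 cz cz' _ (nu_rad Sy)) => x xr; apply: zz'.
by apply: le_trans xr _; rewrite lerDl.
Qed.

Section samples.
Context {n : nat} {dO : measure_display} {Omega : measurableType dO}.
Variables (P : probability Omega R) (x y : nat -> {RV P >-> 'rV[R]_d}).

Lemma semidual_empirical z w : class z ->
  (forall i, (i < n)%N -> Smu (x i w)) -> (forall i, (i < n)%N -> Snu (y i w)) ->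
  semidual phi (empirical n (fun i => x i w)) (empirical n (fun i => y i w)) setT z =
  (sample_mean n x (mu_integrand z) w + sample_mean n y (nu_integrand z) w)%:E.
Proof.
move=> cz Sx Sy.
have mpsi (f : E -> R) : measurable_fun setT f -> measurable_fun setT (fun x => psi (f
  x)).
  by move=> mf; exact: (measurableT_comp (phistar_measurable dphi) mf).
have m1 := mpsi _ (measurable_potential_cost lambda0 cz).
have m2 := mpsi _ (measurable_conjugate_cost lambda0 cz).
rewrite /semidual (integral_empirical _ _ m1) (integral_empirical _ _ m2).
rewrite -EFinD /sample_mean; congr (_ * _ + _ * _)%:E; apply: eq_bigr => i _.
  by rewrite /mu_integrand patchE mem_set//; exact: Sx.
by rewrite /nu_integrand patchE mem_set//; exact: Sy.
Qed.

Lemma semidual_integrand z :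
  mu_part phi mu z + nu_part phi nu (conjugate setT z) =
  \int[mu]_x mu_integrand z x + \int[nu]_y nu_integrand z y.
Proof. by rewrite /mu_part /nu_part Rintegral_mkcond [X in _ + X = _]Rintegral_mkcond.
  Qed.

(** The excess is the empirical excess, nonpositive for a minimizer, plus the
    difference of the deviations. *)
Lemma excess_le_deviation z zt w : class z -> class zt ->
  (forall i, (i < n)%N -> Smu (x i w)) -> (forall i, (i < n)%N -> Snu (y i w)) ->
  (semidual phi (empirical n (fun i => x i w)) (empirical n (fun i => y i w)) setT z <=
   semidual phi (empirical n (fun i => x i w)) (empirical n (fun i => y i w)) setT
     zt)%E ->
  mu_part phi mu z + nu_part phi nu (conjugate setT z) -
    (mu_part phi mu zt + nu_part phi nu (conjugate setT zt)) <=
  (deviation mu n x mu_integrand z w - deviation mu n x mu_integrand zt w) +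
  (deviation nu n y nu_integrand z w - deviation nu n y nu_integrand zt w).
Proof.
move=> cz czt Sx Sy; rewrite !semidual_empirical// lee_fin !semidual_integrand.
have key (a b a' b' s t s' t' : R) : s + t <= s' + t' ->
    a + b - (a' + b') <= (a - s - (a' - s')) + (b - t - (b' - t')) by lra.
exact: key.
Qed.

Lemma samples_in_support : independent_samples mu n x -> independent_samples nu n y ->
  P.-negligible [set w | ~ ((forall i, (i < n)%N -> Smu (x i w)) /\
                            (forall i, (i < n)%N -> Snu (y i w)))].
Proof.
move=> [_ lx] [_ ly].
have h (m : probability E R) (s : nat -> {RV P >-> 'rV[R]_d}) i :
    (forall i, (i < n)%N -> forall A, measurable A -> distribution P (s i) A = m A) ->
    P.-negligible (if (i < n)%N then s i @^-1` (~` msupport m) else set0).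
  move=> lm; case: ifPn => [ni|_]; last exact: negligible_set0.
  have mS : measurable (~` msupport m) by apply: measurableC; exact: measurable_supp.
  apply/negligibleP; first by rewrite -[X in measurable X]setTI; exact: measurable_funP.
  by have := lm i ni _ mS; rewrite msupport_full.
apply: negligibleS (negligibleU (negligible_bigcup (fun i => h mu x i lx))
  (negligible_bigcup (fun i => h nu y i ly))) => w /= /not_andP[|] /existsNP[i
    /not_implyP[ni nS]].
  by left; exists i => //; rewrite ni.
by right; exists i => //; rewrite ni.
Qed.

End samples.

End empirical_potential.

(** * The rate of convergence *)

Section rate.
Context {R : realType}.

Lemma exists_pow2_le (a t : R) : 0 < t -> exists k : nat, a / 2 ^+ k <= t.
Proof.
move=> t0; exists (Num.truncn (a / t)).+1.
rewrite ler_pdivrMr ?exprn_gt0// mulrC -ler_pdivrMr// ltW//.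
apply: (lt_trans (truncnS_gt (a / t))).
by rewrite -natrX ltr_nat ltn_expl.
Qed.

(** Choice of the finest scale of the chain: the first one that is at most
    [eta + t], since its predecessor exceeds [eta]. The slack [t] is there because
    no scale is at most [eta] when [eta = 0]. *)
Lemma exists_scale (a eta t : R) : 0 < t -> 0 <= eta -> eta <= a ->
  exists K : nat, eta / 4 <= a / 2 ^+ K.+1 /\ a / 2 ^+ K <= eta + t.
Proof.
move=> t0 eta0 etaa.
have exk : exists k : nat, a / 2 ^+ k <= eta + t.
  by apply: exists_pow2_le; rewrite ltr_wpDl.
exists (ex_minn exk); case: ex_minnP => -[|K] hK Kmin; split=> //.
  by rewrite expr1; lra.
have : eta + t < a / 2 ^+ K.
  by rewrite ltNge; apply/negP => /Kmin; rewrite ltnn.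
rewrite !exprS !invfM !mulrA => h; lra.
Qed.

End rate.

Section rate_of_convergence.
Context {R : realType} {d : nat} (phi : R -> \bar R).
Hypotheses (ephi : entropy_function phi) (dphi : differentiable_conjugate phi).
Variables (M : R -> R) (lambda l rad : R).
Hypothesis lambda0 : 0 < lambda.
Variables (mu nu : probability 'rV[R]_d R) (X : set 'rV[R]_d).
Hypotheses (mu_rad : msupport mu `<=` eball rad) (nu_rad : msupport nu `<=` eball rad)
  (nu_density : has_density_on (eball rad) nu)
  (cX : compact X) (muX : mu (~` X) = 0%E).
Local Notation E := 'rV[R]_d.
Local Notation class := (potential_class M lambda l).
Local Notation psi := (phistar phi).
Variables (z0 zt : E -> R) (C : set (E -> R)) (c : R).
Hypotheses (uot : uot_potential phi mu nu X z0) (Cclass : forall z, C z -> class z)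
  (Czt : C zt)
  (zt_mu : forall v, msupport mu v -> zt v = z0 v)
  (zt_nu : forall v, msupport nu v -> conjugate setT zt v = conjugate X z0 v)
  (c0 : 0 <= c) (cC : uniform_convexity_bound phi mu nu X z0 C c).
Context {n : nat} {dO : measure_display} {Omega : measurableType dO}.
Variables (P : probability Omega R) (x y : nat -> {RV P >-> 'rV[R]_d})
  (zhat : Omega -> E -> R).
Hypotheses (n0 : (0 < n)%N)
  (iidx : independent_samples mu n x) (iidy : independent_samples nu n y)
  (zhat_min : {ae P, forall w, C (zhat w) /\ forall z, C z ->
       let Jhat := semidual phi (empirical n (fun i => x i w))
                                (empirical n (fun i => y i w)) setT in
       (Jhat (zhat w) <= Jhat z)%E}).
Local Notation Lam := (entropy_slope phi M lambda l rad).
Local Notation ball := (@eball R d (entropy_radius M lambda l rad)).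
Local Notation Ks := (1 + lambda ^- 2).

Lemma expectation_le_chaining (N : nat -> nat)
    (net : forall k, 'I_(N k) -> E -> R) (eps : nat -> R) (K : nat) (e : R) :
  (forall k, 0 < N k)%N -> (forall i, @net 0%N i = zt) ->
  (forall k i, C (@net k i)) -> (forall k, 0 < eps k) ->
  (forall k z, C z -> exists i, forall t, ball t -> `|z t - @net k i t| <= eps k) ->
  0 < e ->
  (expectation_outer P
     (fun w => dHcirc2 phi mu nu X z0 lambda c setT (zhat w) X z0) <=
   (Ks * (2 * (2 * (Lam * eps K) +
      \sum_(k < K) (6 * (Lam * eps k) * Num.sqrt (ln (N k.+1)%:R / n%:R) + e))))%:E)%E.
Proof.
move=> N0 net0 Cnet eps0 netP e0.
have Lam0 : 0 < Lam by exact: entropy_slope_gt0.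
have rho0 k : 0 < Lam * eps k by rewrite mulr_gt0.
have bmu z : C z -> bounded_measurable setT (mu_integrand phi mu z).
  by move=> /Cclass; exact: (bounded_measurable_mu_integrand ephi dphi lambda0 mu_rad).
have bnu z : C z -> bounded_measurable setT (nu_integrand phi nu z).
  by move=> /Cclass; exact: (bounded_measurable_nu_integrand ephi dphi lambda0 nu_rad).
have netmu k z : C z -> exists i, forall t,
    `|mu_integrand phi mu z t - mu_integrand phi mu (@net k i) t| <= Lam * eps k.
  move=> Cz; have [i iP] := netP k z Cz; exists i => t.
  exact: (mu_integrand_lipschitz ephi dphi lambda0 mu_rad _ (Cclass Cz)
    (Cclass (Cnet k i)) (ltW (eps0 k)) iP).
have netnu k z : C z -> exists i, forall t,
    `|nu_integrand phi nu z t - nu_integrand phi nu (@net k i) t| <= Lam * eps k.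
  move=> Cz; have [i iP] := netP k z Cz; exists i => t.
  exact: (nu_integrand_lipschitz ephi dphi lambda0 nu_rad _ (Cclass Cz)
    (Cclass (Cnet k i)) (ltW (eps0 k)) iP).
have [g [bg gP gi]] := chaining n0 iidx bmu N0 net0 Cnet rho0 netmu K e0.
have [h [bh hP hi]] := chaining n0 iidy bnu N0 net0 Cnet rho0 netnu K e0.
set S := 2 * (Lam * eps K) + _ in gi hi *.
have Ks0 : 0 <= Ks by rewrite addr_ge0// invr_ge0 sqr_ge0.
have bgh : bounded_measurable setT (fun w => g w + h w) by exact: bounded_measurableD.
apply: (@le_trans _ _ (\int[P]_w (Ks * (g w + h w)))%:E); last first.
  rewrite lee_fin RintegralZl//; last exact: bounded_measurable_integrable.
  rewrite ler_wpM2l// RintegralD//; try exact: bounded_measurable_integrable.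
  by rewrite mulrDl mul1r lerD.
apply: expectation_outer_le.
  by apply: bounded_measurableM => //; exact: bounded_measurable_cst.
apply: negligibleS (negligibleU zhat_min (samples_in_support iidx iidy)) => w /= hw.
apply: contrapT => /not_orP[/contrapT[Cz zmin] /contrapT[Sx Sy]]; apply: hw.
have [convmu convnu] := cC Cz.
apply: le_trans (stability ephi dphi lambda0 mu_rad nu_rad nu_density cX muX uot
  (Cclass Czt) zt_mu zt_nu (Cclass Cz) c0 convmu convnu) _.
rewrite lee_fin ler_wpM2l//.
have ex := excess_le_deviation dphi lambda0 (Cclass Cz) (Cclass Czt) Sx Sy (zmin zt Czt).
apply: le_trans ex _.
by rewrite lerD// ?gP ?hP.
Qed.

End rate_of_convergence.
(** The chain starts from the single point [zt], which suffices at the scale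
    [eps 0]. Beyond level [K] the scale is frozen: nets exist at every level, as
    [chaining] wants, although only the covering numbers up to level [K] are
    assumed finite. *)
Lemma chaining_nets {R : realType} {T : Type} (C : set (T -> R)) (B : set T)
    (zt : T -> R) (eps : nat -> R) (K : nat) : C zt ->
  (forall z t, C z -> B t -> `|z t - zt t| <= 2 * eps 0%N) ->
  (exists k, (0 < k <= K)%N /\ covering_number C (sup_norm B) (eps k) = +oo%E) \/
  exists (N : nat -> nat) (net : forall k, 'I_(N k) -> T -> R),
    [/\ forall k, (0 < N k)%N, forall i, net 0%N i = zt, forall k i, C (net k i),
      forall k z, C z -> exists i, forall t, B t ->
        `|z t - net k i t| <= 2 * eps (minn k K) &
      forall k, (0 < k <= K)%N -> sqrte (metric_entropy C (sup_norm B) (eps k)) =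
        (Num.sqrt (ln (N k)%:R))%:E].
Proof.
move=> Czt C2; have [hoo|noo] := pselect (exists k, (0 < k <= K)%N /\
  covering_number C (sup_norm B) (eps k) = +oo%E); first by left.
right; have C0 : C !=set0 by exists zt.
have /choice[p pP] (k : nat) : exists p : {N : nat & 'I_N -> T -> R},
  [/\ (0 < tag p)%N, k = 0%N -> forall i, tagged p i = zt, forall i, C (tagged p i),
    forall z, C z -> exists i, forall t, B t -> `|z t - tagged p i t| <= 2 * eps (minn
      k K) &
    (0 < k <= K)%N -> sqrte (metric_entropy C (sup_norm B) (eps k)) =
      (Num.sqrt (ln (tag p)%:R))%:E].
  have [k0|k0] := eqVneq (minn k K) 0%N.
    exists (existT _ 1%N (fun=> zt)); split=> //=.
    - by move=> z Cz; exists ord0 => t Bt; rewrite k0; exact: C2.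
    - by move: k0; rewrite /minn; case: ltnP => [_ ->|+ -> /andP[]]; rewrite ?ltnn//;
        case: k.
  case/boolP: (0 < k <= K)%N => [kK|nkK].
    have [oo|[N [N0 NE [c [Cc cP]]]]] := covering_net B C0 (eps k).
      by case: noo; exists k.
    exists (existT _ N c); split=> //=.
      by move=> k00; rewrite k00 in kK.
    by move=> z Cz; move: kK => /andP[_ /minn_idPl ->]; exact: cP.
  have Kk : minn k K = K.
    by apply/minn_idPr; move: nkK k0;
      rewrite negb_and -leqNgt leqn0 -ltnNge => /orP[/eqP ->|/ltnW//]; rewrite min0n.
  have K0 : (0 < K)%N by move: k0; rewrite Kk lt0n.
  have [oo|[N [N0 NE [c [Cc cP]]]]] := covering_net B C0 (eps K).
    by case: noo; exists K; rewrite K0 leqnn.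
  exists (existT _ N c); split=> //=.
  - by move=> k00; move: k0; rewrite k00 min0n.
  - by rewrite Kk.
exists (fun k => tag (p k)), (fun k => tagged (p k)); split.
- by move=> k; have [] := pP k.
- by move=> i; have [_ /(_ erefl)] := pP 0%N.
- by move=> k; have [] := pP k.
- by move=> k; have [] := pP k.
- by move=> k; have [] := pP k.
Qed.

Theorem proposition3 (R : realType) (M : R -> R) (rad lambda l : R)
    (hlambda : 0 < lambda) :
  exists2 R' : R, 0 < R' &
  forall phi : R -> \bar R,
    entropy_function phi -> differentiable_conjugate phi ->
  exists M' L : R, [/\ 0 < M', 0 < L &
  forall (d : nat) (mu nu : probability 'rV[R]_d R) (X : set 'rV[R]_d)
    (z0 : 'rV[R]_d -> R) (C : set ('rV[R]_d -> R)) (C' : R)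
    (n : nat) (dO : measure_display) (Omega : measurableType dO)
    (P : probability Omega R) (x y : nat -> {RV P >-> 'rV[R]_d})
    (zhat : Omega -> 'rV[R]_d -> R) (delta : R),
    msupport mu `<=` eball rad -> msupport nu `<=` eball rad ->
    has_density_on (eball rad) mu -> has_density_on (eball rad) nu ->
    compact X -> mu (~` X) = 0%E ->
    uot_potential phi mu nu X z0 ->
    (forall z, C z -> forall r, 0 <= r -> forall v, eball r v -> `|z v| <= M r) ->
    (forall z, C z -> forall v, l <= z v) ->
    (forall z, C z -> strongly_convex lambda z) ->
    (exists2 z0t, C z0t &
       (forall v, msupport mu v -> z0t v = z0 v) /\
       (forall v, msupport nu v -> conjugate setT z0t v = conjugate X z0 v)) ->
    0 <= C' -> uniform_convexity_bound phi mu nu X z0 C C' ->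
    (0 < n)%N ->
    independent_samples mu n x -> independent_samples nu n y ->
    {ae P, forall w, C (zhat w) /\ forall z, C z ->
       let Jhat := semidual phi (empirical n (fun i => x i w))
                                (empirical n (fun i => y i w)) setT in
       (Jhat (zhat w) <= Jhat z)%E} ->
    0 <= delta <= M' / L ->
    (expectation_outer P
       (fun w => dHcirc2 phi mu nu X z0 lambda C' setT (zhat w) X z0)
     <= 64%:E * (delta%:E + (Num.sqrt n%:R)^-1%:E *
          \int[lebesgue_measure]_(u in `[(delta / 4)%R, (M' / L)%R])
            sqrte (metric_entropy C (sup_norm (eball R')) (L * u)%R)))%E].
Proof.
pose R' := entropy_radius M lambda l rad.
have R'0 : 0 < R'.
  by rewrite /R' /entropy_radius ltr_pwDl// (lt_le_trans ltr01)// conj_radius_gt1.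
exists R' => // phi ephi dphi.
(* [M'] exceeds the diameter of [C] on the ball of radius [R'], so that the chain
   can start from one point. *)
pose Lam := entropy_slope phi M lambda l rad; pose Ks := 1 + lambda ^- 2.
have Lam0 : 0 < Lam by exact: entropy_slope_gt0.
have Ks0 : 0 < Ks by rewrite ltr_pwDl// invr_ge0 sqr_ge0.
pose L := (2 * Lam * Ks)^-1; pose M' := 2 * `|M R'| + 1.
have L0 : 0 < L by rewrite invr_gt0 !mulr_gt0.
(* This is where the smallness of [L] absorbs the constants. *)
have LE : Lam * Ks = (2 * L)^-1.
  by rewrite /L; field; rewrite !gt_eqF.
have M'0 : 0 < M' by rewrite ltr_wpDl// mulr_ge0.
exists M', L; split=> // d mu nu X z0 C C' n dO Omega P x y zhat delta
  mu_rad nu_rad _ nu_density cX muX uot CM Cl Clam [zt Czt [ztmu ztnu]] C'0 cC n0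
  iidx iidy zhat_min /andP[delta0 deltaM].
have Cclass z : C z -> potential_class M lambda l z.
  by move=> Cz; split; [exact: CM|exact: Cl|exact: Clam].
pose f u := sqrte (metric_entropy C (sup_norm (@eball R d R')) (L * u)).
have C0 : C !=set0 by exists zt.
have f0 u : (0 <= f u)%E by exact: sqrte_ge0.
have f_ni u v : u <= v -> (f v <= f u)%E.
  by move=> uv; apply: sqrt_entropy_nonincreasing => //; rewrite ler_pM2l.
pose Int := (\int[lebesgue_measure]_(u in `[(delta / 4)%R, (M' / L)%R]) f u)%E.
rewrite -/Int.
have Int0 : (0 <= Int)%E by exact: integral_ge0.
have n1 : 0 < Num.sqrt n%:R :> R by rewrite sqrtr_gt0 ltr0n.
apply/lee_addgt0Pr => t t0.
have eta0 : 0 <= L * delta by rewrite mulr_ge0// ltW.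
have etaM : L * delta <= M' by rewrite mulrC -ler_pdivlMr.
have Lt0 : 0 < L * t / 8 by rewrite divr_gt0// mulr_gt0.
(* The slack [L * t / 8] in the finest scale costs [t / 2] in the bound. *)
have [K [K1 K2]] := exists_scale Lt0 eta0 etaM.
pose eps k := M' / 2 ^+ k.
have eps0 k : 0 < eps k by rewrite divr_gt0// exprn_gt0.
have epsS k : eps k.+1 = eps k / 2 by rewrite /eps exprS invfM mulrCA mulrC.
pose s k := eps k.+1 / L.
have sS k : s k - s k.+1 = eps k.+1 / (2 * L).
  by rewrite /s (epsS k.+1); field; rewrite gt_eqF.
have sd k : s k.+1 <= s k.
  by rewrite -subr_ge0 sS divr_ge0 ?ltW// mulr_gt0.
have s_anti i j : (i <= j)%N -> s j <= s i.
  by move=> ij; rewrite -(subnK ij); elim: (j - i)%N => // m IH;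
    rewrite addSn (le_trans (sd _)).
have s0M : s 0%N <= M' / L.
  have LV0 : 0 <= L^-1 by rewrite invr_ge0 ltW.
  apply: ler_wpM2r => //; rewrite /eps expr1 ler_pdivrMr// ler_peMr ?(ltW M'0)//.
  by rewrite ler1n.
have fs k : f (s k) = sqrte (metric_entropy C (sup_norm (@eball R d R')) (eps k.+1)).
  by rewrite /f /s; congr (sqrte (metric_entropy _ _ _)); field; rewrite gt_eqF.
have sK : delta / 4 <= s K.
  by rewrite /s ler_pdivlMr// mulrC mulrA -/(eps K.+1).
have cover0 z v : C z -> eball R' v -> `|z v - zt v| <= 2 * eps 0%N.
  move=> Cz vR; rewrite /eps expr0 divr1 (le_trans (ler_normB _ _))//.
  have := le_trans (CM z Cz R' (ltW R'0) v vR) (ler_norm _).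
  have := le_trans (CM zt Czt R' (ltW R'0) v vR) (ler_norm _).
  have := normr_ge0 (M R'); rewrite /M'; lra.
have [[k [/andP[k0 kK] covoo]]|[N [net [N0 net0 Cnet netP NE]]]] :=
    chaining_nets K Czt cover0.
  (* The entropy is infinite on the interval just below the scale [eps k], which
     lies in the domain of integration. *)
  have Intoo : Int = +oo%E.
    apply/eqyP => A A0; have [k' kE] : exists k', k = k'.+1 by case: k k0 {kK covoo} =>
      // k' _; exists k'.
    pose len := s k' - s k'.+1.
    have len0 : 0 < len by rewrite /len sS divr_gt0// mulr_gt0.
    have := @nonincreasing_integral_ge _ f f0 f_ni (fun i => s (k' + i)%N) (fun=> A / len)
      (delta / 4) (M' / L) 1.
    have lenE : len * (A / len) = A by rewrite mulrC divfK ?gt_eqF.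
    rewrite big_ord_recr big_ord0 /= addn0 addn1 add0r -/len lenE; apply.
    - by case=> // _; rewrite addn0 addn1.
    - by rewrite (le_trans (s_anti 0%N k' _)).
    - by rewrite (le_trans sK)// s_anti// -kE.
    - by move=> _ _; rewrite divr_ge0// ltW.
    - case=> // _; rewrite addn0 fs -kE.
      by rewrite /metric_entropy covoo/= leey.
  rewrite Intoo gt0_muley ?lte_fin ?invr_gt0// addey// gt0_muley ?lte_fin//.
  by rewrite addye// leey.
(* The slack [e] is paid for both measures on each of the [K] links, and is
   multiplied by [Ks]: at most [t / 2] in all. *)
pose e := t / (4 * Ks * K.+1%:R).
have e0 : 0 < e by rewrite divr_gt0// !mulr_gt0.
have eps20 k : 0 < 2 * eps (minn k K) by rewrite mulr_gt0.
have := expectation_le_chaining ephi dphi hlambda mu_rad nu_rad nu_density cX muX uot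
  Cclass Czt ztmu ztnu C'0 cC n0 iidx iidy zhat_min K N0 net0 Cnet eps20 netP e0.
move=> /le_trans; apply; rewrite -/Lam -/Ks.
pose h k := Num.sqrt (ln (N k)%:R) : R.
pose S := \sum_(k < K) (s k - s k.+1) * h k.+1.
have S0 : 0 <= S.
  by apply: sumr_ge0 => k _; rewrite mulr_ge0 ?sqrtr_ge0// subr_ge0.
have SInt : (S%:E <= Int)%E.
  apply: (@nonincreasing_integral_ge _ f f0 f_ni s (fun k => h k.+1)) => // k kK.
    exact: sqrtr_ge0.
  by rewrite fs NE//= ltn0Sn.
have sumE : \sum_(k < K) (6 * (Lam * (2 * eps (minn k K))) *
      Num.sqrt (ln (N k.+1)%:R / n%:R) + e) =
    48 * Lam * L * (Num.sqrt n%:R)^-1 * S + K%:R * e.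
  rewrite big_split/= sumr_const card_ord -[e *+ K]mulr_natl; congr (_ + _).
  rewrite /S mulr_sumr; apply: eq_bigr => k _.
  rewrite sqrtrM ?ln_ge0 ?ler1n// sqrtrV ?ler0n// -/(h k.+1) sS epsS.
  rewrite (minn_idPl (ltnW (ltn_ord k))).
  by field; rewrite !gt_eqF.
rewrite minnn sumE.
have -> : Ks * (2 * (2 * (Lam * (2 * eps K)) +
    (48 * Lam * L / Num.sqrt n%:R * S + K%:R * e))) =
    8 * (Lam * Ks) * eps K + 96 * (Lam * Ks) * L * ((Num.sqrt n%:R)^-1 * S) + 2 * Ks *
      K%:R * e.
  by ring.
rewrite LE.
have -> : 96 * (2 * L)^-1 * L * ((Num.sqrt n%:R)^-1 * S) = 48 * ((Num.sqrt n%:R)^-1 * S).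
  by field; rewrite !gt_eqF.
have b1 : 8 * (2 * L)^-1 * eps K <= 4 * delta + t / 2.
  have -> : 8 * (2 * L)^-1 * eps K = 4 / L * eps K by field; rewrite gt_eqF.
  have -> : 4 * delta + t / 2 = 4 / L * (L * delta + L * t / 8) by field; rewrite gt_eqF.
  by rewrite ler_wpM2l// divr_ge0// ltW.
have b2 : 2 * Ks * K%:R * e <= t / 2.
  have -> : t / 2 = 2 * Ks * K.+1%:R * e.
    by rewrite /e; field; rewrite !gt_eqF.
  by rewrite ler_wpM2r ?(ltW e0)// ler_wpM2l ?ler_nat// mulr_ge0// ltW.
apply: (@le_trans _ _ ((64 * (delta + (Num.sqrt n%:R)^-1 * S) + t)%:E)).
  have nS : 0 <= (Num.sqrt n%:R)^-1 * S by rewrite mulr_ge0// invr_ge0 ltW.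
  by rewrite lee_fin; lra.
rewrite EFinD leeD2r// EFinM lee_wpmul2l// EFinD leeD2l// EFinM lee_wpmul2l//.
Qed.
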